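(* Let $d \geq 3$, $\varepsilon > 0$ and $N \geq 3$. Then \[ \lim_{X \to \infty} \frac{1}{\# \mathscr{P}_d(X)} \cdot \# \left\{ \psi_{\mathbf{a}} \in \mathscr{P}_d(X) : d\left(1 - \frac{4}{d+3}\right) - \varepsilon < \frac{\lambda_2(\psi_{\mathbf{a}})}{\lambda_1(\psi_{\mathbf{a}})} \leq d + \varepsilon \right\} = 1, \] and \[ \lim_{X \to \infty} \frac{1}{\# \mathscr{P}_d(X)} \cdot \# \left\{ \psi_{\mathbf{a}} \in \mathscr{P}_d(X) : 1 \leq \frac{\lambda_N(\psi_{\mathbf{a}})}{\lambda_2(\psi_{\mathbf{a}})} \leq 1 + \frac{4}{d-1} + \varepsilon \right\} = 1. \]
   Context: Let $d \geq 2$. Let $\mathbb{Z}^d_{\mathrm{prim}}$ be the set of $(x_1,\dots,x_d) \in \mathbb{Z}^d$ with $\gcd(x_1,\dots,x_d)=1$. Let $\mathscr{P}_d$ be the set of polynomials $\psi_{\mathbf{a}} \in \mathbb{Q}[z]$ indexed by $\mathbf{a} = (a_d, a_{d-2}, \dots, a_1, a_0) \in \mathbb{Z}^d_{\mathrm{prim}}$ with $a_d \neq 0$, $a_0 > 0$, where $\psi_{\mathbf{a}}(z) = \frac{a_d}{a_0} z^d + \frac{a_{d-2}}{a_0} z^{d-2} + \cdots + \frac{a_1}{a_0} z + 1$. Let $\mathscr{H}(\psi_{\mathbf{a}}) = \max\{|a_d|, |a_{d-2}|, \dots, |a_1|, a_0\}$ and $\mathscr{P}_d(X) = \{\psi_{\mathbf{a}}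 \in \mathscr{P}_d : \mathscr{H}(\psi_{\mathbf{a}}) \leq X\}$. Let $h$ be the logarithmic Weil height on $\mathbb{Q}$ and $\hat{h}_{\psi_{\mathbf{a}}}(z) = \lim_{n \to \infty} d^{-n} h(\psi_{\mathbf{a}}^n(z))$ the canonical height ($\psi^n$ the $n$-th iterate). A vector $(z_1,\dots,z_N) \in \mathbb{Q}^N$ is $\psi_{\mathbf{a}}$-dynamically independent if there is no nonzero polynomial $\mathbf{P} \in \overline{\mathbb{Q}}[X_1,\dots,X_N]$ with $\mathbf{P}(z_1,\dots,z_N)=0$ and such that for all $(\xi_1,\dots,\xi_N) \in \overline{\mathbb{Q}}^N$, $\mathbf{P}(\xi_1,\dots,\xi_N)=0$ implies $\mathbf{P}(\psi_{\mathbf{a}}(\xi_1),\dots,\psi_{\mathbf{a}}(\xi_N))=0$. For $N \geq 1$, the $N$-th dynamical successive minimum is $\lambda_N(\psi_{\mathbf{a}}) = \min\{\max_{1 \leq i \leq N} \hat{h}_{\psi_{\mathbf{a}}}(z_i) : (z_1,\dots,z_N) \in \mathbb{Q}^N \text{ is } \psi_{\mathbf{a}}\text{-dynamically independent}\}$. (For $N=1$ this is the minimum of $\hat{h}_{\psi_{\mathbf{a}}}$ over rational non-preperiodic points, which is positive.) *)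

(* Defs.v *)
From mathcomp Require Import all_boot all_order all_algebra algC finmap.
From mathcomp Require Import all_classical all_reals all_analysis.
From mathcomp Require mpoly.
(* A full Import of mpoly clashes with the notations of mathcomp-analysis. *)
Import (canonicals, coercions) mpoly.

Set Implicit Arguments.
Unset Strict Implicit.
Unset Printing Implicit Defensive.

Import Order.TTheory GRing.Theory Num.Theory.
Import numFieldNormedType.Exports.

Local Open Scope classical_set_scope.
Local Open Scope ring_scope.

(* The vector (a_d, a_(d-2), ..., a_1, a_0) is encoded as the d-tuple
   [:: a_0; a_1; ...; a_(d-2); a_d] : entry i is the coefficient a_i for
   i <= d - 2, and the last entry (i = d - 1) is the leading one a_d. *)

Definition param (d : nat) (a : d.-tuple int) : Prop :=
  [/\ \big[gcdn/0%N]_(x <- a) `|x|%N = 1%N, a`_(d.-1) != 0 & 0 < a`_0].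

Definition psi (d : nat) (a : d.-tuple int) : {poly rat} :=
  ((a`_(d.-1))%:~R / (a`_0)%:~R) *: 'X^d
  + \sum_(1 <= i < d.-1) ((a`_i)%:~R / (a`_0)%:~R) *: 'X^i
  + 1.

Definition coefH (d : nat) (a : d.-tuple int) : nat :=
  \max_(x <- a) `|x|%N.

Definition polysH (R : realType) (d : nat) (X : R) : set {poly rat} :=
  [set psi a | a in [set a : d.-tuple int | param a /\ (coefH a)%:R <= X]].

(* Logarithmic Weil height on Q; numq and denq are coprime. *)
Definition weil_height (R : realType) (x : rat) : R :=
  ln (maxn `|numq x|%N `|denq x|%N)%:R.

(* d is meant to be the degree of p. *)
Definition canonical_height (R : realType) (d : nat) (p : {poly rat})
    (x : rat) : R :=
  limn (fun n : nat => weil_height R (iter n (horner p) x) / d%:R ^+ n).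

Definition dyn_independent (p : {poly rat}) (N : nat) (z : N.-tuple rat)
    : Prop :=
  ~ exists P : mpoly.mpoly N algC,
      [/\ P != 0,
          mpoly.meval (fun i => ratr (tnth z i)) P = 0 &
          forall xi : 'I_N -> algC,
            mpoly.meval xi P = 0 ->
            mpoly.meval (fun i => (map_poly ratr p).[xi i]) P = 0].

(* Canonical heights are nonnegative, so for N >= 1 taking 0 as the base of
   the iterated maximum does not change its value. *)
Definition indep_heights (R : realType) (d : nat) (p : {poly rat})
    (N : nat) : set R :=
  [set \big[Num.max/0]_(i < N) canonical_height R d p (tnth z i)
    | z in [set z : N.-tuple rat | dyn_independent p z]].

(* [succ_min d p N l] says that the minimum defining the N-th dynamical
   successive minimum of p (of degree d) is attained and equal to l. *)
Definition succ_min (R : realType) (d : nat) (p : {poly rat})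
    (N : nat) (l : R) : Prop :=
  indep_heights d p N l /\ lbound (indep_heights d p N) l.

(* Only meaningful when A is finite and B is a finite nonempty set. *)
Definition proportion (R : realType) (T : choiceType) (A B : set T) : R :=
  #|` fset_set A|%:R / #|` fset_set B|%:R.

(* Main.v *)
(* Write psi = F / a_0 with F integral, F(0) = a_0, and let L = log X.
   Since F has no term in z^(d-1), the denominators along the orbit of
   z = p/q grow prime by prime as fast as a_0 allows, up to the cancellation
   of gcd(F(p,q), a_0), where F(p,q) is the binary form of F; hence
     hhat(z) >= (log |a_0| - log gcd(F(p,q), a_0)) / (d-1) + h(z)/2 - small
   as soon as a_0 and a_d are of size X, have a small gcd, a_0 has few divisors
   and a_d is almost squarefree.  By Markov's inequality, for almost all a the
   gcd is at most Y^2 for all z <> 0 with h(z) <= log Y (and small at z = 1).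
   The choice Y = X^(2/(d+3)) balances the two terms, which gives
   hhat(z) >= L/(d+3) for z <> 0 up to o(L).  As psi(0) = 1, this also gives
   hhat(0) = hhat(1)/d = L/(d(d-1)) up to o(L).  Therefore lambda_1 is
   asymptotic to L/(d(d-1)), and lambda_N >= lambda_2 >= L/(d+3) because two
   independent points are not both 0.

   For the upper bound lambda_N <= L/(d-1) it suffices to find N independent
   points of bounded height.  For almost all a there are N distinct primes l_j,
   bounded independently of X and not dividing a_0 a_d, such that psi has modulo
   l_j a noncritical fixed point r_j: a fixed residue is missing for a positive
   proportion of the values of a_1 only, so among many primes one works, by the
   Chinese remainder theorem.  Take z_j = n_j / l_j with n_j = l_j r_i mod l_i
   for i <> j.  Then the orbit of z_j escapes to infinity l_j-adically, while
   the other points are l_j-adically recurrent, psi being an isometry on the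
   residue disc of r_j; so the leading coefficient in X_j of a polynomial
   vanishing on the joint orbit also vanishes on it, and by induction the
   joint orbit is Zariski dense. *)

(* One parameter b, about X^(1/J) with J large but fixed, controls the exceptional sets: those not
   tied to the primes l_j have density O(log X / b), while avoiding them costs only O(log b) in each
   height estimate, less than any prescribed multiple of L. The candidates for the l_j are fixed
   before X; their number and size make the remaining exceptions rare. The exponent of Y comes from
   two competing estimates. About Y^2 rationals have height at most Y, so averaging over them loses
   a gcd of size Y^2 and leaves (L - 2 log Y)/(d-1). For larger heights only the trivial bound gcd
   <= |a_0| is available, and the term h(z)/2 > (log Y)/2 has to suffice. The two agree when log Y =
   2L/(d+3). The coefficient 1/2 of h(z) is the price of cancellation against a_d: at a prime l,
   half of the valuation of the denominator of z pays for the factors l of a_d that may cancel once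
   the square part of a_d is set aside. The constants of the theorem are the ratios of the levels
   1/(d(d-1)), 1/(d+3) and 1/(d-1): one has d(d-1)/(d+3) = d(1 - 4/(d+3)) and (d+3)/(d-1) = 1 +
   4/(d-1). *)
Require Import Defs.
From mathcomp Require Import all_boot all_order all_algebra.
From mathcomp Require Import all_classical all_reals all_analysis.
From mathcomp Require Import algC algnum fieldext finmap.
From mathcomp Require mpoly.
Import (canonicals, coercions) mpoly.
From mathcomp Require Import zify ring lra.

Set Implicit Arguments.
Unset Strict Implicit.
Unset Printing Implicit Defensive.

Import Order.TTheory GRing.Theory Num.Theory.
Import numFieldNormedType.Exports.

Local Open Scope classical_set_scope.
Local Open Scope ring_scope.

(** * Adic recurrence and dynamical independence *)

(* For [l] prime: the [l]-adic valuation of [x] is at least [k]. *)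
Definition ldiv (l k : nat) (x : rat) : Prop :=
  exists u v : int,
    ~~ (l%:Z %| v)%Z /\ x * v%:~R = l%:R ^+ k * u%:~R.

Section Ldiv.
Variable l : nat.
Hypothesis pr_l : prime l.

Lemma prime_dvdzM (u v : int) :
  (l%:Z %| u * v)%Z = (l%:Z %| u)%Z || (l%:Z %| v)%Z.
Proof. by rewrite !dvdzE abszM /= Euclid_dvdM. Qed.

Lemma ldiv_le j k x : (j <= k)%N -> ldiv l k x -> ldiv l j x.
Proof.
move=> le_jk [u [v [nv e]]]; exists (l%:Z ^+ (k - j) * u), v; split=> //.
by rewrite e rmorphM rmorphXn /= mulrA -exprD subnKC.
Qed.

Lemma ldiv_int (m : int) : ldiv l 0 m%:~R.
Proof.
exists m, 1; split; last by rewrite expr0 mulr1 mul1r.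
by rewrite dvdzE /= dvdn1 neq_ltn prime_gt1 // orbT.
Qed.

Lemma ldiv_dvd k (m : int) : ((l ^ k)%N%:Z %| m)%Z -> ldiv l k m%:~R.
Proof.
case/dvdzP=> c ->; exists c, 1; split.
  by rewrite dvdzE /= dvdn1 neq_ltn prime_gt1 // orbT.
by rewrite mulr1 rmorphM /= mulrC -pmulrn natrX.
Qed.

Lemma ldiv0 k : ldiv l k 0.
Proof. by have := @ldiv_dvd k 0 (dvdz0 _). Qed.

Lemma ldivM j k x y : ldiv l j x -> ldiv l k y -> ldiv l (j + k) (x * y).
Proof.
move=> [u [v [nv e]]] [u' [v' [nv' e']]]; exists (u * u'), (v * v').
split; first by rewrite prime_dvdzM negb_or nv.
by rewrite !rmorphM /= mulrACA e e' exprD; ring.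
Qed.

Lemma ldivMl k x y : ldiv l 0 x -> ldiv l k y -> ldiv l k (x * y).
Proof. exact: ldivM. Qed.

Lemma ldivD k x y : ldiv l k x -> ldiv l k y -> ldiv l k (x + y).
Proof.
move=> [u [v [nv e]]] [u' [v' [nv' e']]]; exists (u * v' + u' * v), (v * v').
split; first by rewrite prime_dvdzM negb_or nv.
rewrite rmorphD !rmorphM /=.
have -> : (x + y) * (v%:~R * v'%:~R) = x * v%:~R * v'%:~R + y * v'%:~R * v%:~R by ring.
by rewrite e e'; ring.
Qed.

Lemma ldivN k x : ldiv l k x -> ldiv l k (- x).
Proof.
by move=> [u [v [nv e]]]; exists (- u), v; split=> //; rewrite mulNr e rmorphN mulrN.
Qed.

Lemma ldivB k x y : ldiv l k x -> ldiv l k y -> ldiv l k (x - y).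
Proof. by move=> Dx Dy; apply/ldivD/ldivN. Qed.

Lemma ldiv_sum k (I : Type) (s : seq I) (P : pred I) (F : I -> rat) :
  (forall i, P i -> ldiv l k (F i)) -> ldiv l k (\sum_(i <- s | P i) F i).
Proof. by move=> DF; elim/big_ind: _ => //; [exact: ldiv0 | exact: ldivD]. Qed.

Lemma ldivX x n : ldiv l 0 x -> ldiv l 0 (x ^+ n).
Proof.
move=> Dx; elim: n => [|n IHn]; first by rewrite expr0; apply: (ldiv_int 1).
by rewrite exprS; apply: ldivMl.
Qed.

(** Taking for [k] the absolute value of the numerator is enough: [l ^ k] would divide a nonzero
    numerator that it exceeds. *)
Lemma ldiv_eq0 x : (forall k, ldiv l k x) -> x = 0.
Proof.
move=> Dx; apply/eqP; rewrite -numq_eq0 -absz_eq0; apply/negP => /negP n0.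
have [u [v [nv e]]] := Dx `|numq x|%N.
have {}e : numq x * v = (l ^ `|numq x|)%N%:Z * (u * denq x).
  apply: (@intr_inj rat).
  rewrite !rmorphM /=.
  have := congr1 (fun t => t * (denq x)%:~R) e.
  rewrite /= mulrAC numqE => ->.
  by rewrite -pmulrn natrX; ring.
have: ((l ^ `|numq x|)%N %| `|numq x|)%N.
  rewrite -(@Gauss_dvdl _ _ `|v|); last first.
    by rewrite coprime_pexpl ?lt0n // prime_coprime.
  by rewrite -abszM e abszM dvdn_mulr.
move/dvdn_leq; rewrite lt0n => /(_ n0); rewrite leqNgt ltn_expl ?prime_gt1 //.
Qed.

(** The pair [ldiv l 0 x], [~ ldiv l 1 x] says that [x] is an l-adic unit; units appear in this form
    below. *)
Lemma ldiv_unitM k x y : ldiv l 0 x -> ~ ldiv l 1 x -> ldiv l k (x * y) -> ldiv l k y.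
Proof.
move=> [u [v [nv e]]] nx [u' [v' [nv' e']]].
have nu : ~~ (l%:Z %| u)%Z.
  apply/negP=> /dvdzP[c uE]; apply: nx; exists c, v; split=> //.
  by rewrite e uE rmorphM /= expr0 expr1 mul1r mulrC.
exists (u' * v), (u * v'); split; first by rewrite prime_dvdzM negb_or nu.
rewrite !rmorphM /=; move: e; rewrite expr0 mul1r => <-.
have -> : y * (x * v%:~R * v'%:~R) = x * y * v'%:~R * v%:~R by ring.
by rewrite e'; ring.
Qed.

(** The denominator is invertible modulo [l ^ k] by Bezout. This makes the residue classes a finite
    set, ready for the pigeonhole principle. *)
Lemma ldiv_residue k x : ldiv l 0 x ->
  exists m : 'I_(l ^ k), ldiv l k (x - (m : nat)%:R).
Proof.
move=> [u [v [nv]]]; rewrite expr0 mul1r => e.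
have lk_gt0 : (0 < l ^ k)%N by rewrite expn_gt0 prime_gt0.
have cop : coprimez v (l ^ k)%N%:Z.
  by rewrite coprimezE /= coprime_sym coprimeXl // prime_coprime.
have [[a b] /= ab] := coprimezP _ _ cop.
pose m := ((u * a) %% (l ^ k)%N%:Z)%Z.
have m_ge0 : 0 <= m by rewrite modz_ge0 // -lt0n.
have lt_m : (`|m|%N < l ^ k)%N.
  by rewrite -ltz_nat gez0_abs // ltz_pmod // ltz_nat.
exists (Ordinal lt_m) => /=.
exists (b * u + v * ((u * a) %/ (l ^ k)%N%:Z)%Z), v; split=> //.
rewrite mulrBl e.
have -> : (`|m|%N%:R : rat) = m%:~R by rewrite pmulrn gez0_abs.
have mE : m = u * a - ((u * a) %/ (l ^ k)%N%:Z)%Z * (l ^ k)%N%:Z.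
  by rewrite {1}(divz_eq (u * a) (l ^ k)%N%:Z) addrC addKr.
rewrite mE -natrX -[(l ^ k)%N%:R]/((l ^ k)%N%:~R) -!rmorphM /= -rmorphB /= -?rmorphM /=.
congr (_%:~R).
have {1}-> : u = u * (a * v + b * (l ^ k)%N%:Z) by rewrite ab mulr1.
ring.
Qed.

End Ldiv.

(** * Polynomial maps on l-integral points: isometry on a disc and recurrence of orbits *)

Section LdivPoly.
Variable l : nat.
Hypothesis pr_l : prime l.
Variable p : {poly rat}.
Hypothesis p_int : forall i, ldiv l 0 p`_i.

Lemma ldiv_subXX k x y n : ldiv l 0 x -> ldiv l 0 y -> ldiv l k (x - y) ->
  ldiv l k (x ^+ n - y ^+ n).
Proof.
move=> Dx Dy Dxy; rewrite subrXX mulrC; apply: ldivMl => //.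
by apply: ldiv_sum => // i _; apply: ldivMl => //; apply: ldivX.
Qed.

Lemma ldiv_horner_sub k x y : ldiv l 0 x -> ldiv l 0 y -> ldiv l k (x - y) ->
  ldiv l k (p.[x] - p.[y]).
Proof.
move=> Dx Dy Dxy; rewrite !horner_coef -sumrB; apply: ldiv_sum => // i _.
by rewrite -mulrBr; apply: ldivMl => //; apply: ldiv_subXX.
Qed.

(** The inner sum is left unevaluated so that it is, term by term, the diagonal value of the
    difference quotient with terms x^(i-1-j) y^j. *)
Lemma horner_deriv_coef (r : rat) :
  p^`().[r] = \sum_(i < size p) p`_i * (\sum_(j < i) r ^+ i.-1).
Proof.
rewrite /deriv horner_poly.
case: (size p) => [|n]; first by rewrite !big_ord0.
rewrite big_ord_recl /= big_ord0 mulr0 add0r; apply: eq_bigr => i _.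
by rewrite sumr_const card_ord /bump /= add1n mulrnAr mulrnAl.
Qed.

(* [p] is an [l]-adic isometry on the residue disc of [r]: the difference
   quotient of [p] there is congruent to the unit [p'(r)]. *)
Lemma ldiv_horner_isometry k r x y : ldiv l 0 r -> ~ ldiv l 1 p^`().[r] ->
  ldiv l 1 (x - r) -> ldiv l 1 (y - r) ->
  ldiv l k (p.[x] - p.[y]) -> ldiv l k (x - y).
Proof.
move=> Dr ndr Dxr Dyr Dp.
have D0 t : ldiv l 1 (t - r) -> ldiv l 0 t.
  by move=> Dtr; rewrite -[t](subrK r); apply: ldivD => //; apply: ldiv_le Dtr.
have [Dx Dy] := (D0 _ Dxr, D0 _ Dyr).
pose S := \sum_(i < size p) p`_i * (\sum_(j < i) x ^+ (i.-1 - j) * y ^+ j).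
have pS : p.[x] - p.[y] = S * (x - y).
  rewrite !horner_coef -sumrB mulr_suml; apply: eq_bigr => i _.
  by rewrite -mulrBr subrXX mulrCA mulrC.
have DS : ldiv l 1 (S - p^`().[r]).
  rewrite horner_deriv_coef -sumrB; apply: ldiv_sum => // i _.
  rewrite -mulrBr; apply: ldivMl => //; rewrite -sumrB; apply: ldiv_sum => // j _.
  have -> : r ^+ i.-1 = r ^+ (i.-1 - j) * r ^+ j.
    by rewrite -exprD subnK //; case: (i : nat) j => [[]//|m [j]] /=; rewrite ltnS.
  set a := x ^+ _; set b := y ^+ _; set a' := r ^+ _; set b' := r ^+ _.
  have -> : a * b - a' * b' = a * (b - b') + b' * (a - a') by ring.
  by apply: ldivD => //; apply: ldivMl => //;
    first [exact: ldivX | exact: ldiv_subXX].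
have S0 : ldiv l 0 S.
  apply: ldiv_sum => // i _; apply: ldivMl => //; apply: ldiv_sum => // j _.
  by apply: ldivMl => //; apply: ldivX.
apply: (ldiv_unitM pr_l S0); last by rewrite -pS.
move=> S1; apply: ndr; have -> : p^`().[r] = S - (S - p^`().[r]) by ring.
exact: ldivB.
Qed.

Section Orbit.
Variable r : rat.
Hypotheses (r_int : ldiv l 0 r) (r_fix : ldiv l 1 (p.[r] - r)).
Hypothesis r_unit : ~ ldiv l 1 p^`().[r].
Variables (m : nat) (z : 'I_m -> rat).
Hypothesis z_r : forall i, ldiv l 1 (z i - r).

Lemma orbit_near n i : ldiv l 1 (iter n (horner p) (z i) - r).
Proof.
elim: n => [|n IHn] //=.
set t := iter n _ _ in IHn *.
have -> : p.[t] - r = (p.[t] - p.[r]) + (p.[r] - r) by ring.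
apply: ldivD => //; apply: ldiv_horner_sub => //.
by rewrite -[t](subrK r); apply: ldivD => //; apply: ldiv_le IHn.
Qed.

Lemma orbit_int n i : ldiv l 0 (iter n (horner p) (z i)).
Proof.
rewrite -[iter _ _ _](subrK r); apply: ldivD => //.
exact: (ldiv_le _ (orbit_near n i)).
Qed.

(** The isometry property lets a congruence between two times of an orbit be pulled back step by
    step towards time 0. *)
Lemma orbit_cancel k a b n i :
  ldiv l k (iter (n + a) (horner p) (z i) - iter (n + b) (horner p) (z i)) ->
  ldiv l k (iter a (horner p) (z i) - iter b (horner p) (z i)).
Proof.
elim: n => [//|n IHn]; rewrite !addSn !iterS => /ldiv_horner_isometry D.
by apply/IHn/(D r) => //; apply: orbit_near.
Qed.

Lemma orbit_shift k a b n i :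
  ldiv l k (iter a (horner p) (z i) - iter b (horner p) (z i)) ->
  ldiv l k (iter (n + a) (horner p) (z i) - iter (n + b) (horner p) (z i)).
Proof.
move=> D; elim: n => [//|n IHn]; rewrite !addSn !iterS.
by apply: ldiv_horner_sub => //; apply: orbit_int.
Qed.

(** Two times [a < b] give the same residues modulo [l ^ k] for all points simultaneously, by the
    pigeonhole principle on vectors of residues. Pulled back to time 0, this says that [b - a] is a
    return time of the starting points, hence a period modulo [l ^ k] of the whole orbit. *)
Lemma orbit_recurrent k n : exists2 T, (0 < T)%N & forall s i,
  ldiv l k (iter (n + s * T) (horner p) (z i) - iter n (horner p) (z i)).
Proof.
pose y a i := iter a (horner p) (z i).
have /choice [f fP] : forall a, exists g : {ffun 'I_m -> 'I_(l ^ k)},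
    forall i, ldiv l k (y a i - (g i : nat)%:R).
  move=> a.
  have [g gP] := choice (fun i => ldiv_residue pr_l k (orbit_int a i)).
  by exists [ffun i => g i] => i; rewrite ffunE; apply: gP.
have [a [b [lt_ab e]]] : exists a b : nat, (a < b)%N /\ f a = f b.
  pose K := #|{: {ffun 'I_m -> 'I_(l ^ k)}}|.
  have /injectivePn [a [b ab e]] : ~~ injectiveb (fun a : 'I_K.+1 => f a).
    by apply/injectiveP => /leq_card; rewrite card_ord ltnn.
  have [lt|lt|e1] := ssrnat.ltngtP a b; first by exists a, b.
    by exists b, a.
  by rewrite (ord_inj e1) eqxx in ab.
have D0 i : ldiv l k (y (b - a)%N i - y 0%N i).
  apply: (@orbit_cancel k (b - a) 0 a i); rewrite addn0 subnKC ?(ltnW lt_ab) //.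
  rewrite -/(y b i) -/(y a i).
  have -> : y b i - y a i = (y b i - (f b i)%:R) - (y a i - (f a i)%:R).
    by rewrite e; ring.
  exact: ldivB.
exists (b - a)%N; first by rewrite subn_gt0.
move=> s i; elim: s => [|s IHs]; first by rewrite addn0 subrr; apply: ldiv0.
have := orbit_shift (n + s * (b - a)) (D0 i).
rewrite addn0 -addnA -mulSnr => /ldivD - /(_ pr_l _ IHs).
by rewrite subrKA.
Qed.

End Orbit.
End LdivPoly.

(** * Polynomials in several variables: the last variable and l-adic continuity *)

Section Muni.
Variables (R : comNzRingType) (n : nat).
Implicit Type P : mpoly.mpoly n.+1 R.

Lemma meval_muni P (v : 'I_n.+1 -> R) :
  mpoly.meval v P =
  (map_poly (mpoly.meval (fun i => v (widen_ord (leqnSn n) i))) (mpoly.muni P)).[v ord_max].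
Proof.
rewrite mpoly.muniE rmorph_sum /= horner_sum mpoly.mevalE; apply: eq_bigr => m _.
rewrite map_polyZ /= map_polyXn hornerZ hornerXn /= mpoly.mevalZ mpoly.mevalX.
rewrite big_ord_recr /= mulrA; congr (_ * _ * _).
by apply: eq_bigr => i _; rewrite mpoly.mnmE.
Qed.

(** A monomial is determined by its exponents in the first [n] variables together with the exponent
    of the last one, so no two coefficients of [P] are merged. *)
Lemma muni_eq0 P : mpoly.muni P = 0 -> P = 0.
Proof.
move=> P0; apply/mpoly.mpolyP => m; rewrite mpoly.mcoeff0.
pose m' := mpoly.Multinom [tuple m (widen_ord (leqnSn n) i) | i < n].
have m'E (m2 : mpoly.multinom n.+1) :
    (mpoly.Multinom [tuple m2 (widen_ord (leqnSn n) i) | i < n] == m') && (m2 ord_max == m ord_max) = (m2 == m).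
  apply/andP/eqP => [[/eqP/mpoly.mnmP e /eqP e']|-> //]; apply/mpoly.mnmP => i.
  case: (unliftP ord_max i) => [j ->|-> //].
  have := e j; rewrite !mpoly.mnmE.
  by have -> : widen_ord (leqnSn n) j = lift ord_max j by apply/val_inj; rewrite /= /bump leqNgt ltn_ord.
have : mpoly.mcoeff m' (mpoly.muni P)`_(m ord_max) = 0.
  by rewrite P0 coef0 mpoly.mcoeff0.
rewrite mpoly.muniE coef_sum raddf_sum /=.
under eq_bigr => m2 _ do rewrite coefZ coefXn mulr_natr raddfMn /= mpoly.mcoeffZ mpoly.mcoeffX
  -mulrnAr -mulrnA mulnb [m ord_max == _]eq_sym m'E.
case: (boolP (m \in mpoly.msupp P)) => [min | /mpoly.memN_msupp_eq0-> //].
rewrite (bigD1_seq m) ?mpoly.msupp_uniq //= eqxx mulr1 big1 ?addr0 // => m2 /negbTE ->.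
by rewrite mulr0.
Qed.

End Muni.

Lemma meval_mpoly0_inj (K : comNzRingType) (v : 'I_0 -> K) (P : mpoly.mpoly 0 K) :
  mpoly.meval v P = 0 -> P = 0.
Proof.
move=> P0; apply/mpoly.mpolyP => m; rewrite mpoly.mcoeff0.
have m0 (m' : mpoly.multinom 0) : m' = m by apply/mpoly.mnmP; case.
have := P0; rewrite mpoly.mevalE.
case: (boolP (m \in mpoly.msupp P)) => [Pm | /mpoly.memN_msupp_eq0-> //].
rewrite (bigD1_seq m) ?mpoly.msupp_uniq //= big_ord0 mulr1 big1 ?addr0 // => m' /eqP[].
exact: m0.
Qed.

Section MpolyLdiv.
Variable l : nat.
Hypothesis pr_l : prime l.

Lemma ldiv_clear c : exists C, ldiv l 0 (l%:R ^+ C * c).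
Proof.
have /(pfactor_coprime pr_l) [v cop dE] : (0 < `|denq c|)%N by rewrite absz_gt0 denq_neq0.
exists (logn l `|denq c|), (numq c), v; split.
  by rewrite dvdzE /= -prime_coprime.
have dZ : denq c = (v * l ^ logn l `|denq c|)%N%:Z by rewrite -dE gez0_abs ?denq_ge0.
by rewrite expr0 mul1r numqE [in RHS]dZ PoszM rmorphM /= -!pmulrn natrX; ring.
Qed.

Lemma ldiv_scale k C x : ldiv l k x -> ldiv l k (l%:R ^+ C * x).
Proof. by apply: ldivMl => //; apply: ldivX => //; apply: (ldiv_int pr_l l). Qed.

(** The power [l ^ C] clears the l-parts of the denominators of the coefficients. After scaling, the
    evaluation is l-integral and 1-Lipschitz on l-integral points; [C] does not depend on the
    precision [k]. *)
Lemma ldiv_meval m (P : mpoly.mpoly m rat) : exists C,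
  (forall y, (forall i, ldiv l 0 (y i)) -> ldiv l 0 (l%:R ^+ C * mpoly.meval y P)) /\
  (forall k y y', (forall i, ldiv l 0 (y i)) -> (forall i, ldiv l k (y' i - y i)) ->
    ldiv l k (l%:R ^+ C * (mpoly.meval y' P - mpoly.meval y P))).
Proof.
elim/mpoly.mpolyind: P => [|c mm P _ _ [C [DP DP']]].
  exists 0%N; split=> [y _|k y y' _ _]; rewrite !mpoly.meval0 ?subr0 mulr0; exact: ldiv0.
have [C' Dc] := ldiv_clear c.
exists (C + C')%N; split=> [y Dy | k y y' Dy Dyy'].
  rewrite mpoly.mevalD mpoly.mevalZ mpoly.mevalX mulrDr; apply: ldivD => //; last first.
    by rewrite addnC exprD -mulrA; apply/ldiv_scale/DP.
  rewrite exprD -mulrA; apply/ldiv_scale; rewrite mulrA; apply: ldivMl => //.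
  elim/big_rec: _ => [|i x _ Dx]; first exact: (ldiv_int pr_l 1).
  by apply: ldivMl => //; apply: ldivX.
rewrite !mpoly.mevalD !mpoly.mevalZ !mpoly.mevalX.
have -> (a b e f g h : rat) : a * (b * e + f - (b * g + h)) =
   a * b * (e - g) + a * (f - h) by ring.
apply: ldivD => //; last first.
  by rewrite addnC exprD -mulrA; apply/ldiv_scale/DP'.
rewrite exprD -!mulrA; apply/ldiv_scale; rewrite mulrA; apply: ldivMl => //.
suff [] : [/\ ldiv l 0 (\prod_(i < m) y i ^+ mm i), ldiv l 0 (\prod_(i < m) y' i ^+ mm i)
    & ldiv l k (\prod_(i < m) y' i ^+ mm i - \prod_(i < m) y i ^+ mm i)] by [].
have Dy' i : ldiv l 0 (y' i).
  rewrite -[y' i](subrK (y i)); apply: ldivD => //; exact: (ldiv_le _ (Dyy' i)).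
elim/big_rec2: _ => [|i a b _ [Db Da Dab]].
  by rewrite subrr; split; [exact: (ldiv_int pr_l 1) | exact: (ldiv_int pr_l 1) | exact: ldiv0].
split; try by apply: ldivMl => //; apply: ldivX.
have -> : y' i ^+ mm i * a - y i ^+ mm i * b = y' i ^+ mm i * (a - b) + b * (y' i ^+ mm i - y i ^+ mm i) by ring.
apply: ldivD => //; apply: ldivMl => //; first exact: ldivX.
exact: ldiv_subXX.
Qed.

End MpolyLdiv.

(** * Escape to infinity and Zariski density of joint orbits *)

Section Escape.
Variable l : nat.
Hypothesis pr_l : prime l.
Variable p : {poly rat}.
Hypothesis p_int : forall i, ldiv l 0 p`_i.
Hypothesis p_lead : ~ ldiv l 1 (lead_coef p).
Hypothesis p_deg : (2 < size p)%N.

(** When [x] has a pole at [l], the leading term dominates: p(x) = x^d U with [U] a unit. As the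
    degree is at least 2, the order of the pole at least doubles, so it gains at least 1. *)
Lemma escape_step k x : (0 < k)%N -> x != 0 -> ldiv l k x^-1 ->
  p.[x] != 0 /\ ldiv l k.+1 p.[x]^-1.
Proof.
move=> k0 x0 Dx; set d := (size p).-1.
have sE : size p = d.+1 by rewrite prednK // (leq_ltn_trans _ p_deg).
pose U := lead_coef p + \sum_(i < d) p`_i * x^-1 ^+ (d - i).
have pE : p.[x] = x ^+ d * U.
  rewrite horner_coef sE big_ord_recr /= addrC mulrDr mulr_sumr; congr (_ + _).
    by rewrite mulrC.
  apply: eq_bigr => i _; have -> : x ^+ d = x ^+ (d - i) * x ^+ i.
    by rewrite -exprD subnK // ltnW.
  by rewrite exprVn; field; rewrite expf_neq0.
have D0 : ldiv l 0 x^-1 by apply: ldiv_le Dx.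
have D1 : ldiv l 1 x^-1 by apply: ldiv_le Dx.
have DS : ldiv l 1 (\sum_(i < d) p`_i * x^-1 ^+ (d - i)).
  apply: ldiv_sum => // i _; apply: ldivMl => //.
  rewrite -(subnSK (ltn_ord i)) exprSr.
  by apply: ldivMl => //; apply: ldivX.
have nU : ~ ldiv l 1 U.
  by move=> DU; apply: p_lead; have := ldivB pr_l DU DS; rewrite /U addrK.
have U0 : U != 0 by apply/eqP => U0; apply: nU; rewrite U0; apply: ldiv0.
have DU : ldiv l 0 U.
  apply: ldivD => //; first exact: p_int.
  exact: ldiv_le DS.
have DUV : ldiv l 0 U^-1.
  by apply: (ldiv_unitM pr_l DU nU); rewrite divff //; apply: (ldiv_int pr_l 1).
split; first by rewrite pE mulf_neq0 // expf_neq0.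
rewrite pE invfM -exprVn mulrC; apply: ldivMl => //.
have -> : d = (d - 2 + 2)%N by rewrite subnK // -ltnS -sE.
rewrite exprD expr2; apply: ldivMl; rewrite ?ldivX //; first exact: ldivX.
apply: (@ldiv_le l _ (k + k)); first by rewrite -addn1 leq_add2l.
exact: ldivM.
Qed.

Lemma escape_iter k x : (0 < k)%N -> x != 0 -> ldiv l k x^-1 -> forall n,
  iter n (horner p) x != 0 /\ ldiv l (n + k) (iter n (horner p) x)^-1.
Proof.
move=> k0 x0 Dx; elim=> [//|n [xn Dn]] /=.
by rewrite addSn; apply: escape_step => //; rewrite ltn_addl.
Qed.

End Escape.

(** The hypothesis is triangular: the prime attached to [j] constrains only [z j] and the earlier
    points. Removing the last point thus preserves it, which permits the induction on [N]. *)
Theorem orbit_dense (p : {poly rat}) N (z : 'I_N -> rat) :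
  (2 < size p)%N ->
  (forall j : 'I_N, exists l r, [/\ prime l, forall i, ldiv l 0 p`_i,
     ~ ldiv l 1 (lead_coef p) &
     [/\ ldiv l 0 r, ldiv l 1 (p.[r] - r), ~ ldiv l 1 p^`().[r],
         forall i : 'I_N, (i < j)%N -> ldiv l 1 (z i - r) &
         z j != 0 /\ ldiv l 1 (z j)^-1]]) ->
  forall P : mpoly.mpoly N rat,
    (forall n, mpoly.meval (fun i => iter n (horner p) (z i)) P = 0) -> P = 0.
Proof.
move=> p_deg; elim: N z => [|N IHN] z hz P P0.
  exact: meval_mpoly0_inj (P0 0%N).
apply: muni_eq0; apply/eqP; rewrite -lead_coef_eq0; apply/eqP.
set Q := mpoly.muni P.
pose w i := z (widen_ord (leqnSn N) i).
apply: (IHN w) => [j|n].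
  have [l [r [pr_l pi pl [r0 r1 r2 r3 r4]]]] := hz (widen_ord (leqnSn N) j).
  by exists l, r; split=> //; split=> // i ij; apply: (r3 (widen_ord (leqnSn N) i)).
have [l [r [pr_l p_int p_lead [r0 r1 r2 r3 [x0 Dx]]]]] := hz ord_max.
have w_r i : ldiv l 1 (w i - r) by apply: r3 => /=.
pose y n i := iter n (horner p) (w i); pose x n := iter n (horner p) (z ord_max).
have Dy m i : ldiv l 0 (y m i) by apply: (orbit_int pr_l p_int r0 r1 w_r).
have [Q0|Qn0] := eqVneq Q 0; first by rewrite Q0 lead_coef0 mpoly.meval0.
set K := (size Q).-1.
have sQ : size Q = K.+1 by rewrite /K prednK // size_poly_gt0.
(* The relation P = 0 at time [m], divided by the top power of the last coordinate: the leading
   coefficient becomes a sum of terms each carrying a negative power of [x m]. *)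
have QE m : mpoly.meval (y m) (lead_coef Q) =
    - \sum_(i < K) mpoly.meval (y m) Q`_i * (x m)^-1 ^+ (K - i).
  have [xm0 _] := escape_iter pr_l p_int p_lead p_deg (ltnSn 0) x0 Dx m.
  have := P0 m; rewrite meval_muni -/Q.
  set f := mpoly.meval _.
  have sz : (size (map_poly f Q) <= K.+1)%N by rewrite -sQ size_poly.
  rewrite (horner_coef_wide _ sz) big_ord_recr /=.
  under eq_bigr => i _ do rewrite coef_map_id0 ?[f 0]mpoly.meval0 //.
  rewrite coef_map_id0 ?[f 0]mpoly.meval0 // -lead_coefE addrC => /eqP.
  rewrite addr_eq0 => /eqP e.
  apply: (@mulIf _ (x m ^+ K)); first by rewrite expf_neq0.
  rewrite mulNr; move: e => /= ->; congr (- _); rewrite mulr_suml; apply: eq_bigr => i _.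
  have -> : x m ^+ K = x m ^+ (K - i) * x m ^+ i by rewrite -exprD subnK // ltnW.
  by rewrite exprVn mulrA mulfVK // expf_neq0.
have [C DC] := choice (fun i : 'I_K => ldiv_meval pr_l Q`_i).
pose C1 := (\sum_i C i)%N.
have [C2 [_ DC2]] := ldiv_meval pr_l (lead_coef Q).
suff : l%:R ^+ (C1 + C2) * mpoly.meval (y n) (lead_coef Q) = 0.
  by move/eqP; rewrite mulf_eq0 expf_eq0 pnatr_eq0 (gtn_eqF (prime_gt0 pr_l)) andbF => /eqP.
apply: (ldiv_eq0 pr_l) => k.
have [T T0 DT] := orbit_recurrent pr_l p_int r0 r1 r2 w_r k n.
(* At this time the first points are back modulo [l ^ k] at their position of time [n], and since
   [T] is positive the pole of the last one has order at least [k]. So the leading coefficient at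
   time [n] is zero modulo [l ^ k], up to a denominator independent of [k]. *)
set m := (n + k * T)%N in DT.
have -> : mpoly.meval (y n) (lead_coef Q) = mpoly.meval (y m) (lead_coef Q) -
   (mpoly.meval (y m) (lead_coef Q) - mpoly.meval (y n) (lead_coef Q)) by ring.
rewrite mulrBr; apply: ldivB => //; last first.
  by rewrite exprD -mulrA; apply/ldiv_scale/DC2 => // i; apply: DT.
rewrite QE mulrN addnC exprD -mulrA -mulrN; apply: ldiv_scale => //.
rewrite mulr_sumr; apply/ldivN/ldiv_sum => // i _.
rewrite mulrA; apply: ldivMl => //.
  rewrite /C1 (bigD1 i) //= addnC exprD -mulrA; apply: ldiv_scale => //.
  by have [+ _] := DC i; apply.
have [_ Dm] := escape_iter pr_l p_int p_lead p_deg (ltnSn 0) x0 Dx m.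
have {}Dm : ldiv l k (x m)^-1.
  apply: ldiv_le Dm; rewrite /m; nia.
rewrite -(subnSK (ltn_ord i)) exprSr; apply: ldivMl => //.
by apply: ldivX => //; apply: ldiv_le Dm.
Qed.

(* A Q-linear functional on the span of the coefficients of [P] replaces [P]
   by a rational polynomial. *)
Lemma rational_equation N (P : mpoly.mpoly N algC) : P != 0 ->
  exists2 Q : mpoly.mpoly N rat, Q != 0 & forall x : 'I_N -> rat,
    mpoly.meval (fun i => ratr (x i)) P = 0 -> mpoly.meval x Q = 0.
Proof.
move=> P0; set s := [seq mpoly.mcoeff m P | m <- mpoly.msupp P].
have [L [f [s1 s1E _]]] := num_field_exists s.
have sz : size s1 = size (mpoly.msupp P) by rewrite -(size_map f) s1E size_map.
pose c m := nth 0 s1 (index m (mpoly.msupp P)).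
have cE m : m \in mpoly.msupp P -> f (c m) = mpoly.mcoeff m P.
  move=> Pm; rewrite -(nth_map _ 0) ?sz ?index_mem // s1E (nth_map m) ?index_mem //.
  by rewrite nth_index.
have [m0 Pm0] : exists m, m \in mpoly.msupp P.
  move: P0; rewrite -mpoly.msupp_eq0; case: (mpoly.msupp P) => // m r _.
  by exists m; rewrite mem_head.
have [i ci] : exists i, coord (vbasis fullv) i (c m0) != 0.
  apply: contrapT => /forallNP ci; have := Pm0; rewrite mpoly.mcoeff_msupp -cE //.
  rewrite (coord_vbasis (memvf (c m0))) big1 ?rmorph0 ?eqxx // => i _.
  by have /negP := ci i; rewrite negbK => /eqP->; rewrite scale0r.
pose phi u : rat := coord (vbasis fullv) i u.
exists (\sum_(m <- mpoly.msupp P) mpoly.mpolyC N (phi (c m)) * mpoly.mpolyX rat m).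
  apply/eqP => /(congr1 (mpoly.mcoeff m0)); rewrite mpoly.mcoeff0 raddf_sum /=.
  rewrite (bigD1_seq m0) ?mpoly.msupp_uniq //= mpoly.mcoeffCM mpoly.mcoeffX eqxx mulr1.
  rewrite big1 ?addr0 => [/eqP|m /negbTE mm0]; first exact/negP.
  by rewrite mpoly.mcoeffCM mpoly.mcoeffX mm0 mulr0.
move=> x; rewrite mpoly.mevalE => Px; rewrite raddf_sum /=.
under eq_bigr => m _ do rewrite mpoly.mevalM mpoly.mevalC mpoly.mevalX.
transitivity (phi (\sum_(m <- mpoly.msupp P) (\prod_j x j ^+ m j) *: c m)).
  by rewrite /phi linear_sum /=; apply: eq_bigr => m _; rewrite linearZ /= mulrC.
rewrite [X in phi X](_ : _ = 0) /phi ?linear0 //.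
apply: (fmorph_inj f); rewrite rmorph0 rmorph_sum -[RHS]Px /=.
apply: eq_big_seq => m Pm; rewrite rmorphZ_num cE // mulrC; congr (_ * _).
by rewrite rmorph_prod; apply: eq_bigr => j _; rewrite rmorphXn.
Qed.

(** The invariance hypothesis is applied along the orbit of [z] only: it propagates the vanishing of
    [P] from each iterate to the next, hence that of its rational substitute [Q]. *)
Lemma dyn_independent_of_dense (p : {poly rat}) N (z : N.-tuple rat) :
  (forall P : mpoly.mpoly N rat,
    (forall n, mpoly.meval (fun i => iter n (horner p) (tnth z i)) P = 0) -> P = 0) ->
  dyn_independent p z.
Proof.
move=> dense [P [P0 Pz Pinv]].
have [Q Q0 QP] := rational_equation P0.
move/eqP: Q0; apply; apply: dense => n; apply: QP.
elim: n => [//|n IHn] /=.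
rewrite -[RHS](Pinv _ IHn); apply: mpoly.meval_eq => i.
by rewrite horner_map.
Qed.

(** * The integral numerator F of psi *)

Definition numer (d : nat) (a : d.-tuple int) : {poly int} :=
  a`_(d.-1) *: 'X^d + \sum_(1 <= i < d.-1) a`_i *: 'X^i + (a`_0)%:P.

Lemma coef_numer d (a : d.-tuple int) i : (2 < d)%N ->
  (numer a)`_i = if i == d then a`_(d.-1) else if (i < d.-1)%N then a`_i else 0.
Proof.
move=> d3; rewrite /numer !coefD coefZ coefXn coefC coef_sum.
under eq_bigr => j _ do rewrite coefZ coefXn.
have [->|id] := eqVneq i d; rewrite ?mulr1 ?mulr0 ?add0r.
  rewrite big_nat_cond big1 ?addr0 => [|j /andP[/andP[_ jd] _]].
    by rewrite (gtn_eqF (leq_ltn_trans _ d3)) ?addr0.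
  by rewrite gtn_eqF ?mulr0 //; lia.
case: i id => [|i] id /=.
  rewrite (_ : 0 < d.-1)%N; last by lia.
  by rewrite big_nat_cond big1 ?add0r // => j /andP[/andP[j0 _] _]; rewrite ltn_eqF ?mulr0.
rewrite addr0; case: ifP => lt_i.
  rewrite (bigD1_seq i.+1) ?iota_uniq //= ?mem_index_iota ?lt_i //.
  by rewrite eqxx mulr1 big1 ?addr0 // => j ji; rewrite eq_sym (negbTE ji) mulr0.
rewrite big_nat_cond big1 // => j /andP[/andP[_ jd] _].
by rewrite gtn_eqF ?mulr0 //; lia.
Qed.

Lemma size_numer d (a : d.-tuple int) : (2 < d)%N -> a`_(d.-1) != 0 ->
  size (numer a) = d.+1.
Proof.
move=> d3 ad; apply/eqP; rewrite eqn_leq; apply/andP; split.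
  apply/leq_sizeP => j dj; rewrite coef_numer // gtn_eqF //.
  by rewrite (_ : (j < d.-1)%N = false) //; lia.
rewrite ltnNge; apply: contra ad => /leq_sizeP /(_ d (leqnn d)).
by rewrite coef_numer // eqxx => ->.
Qed.

Lemma psiE d (a : d.-tuple int) : a`_0 != 0 ->
  psi a = (a`_0)%:~R^-1 *: map_poly intr (numer a).
Proof.
move=> a0; rewrite /psi /numer !rmorphD /= rmorph_sum /= !scalerDr map_polyC /=.
rewrite map_polyZ /= map_polyXn scalerA mulrC; congr (_ + _ + _).
  rewrite scaler_sumr; apply: eq_bigr => i _.
  by rewrite map_polyZ /= map_polyXn scalerA mulrC.
by rewrite -mul_polyC -polyCM mulVf // intr_eq0.
Qed.

Section LdivFrac.
Variable l : nat.
Hypothesis pr_l : prime l.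

Lemma ldiv_frac k (a b : int) : ~~ (l%:Z %| b)%Z -> ((l ^ k)%N%:Z %| a)%Z ->
  ldiv l k (a%:~R / b%:~R).
Proof.
move=> nb /dvdzP[c ->]; exists c, b; split=> //.
rewrite divfK; last by apply/eqP => /eqP; rewrite intr_eq0 => /eqP b0; rewrite b0 dvdz0 in nb.
by rewrite rmorphM /= -pmulrn natrX mulrC.
Qed.

Lemma ldiv1_frac (a b : int) : ~~ (l%:Z %| b)%Z -> ldiv l 1 (a%:~R / b%:~R) ->
  (l%:Z %| a)%Z.
Proof.
move=> nb [u [v [nv e]]].
have b0 : b%:~R != 0 :> rat.
  by apply/eqP => /eqP; rewrite intr_eq0 => /eqP b0; rewrite b0 dvdz0 in nb.
have {}e : a * v = l%:Z * (u * b).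
  apply: (@intr_inj rat); rewrite !rmorphM /= -pmulrn mulrA.
  by rewrite -[in RHS](expr1 l%:R) -e; field.
have : (l%:Z %| a * v)%Z by rewrite e dvdz_mulr.
by rewrite prime_dvdzM // (negbTE nv) orbF.
Qed.

End LdivFrac.

(** * Independent points of bounded height *)

Section Points.
Variables (d : nat) (a : d.-tuple int).
Hypotheses (d3 : (2 < d)%N) (a0 : a`_0 != 0) (ad : a`_(d.-1) != 0).

Lemma size_psi : size (psi a) = d.+1.
Proof.
rewrite psiE // size_scale ?invr_eq0 ?intr_eq0 //.
by rewrite size_map_inj_poly ?size_numer //; exact: intr_inj.
Qed.

Lemma coef_psi i : (psi a)`_i = ((numer a)`_i)%:~R / (a`_0)%:~R.
Proof. by rewrite psiE // coefZ coef_map mulrC. Qed.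

Lemma lead_coef_psi : lead_coef (psi a) = (a`_(d.-1))%:~R / (a`_0)%:~R.
Proof. by rewrite lead_coefE size_psi coef_psi coef_numer // eqxx. Qed.

Lemma horner_psi_int (r : int) : (psi a).[r%:~R] = (numer a).[r]%:~R / (a`_0)%:~R.
Proof. by rewrite psiE // hornerZ horner_map mulrC. Qed.

Lemma deriv_psi_int (r : int) :
  (psi a)^`().[r%:~R] = (numer a)^`().[r]%:~R / (a`_0)%:~R.
Proof. by rewrite psiE // derivZ deriv_map hornerZ horner_map mulrC. Qed.

(** The fixed point equation and the derivative are multiplied by [a_0], a unit at [l]. The two
    nondivisibility conditions on coefficients make psi l-integral with a unit leading
    coefficient. *)
Definition good_prime (l : nat) (r : int) : Prop :=
  [/\ prime l, ~~ (l%:Z %| a`_0)%Z, ~~ (l%:Z %| a`_(d.-1))%Z,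
      (l%:Z %| (numer a).[r] - a`_0 * r)%Z & ~~ (l%:Z %| (numer a)^`().[r])%Z].

(** The integer is prescribed as 1 modulo [l i], so that n / l_i keeps its pole there, and as r_j
    l_i modulo every other l_j, so that n / l_i lies in the disc of r_j. Reduction modulo the
    product of the primes bounds the height. *)
Lemma crt_points N (l : 'I_N -> nat) (r : 'I_N -> int) i :
  (forall j, prime (l j)) -> injective l ->
  exists n : nat, [/\ (n < \prod_j l j)%N, ~~ (l i %| n)%N &
    forall j, j != i -> ((l j)%:Z %| n%:Z - r j * (l i)%:Z)%Z].
Proof.
move=> pr_l inj_l; pose e j : int := if j == i then 1 else r j * (l i)%:Z.
suff [n [ltn nP]] : exists n : nat, (n < \prod_j l j)%N /\
    forall j, ((l j)%:Z %| n%:Z - e j)%Z.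
  exists n; split=> // [|j ji]; last by have := nP j; rewrite /e (negbTE ji).
  apply/negP => ln; have := nP i; rewrite /e eqxx => ln1.
  have : ((l i)%:Z %| n%:Z - (n%:Z - 1))%Z by rewrite rpredB // dvdzE.
  by rewrite opprB addrC subrK dvdzE /= dvdn1 gtn_eqF ?prime_gt1.
suff [m mP] : exists m : int, forall j, ((l j)%:Z %| m - e j)%Z.
  have P0 : (0 < \prod_j l j)%N by rewrite prodn_gt0 // => j; rewrite prime_gt0.
  exists `|(m %% (\prod_j l j)%N%:Z)%Z|%N; split.
    by rewrite -ltz_nat gez0_abs ?modz_ge0 ?ltz_pmod ?ltz_nat // -lt0n.
  move=> j; rewrite gez0_abs ?modz_ge0 -?lt0n //.
  have -> : (m %% (\prod_j l j)%N%:Z)%Z - e j = m - e j - (m %/ (\prod_j l j)%N%:Z)%Z * (\prod_j l j)%N%:Z.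
    by rewrite {2}(divz_eq m (\prod_j l j)%N); ring.
  rewrite rpredB // dvdz_mull // dvdzE /= (bigD1 j) //= dvdn_mulr //.
have [m mP] : exists m : int, forall j, j \in enum 'I_N -> ((l j)%:Z %| m - e j)%Z.
  elim: (enum 'I_N) (enum_uniq 'I_N) => [|j s IHs] /=; first by exists 0.
  case/andP=> js us; have [m mP] := IHs us.
  have cop : coprimez (\prod_(t <- s) (l t)%:Z) (l j)%:Z.
    rewrite coprimezE /=; elim: s js {IHs us mP} => [|t s IHs].
      by rewrite big_nil /= coprime1n.
    rewrite inE negb_or => /andP[jt js]; rewrite big_cons abszM coprimeMl IHs // andbT.
    rewrite absz_nat prime_coprime // dvdn_prime2 //; apply: contra jt => /eqP/inj_l->.
    by rewrite eqxx.
  exists (zchinese (\prod_(t <- s) (l t)%:Z) (l j)%:Z m (e j)) => t.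
  rewrite inE => /predU1P[->|ts]; first by rewrite -eqz_mod_dvd zchinese_modr.
  rewrite -[_ - _](subrKA m) rpredD ?mP //.
  have : (\prod_(t <- s) (l t)%:Z %| zchinese (\prod_(t <- s) (l t)%:Z) (l j)%:Z m (e j) - m)%Z.
    by rewrite -eqz_mod_dvd zchinese_modl.
  by apply: dvdz_trans; rewrite (big_rem t) //= dvdz_mulr.
by exists m => j; apply: mP; rewrite mem_enum.
Qed.

(** The coordinates are bounded in terms of the primes alone, whatever the size of the coefficients
    of psi. *)
Lemma independent_points N (l : 'I_N -> nat) (r : 'I_N -> int) :
  injective l -> (forall j, good_prime (l j) (r j)) ->
  exists z : N.-tuple rat, dyn_independent (psi a) z /\
    forall i, exists2 n : nat, (0 < n < \prod_j l j)%N &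
      tnth z i = n%:R / (l i)%:R.
Proof.
move=> inj_l good; have pr_l j : prime (l j) by have [] := good j.
have [n nP] := choice (fun i => crt_points r i pr_l inj_l).
exists [tuple (n i)%:R / (l i)%:R | i < N]; split; last first.
  move=> i; exists (n i); last by rewrite tnth_mktuple.
  have [-> ln _] := nP i; rewrite andbT lt0n.
  by apply: contra ln => /eqP->; rewrite dvdn0.
apply: dyn_independent_of_dense; apply: orbit_dense => [|j].
  by rewrite size_psi ltnS ltnW.
have [prl la0 lad lr lr'] := good j; exists (l j), (r j)%:~R; split=> //.
- by move=> i; rewrite coef_psi; apply: ldiv_frac; rewrite // expn0 dvdzE dvd1n.
- by rewrite lead_coef_psi => /(ldiv1_frac prl la0); apply/negP.
have a0Q : (a`_0)%:~R != 0 :> rat by rewrite intr_eq0.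
split.
- exact: ldiv_int.
- have -> : (psi a).[(r j)%:~R] - (r j)%:~R =
      ((numer a).[r j] - a`_0 * r j)%:~R / (a`_0)%:~R.
    by rewrite horner_psi_int rmorphB rmorphM /=; field.
  exact: ldiv_frac.
- by rewrite deriv_psi_int => /(ldiv1_frac prl la0); apply/negP.
- move=> i ij; rewrite tnth_mktuple.
  have li0 : (l i)%:R != 0 :> rat by rewrite pnatr_eq0 -lt0n prime_gt0.
  have -> : (n i)%:R / (l i)%:R - (r j)%:~R =
      ((n i)%:Z - r j * (l i)%:Z)%:~R / ((l i)%:Z)%:~R :> rat.
    by rewrite rmorphB rmorphM /= -!pmulrn; field.
  have [_ _ nij] := nP i; have ji : j != i by apply: contraTneq ij => ->; rewrite ltnn.
  apply: ldiv_frac; rewrite ?expn1 ?nij // dvdzE /= dvdn_prime2 //.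
  by apply: contra ji => /eqP/inj_l->.
- have [_ ln _] := nP j; rewrite tnth_mktuple invf_div.
  have n0 : n j != 0%N by apply: contra ln => /eqP->; rewrite dvdn0.
  split; first by rewrite mulf_neq0 ?invr_eq0 ?pnatr_eq0 // -lt0n prime_gt0.
  by rewrite !pmulrn; apply: ldiv_frac.
Qed.

End Points.

(** * Lower bounds for the canonical height *)

Lemma leq_abszD (x y : int) : (`|(x + y)%R| <= `|x| + `|y|)%N.
Proof. by rewrite -lez_nat PoszD !abszE ler_normD. Qed.

Definition ratH (x : rat) : nat := maxn `|numq x|%N `|denq x|%N.

Lemma ratH_gt0 x : (0 < ratH x)%N.
Proof. by rewrite leq_max orbC absz_gt0 denq_neq0. Qed.

Lemma frac_num_den (u v : int) : v != 0 ->
  (`|u| = gcdn `|u| `|v| * `|numq (u%:~R / v%:~R)|)%N /\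
  (`|v| = gcdn `|u| `|v| * `|denq (u%:~R / v%:~R)|)%N.
Proof.
case: divqP => [_|k x k0 _]; first by rewrite eqxx.
by rewrite !abszM -muln_gcdr (eqP (coprime_num_den x)) muln1.
Qed.

Lemma ratH_frac (u v : int) : v != 0 ->
  (ratH (u%:~R / v%:~R) <= maxn `|u| `|v|)%N.
Proof.
move=> v0; have [eu ev] := frac_num_den u v0.
have g0 : (0 < gcdn `|u| `|v|)%N by rewrite gcdn_gt0 !absz_gt0 v0 orbT.
rewrite /ratH; move: eu ev g0; set g := gcdn _ _; move=> -> -> g0.
by rewrite -maxnMr leq_pmull.
Qed.

(** The binary form F(p,q) = q^d F(p/q). *)
Definition homog (d : nat) (a : d.-tuple int) (p q : int) : int :=
  \sum_(i < d.+1) (numer a)`_i * p ^+ i * q ^+ (d - i).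

(* The part of [a_0] that may cancel from the denominator of [psi(z)]. *)
Definition psi_gcd (d : nat) (a : d.-tuple int) (z : rat) : nat :=
  gcdn `|homog a (numq z) (denq z)| `|a`_0|.

Section Heights.
Variables (d : nat) (a : d.-tuple int).
Hypotheses (d3 : (2 < d)%N) (a0 : a`_0 != 0) (ad : a`_(d.-1) != 0).

Lemma psi_frac z :
  (psi a).[z] = (homog a (numq z) (denq z))%:~R / (a`_0 * denq z ^+ d)%:~R.
Proof.
have q0 : (denq z)%:~R != 0 :> rat by rewrite intr_eq0 denq_neq0.
have a0Q : (a`_0)%:~R != 0 :> rat by rewrite intr_eq0.
rewrite psiE // hornerZ horner_coef size_map_inj_poly ?size_numer //; last exact: intr_inj.
rewrite rmorph_sum /= rmorphM rmorphXn /= invfM mulr_suml mulr_sumr.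
apply: eq_bigr => i _; rewrite coef_map /= !rmorphM !rmorphXn /= numqE exprMn.
have -> : ((denq z)%:~R ^+ d : rat) = (denq z)%:~R ^+ i * (denq z)%:~R ^+ (d - i).
  by rewrite -exprD subnKC // -ltnS.
by field; rewrite !expf_neq0 ?a0Q.
Qed.

Lemma leq_coefH i : (`|((numer a)`_i)%R|%N <= coefH a)%N.
Proof.
have leH j : (`|(a`_j)%R|%N <= coefH a)%N.
  have [lt_j|le_j] := ltnP j d; last by rewrite nth_default ?size_tuple.
  by rewrite /coefH (big_nth 0) size_tuple big_mkord (leq_bigmax (Ordinal lt_j)).
by rewrite coef_numer //; case: ifP => _ //; case: ifP.
Qed.

Lemma ratH_psi z : (ratH (psi a).[z] <= d.+1 * coefH a * ratH z ^ d)%N.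
Proof.
have q0 := denq_neq0 z.
rewrite psi_frac; apply: leq_trans (ratH_frac _ _) _; first by rewrite mulf_neq0 ?expf_neq0.
have nH : (`|numq z| <= ratH z)%N by rewrite leq_maxl.
have dH : (`|denq z| <= ratH z)%N by rewrite leq_maxr.
rewrite geq_max; apply/andP; split; last first.
  rewrite abszM abszX leq_mul ?leq_exp2r //; last by apply: ltn_trans d3.
  apply: leq_trans (leq_pmull _ _) => //; have := leq_coefH 0.
  by rewrite coef_numer // ltn_eqF ?(ltn_trans _ d3) // (_ : (0 < d.-1)%N) //; lia.
have -> : (d.+1 * coefH a * ratH z ^ d = \sum_(i < d.+1) coefH a * ratH z ^ d)%N.
  by rewrite sum_nat_const card_ord mulnA.
rewrite /homog; elim/big_rec2: _ => [//|i x y _ le_xy].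
apply: leq_trans (leq_abszD _ _) (leq_add _ le_xy).
rewrite !abszM !abszX -mulnA leq_mul ?leq_coefH //.
have -> : (ratH z ^ d = ratH z ^ i * ratH z ^ (d - i))%N.
  by rewrite -expnD subnKC // -ltnS.
by apply: leq_mul; [case: (i : nat) | case: (d - i)%N] => // m; rewrite leq_exp2r.
Qed.

End Heights.

(* Here and below [e n] stands for the valuation of the denominator of the
   [n]-th iterate of [z], and [v0], [vd] for those of [a_0] and [a_d]. *)
Lemma class_growth (d v0 vd : nat) (e : nat -> nat) : (2 < d)%N ->
  (forall n, (vd < 2 * e n)%N -> (v0 + d * e n <= e n.+1 + vd)%N) ->
  (vd < 2 * e 0)%N -> forall n,
  (d ^ n * (d.-1 * e 0%N + v0) + vd <= d.-1 * e n + v0 + d ^ n * vd)%N.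
Proof.
move=> d3 He h0 n.
suff [] : (vd < 2 * e n)%N /\
  (d ^ n * (d.-1 * e 0%N + v0) + vd <= d.-1 * e n + v0 + d ^ n * vd)%N by [].
elim: n => [|n [hn IHn]]; first by rewrite expn0 !mul1n; split=> //; lia.
have := He n hn; split; first by nia.
have [c dc] : exists c, d = c.+1 by exists d.-1; lia.
move: IHn H; rewrite expnS; set D := (d ^ n)%N; rewrite dc /=; nia.
Qed.

(** Here [vg] and [f] are the valuations of [psi_gcd] and of the square part [s] of [a_d]. If
    [vd < 2 * e 0], growth starts at once, and half of [e 0] pays for the lost [vd], because vd <=
    2f + 1 <= 2f + e_0 and d - 1 >= 2. Otherwise [e 0 <= f]; then either [v0 <= vg + minn v0 vd] and
    the error term alone suffices, or e_1 >= v0 - vg > vd and growth starts at the first iterate. *)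
Lemma local_growth (d v0 vd vg f : nat) (e : nat -> nat) : (2 < d)%N ->
  (forall n, (vd < 2 * e n)%N -> (v0 + d * e n <= e n.+1 + vd)%N) ->
  (v0 <= e 1 + vg)%N -> (vd <= 2 * f + 1)%N -> forall n,
  (d ^ n * (2 * v0 + d.-1 * e 0) <=
   d.-1 * 2 * e n + 2 * v0 + 2 * d ^ n * (vg + minn v0 vd + d.-1 * f))%N.
Proof.
move=> d3 He h1 hf n.
have [c dc] : exists c, d = c.+3 by exists (d - 3)%N; lia.
have [h0|h0] := ltnP vd (2 * e 0%N).
  have := class_growth d3 He h0 n.
  set D := (d ^ n)%N; rewrite dc /=.
  have h2 : (2 * vd <= c.+2 * (e 0%N + 2 * f))%N by apply: leq_mul => //; lia.
  have {}h2 : (D * (2 * vd) <= D * (c.+2 * (e 0%N + 2 * f)))%N by rewrite leq_mul2l h2 orbT.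
  nia.
have [hv|hv] := leqP v0 (vg + minn v0 vd).
  set D := (d ^ n)%N; rewrite dc /=.
  have : (D * v0 <= D * (vg + minn v0 vd))%N by rewrite leq_mul2l hv orbT.
  have : (D * (c.+2 * e 0%N) <= D * (c.+2 * f))%N by rewrite !leq_mul2l (_ : (e 0 <= f)%N) ?orbT //; lia.
  set x := minn _ _; nia.
have vdE : minn v0 vd = vd by lia.
have h1' : (vd < 2 * e 1)%N by lia.
case: n => [|n]; first by rewrite expn0 dc /=; nia.
have := @class_growth d v0 vd (fun n => e n.+1) d3 (fun n => He n.+1) h1' n.
rewrite vdE expnS; rewrite vdE in hv.
set D := (d ^ n)%N; rewrite dc /= => h3.
have [x xE] : exists x, v0 = (vg + vd + x)%N by exists (v0 - vg - vd)%N; lia.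
have h4 : (c.+3 * x + vd <= c.+2 * e 1%N + v0)%N by nia.
have {}h4 : (D * (c.+3 * x) + D * vd <= D * (c.+2 * e 1%N + v0))%N.
  by rewrite -mulnDr leq_mul2l h4 orbT.
have h5 : (c.+3 * D * (c.+2 * e 0%N) <= c.+3 * D * (c.+2 * f))%N.
  by rewrite !leq_mul2l (_ : (e 0 <= f)%N) ?orbT //; lia.
have h6 : (c.+3 * D * x + vd <= c.+2 * e n.+1 + v0)%N.
  rewrite [(c.+3 * D)%N]mulnC -mulnA; move: (D * (c.+3 * x))%N h4 => S h4.
  move: (D * (c.+2 * e 1 + v0))%N (D * vd)%N (c.+2 * e n.+1)%N h3 h4 => P Q U.
  by clear; lia.
move: h5 h6; rewrite xE; set E := (c.+3 * D)%N; move: (c.+2 * e 0%N)%N => y.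
rewrite [(c.+2 * 2)%N]mulnC -mulnA; move: (c.+2 * e n.+1)%N (c.+2 * f)%N => t g.
have -> : (E * (2 * (vg + vd + x) + y) = 2 * (E * vg) + 2 * (E * vd) + 2 * (E * x) + E * y)%N by ring.
have -> : (2 * E * (vg + vd + g) = 2 * (E * vg) + 2 * (E * vd) + 2 * (E * g))%N by ring.
move: (E * vg)%N (E * vd)%N (E * x)%N (E * y)%N (E * g)%N => *; lia.
Qed.

(** For the largest [s] whose square divides [m], a larger valuation at some [l] would allow [s * l]
    instead. *)
Lemma max_square_divisor (m : nat) : (0 < m)%N ->
  exists s, [/\ (0 < s)%N, (s ^ 2 %| m)%N &
    forall l, prime l -> (logn l m <= 2 * logn l s + 1)%N].
Proof.
move=> m0; pose P s := ((0 < s) && (s ^ 2 %| m))%N.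
have P1 : P 1%N by rewrite /P exp1n dvd1n.
have Pm s : P s -> (s <= m)%N.
  by case/andP=> s0 /(dvdn_leq m0); apply: leq_trans; rewrite -mulnn leq_pmulr.
case: (ex_maxnP (ex_intro P 1%N P1) Pm) => s /andP[s0 sm] smax.
exists s; split=> // l pr_l; rewrite leqNgt; apply/negP => h.
have : P (s * l)%N.
  rewrite /P muln_gt0 s0 prime_gt0 //=.
  have [c mE] := dvdnP sm; rewrite mE expnMn mulnC dvdn_pmul2r ?expn_gt0 ?s0 //.
  have c0 : (0 < c)%N by move: m0; rewrite mE muln_gt0 => /andP[].
  rewrite pfactor_dvdn //; move: h; rewrite mE lognM ?expn_gt0 ?s0 // lognX; lia.
by move/smax; rewrite leqNgt ltn_Pmulr // prime_gt1.
Qed.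

Lemma dvdn_logn (m n : nat) : (0 < m)%N -> (0 < n)%N ->
  (forall l, prime l -> (logn l m <= logn l n)%N) -> (m %| n)%N.
Proof.
move=> m0 n0 h; apply/dvdn_partP => // p; rewrite mem_primes => /andP[pp _].
by rewrite p_part pfactor_dvdn ?h.
Qed.

(** * Growth of the denominators along an orbit *)

Section HeightGrowth.
Variables (d : nat) (a : d.-tuple int).
Hypotheses (d3 : (2 < d)%N) (a0 : a`_0 != 0) (ad : a`_(d.-1) != 0).

Let A0 := `|(a`_0)%R|%N.
Let AD := `|(a`_(d.-1))%R|%N.
Let A0_gt0 : (0 < A0)%N. Proof. by rewrite absz_gt0. Qed.
Let AD_gt0 : (0 < AD)%N. Proof. by rewrite absz_gt0. Qed.

Lemma denq_psi z :
  (A0 * `|denq z| ^ d = gcdn `|homog a (numq z) (denq z)| (A0 * `|denq z| ^ d)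
     * `|denq (psi a).[z]|)%N.
Proof.
rewrite psi_frac //.
have [] := frac_num_den (homog a (numq z) (denq z)) (_ : a`_0 * denq z ^+ d != 0).
  by rewrite mulf_neq0 ?expf_neq0 ?denq_neq0.
by move=> _; rewrite abszM abszX.
Qed.

Lemma psi_gcd_gt0 z : (0 < psi_gcd a z)%N.
Proof. by rewrite gcdn_gt0 orbC A0_gt0. Qed.

(** The gcd of F(p,q) and a_0 q^d divides gcd(F(p,q), a_0) q^d. This controls the first iterate even
    at the primes not dividing the denominator of [z]. *)
Lemma dvdn_denq_psi z : (A0 %| `|denq (psi a).[z]| * psi_gcd a z)%N.
Proof.
have q0 : (0 < `|denq z| ^ d)%N by rewrite expn_gt0 absz_gt0 denq_neq0.
rewrite -(dvdn_pmul2r q0) denq_psi [(gcdn _ _ * _)%N]mulnC -mulnA.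
rewrite dvdn_pmul2l ?absz_gt0 ?denq_neq0 // /psi_gcd muln_gcdl dvdn_gcd dvdn_gcdr andbT.
exact/dvdn_mulr/dvdn_gcdl.
Qed.

(** As F has no term of degree d - 1, each term other than the leading one contains q at least
    twice. This square is the source of the condition [vd < 2 * e n] in the growth estimates. *)
Lemma dvdz_homog (p q : int) : (q ^+ 2 %| homog a p q - a`_(d.-1) * p ^+ d)%Z.
Proof.
have dE : d = d.-2.+2 by lia.
rewrite /homog big_ord_recr /= subnn expr0 mulr1 coef_numer // eqxx addrK.
apply: (big_ind (fun x => q ^+ 2 %| x)%Z) => [|x y|i _]; first exact: dvdz0.
  exact: rpredD.
rewrite coef_numer // ltn_eqF //; case: ifP => lt_i; last by rewrite !mul0r dvdz0.
have -> : (d - i = d - i - 2 + 2)%N by lia.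
by rewrite exprD mulrA dvdz_mull.
Qed.

(** If more than [logn l AD] factors [l] cancelled, that power of [l] would divide both F(p,q) and
    q^2, hence a_d p^d; but p is prime to [l]. *)
Lemma logn_denq_psi l z : prime l -> (logn l AD < 2 * logn l `|denq z|)%N ->
  (logn l A0 + d * logn l `|denq z| <= logn l `|denq (psi a).[z]| + logn l AD)%N.
Proof.
move=> pr_l h; have q0 : (0 < `|denq z|)%N by rewrite absz_gt0 denq_neq0.
have := congr1 (logn l) (denq_psi z).
set G := gcdn _ _.
have G0 : (0 < G)%N by rewrite gcdn_gt0 muln_gt0 A0_gt0 expn_gt0 q0 orbT.
rewrite lognM ?expn_gt0 ?q0 // lognX lognM // ?absz_gt0 ?denq_neq0 // => ->.
rewrite addnC leq_add2l leqNgt; apply/negP => hG.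
have lG : (l ^ (logn l AD).+1 %| G)%N by rewrite pfactor_dvdn.
have lq : (l %| `|denq z|)%N.
  by apply: contraLR h => nlq; rewrite (lognE l `|denq z|) (negbTE nlq) !andbF muln0.
have lh : ((l ^ (logn l AD).+1)%N%:Z %| homog a (numq z) (denq z))%Z.
  by rewrite dvdzE /=; apply: dvdn_trans lG (dvdn_gcdl _ _).
have lq2 : ((l ^ (logn l AD).+1)%N%:Z %| denq z ^+ 2)%Z.
  by rewrite dvdzE abszX /= pfactor_dvdn ?expn_gt0 ?q0 // lognX.
have := rpredB lh (dvdz_trans lq2 (dvdz_homog (numq z) (denq z))).
rewrite opprB addrC subrK dvdzE /= abszM abszX Gauss_dvdl; last first.
  rewrite coprimeXl // coprimeXr // prime_coprime //.
  apply/negP => ln; have := coprime_num_den z.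
  rewrite /coprime => /eqP g1; have : (l %| 1)%N by rewrite -g1 dvdn_gcd ln.
  by rewrite dvdn1 gtn_eqF // prime_gt1.
by rewrite pfactor_dvdn // ltnn.
Qed.

(** The local estimates at all primes say that the left side divides the right side; the squares
    clear the factor 1/2 in front of the valuations. *)
Lemma denq_iter_growth z s :
  (0 < s)%N -> (forall l, prime l -> (logn l AD <= 2 * logn l s + 1)%N) ->
  forall n,
  ((A0 ^ 2 * `|denq z| ^ d.-1) ^ (d ^ n) <=
   `|denq (iter n (horner (psi a)) z)| ^ (d.-1 * 2) * A0 ^ 2 *
   (psi_gcd a z * gcdn A0 AD * s ^ d.-1) ^ (2 * d ^ n))%N.
Proof.
move=> s0 hs n.
have q0 x : (0 < `|denq x|)%N by rewrite absz_gt0 denq_neq0.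
have g0 := psi_gcd_gt0 z.
have gg0 : (0 < gcdn A0 AD)%N by rewrite gcdn_gt0 A0_gt0.
have L0 : (0 < `|denq (iter n (horner (psi a)) z)| ^ (d.-1 * 2) * A0 ^ 2 *
   (psi_gcd a z * gcdn A0 AD * s ^ d.-1) ^ (2 * d ^ n))%N.
  by rewrite !(muln_gt0, expn_gt0) q0 A0_gt0 g0 gg0 s0.
apply: dvdn_leq => //; apply: dvdn_logn => //.
  by rewrite !(muln_gt0, expn_gt0) q0 A0_gt0.
move=> l pr_l.
rewrite !(lognX, lognM) ?(muln_gt0, expn_gt0, q0, A0_gt0, g0, gg0, s0) //.
rewrite logn_gcd //.
apply: (@local_growth d (logn l A0) (logn l AD) (logn l (psi_gcd a z)) (logn l s)
  (fun n => logn l `|denq (iter n (horner (psi a)) z)|)) => //; last exact: hs.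
  by move=> m; apply: logn_denq_psi.
have := dvdn_leq_log l (_ : (0 < `|denq (psi a).[z]| * psi_gcd a z)%N) (dvdn_denq_psi z).
by rewrite lognM //=; apply; rewrite muln_gt0 q0.
Qed.

End HeightGrowth.

(** * Growth at the archimedean place *)

Section Archimedean.
Variables (d : nat) (a : d.-tuple int).
Hypotheses (d3 : (2 < d)%N) (a0 : a`_0 != 0) (ad : a`_(d.-1) != 0).
Variable B : nat.
Hypothesis coef_B : (coefH a <= B * `|(a`_(d.-1))%R|)%N.

Let T : rat := (2 * d * B)%:R.
Let c : rat := `|(a`_(d.-1))%R|%N%:R.

Let c_gt0 : 0 < c. Proof. by rewrite ltr0n absz_gt0. Qed.

Let B_gt0 : (0 < B)%N.
Proof.
have := leq_coefH a d3 d; rewrite coef_numer // eqxx => /leq_trans/(_ coef_B).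
by rewrite lt0n; apply: contraTneq => ->; rewrite mul0n -ltnNge absz_gt0.
Qed.

Let T_ge1 : 1 <= T.
Proof. by rewrite ler1n !muln_gt0 B_gt0 (ltn_trans _ d3). Qed.

Let numer_le i : `|((numer a)`_i)%:~R| <= B%:R * c :> rat.
Proof.
rewrite -intr_norm -abszE -natrM -pmulrn ler_nat.
exact: leq_trans (leq_coefH a d3 i) coef_B.
Qed.

(** For |z| >= 2dB the lower terms of F add up to at most half of the leading one, and |a_0| <= B
    |a_d|. *)
Lemma psi_expansion z : T <= `|z| -> `|z| ^+ d <= T * `|(psi a).[z]|.
Proof.
move=> hz; have z1 : 1 <= `|z| := le_trans T_ge1 hz.
have a0Q : 0 < `|(a`_0)%:~R| :> rat by rewrite normr_gt0 intr_eq0.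
have e : `|(psi a).[z]| * `|(a`_0)%:~R| = `|\sum_(i < d.+1) ((numer a)`_i)%:~R * z ^+ i|.
  rewrite psiE // hornerZ horner_coef size_map_inj_poly ?size_numer //; last exact: intr_inj.
  rewrite normrM normfV mulrAC mulVf ?gt_eqF // mul1r; congr (`|_|).
  by apply: eq_bigr => i _; rewrite coef_map.
have lowdeg : `|\sum_(i < d) ((numer a)`_i)%:~R * z ^+ i| * 2 <= c * `|z| ^+ d.
  have h : `|\sum_(i < d) ((numer a)`_i)%:~R * z ^+ i| <= \sum_(i < d) B%:R * c * `|z| ^+ d.-1.
    apply: le_trans (ler_norm_sum _ _ _) _; apply: ler_sum => i _.
    rewrite normrM normrX ler_pM ?exprn_ge0 ?normr_ge0 ?numer_le //.
    by apply: ler_weXn2l => //; have := ltn_ord i; lia.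
  apply: le_trans (ler_wpM2r _ h) _ => //; rewrite sumr_const card_ord.
  have -> : `|z| ^+ d = `|z| * `|z| ^+ d.-1 by rewrite -exprS prednK ?(ltn_trans _ d3).
  have -> : B%:R * c * `|z| ^+ d.-1 *+ d * 2 = T * (c * `|z| ^+ d.-1).
    by rewrite /T !natrM -mulr_natr; ring.
  by rewrite mulrCA ler_pM2l // ler_wpM2r ?exprn_ge0.
have top : c * `|z| ^+ d <= `|(psi a).[z]| * `|(a`_0)%:~R| * 2.
  have h : c * `|z| ^+ d <= `|\sum_(i < d.+1) ((numer a)`_i)%:~R * z ^+ i|
           + `|\sum_(i < d) ((numer a)`_i)%:~R * z ^+ i|.
    have -> : c * `|z| ^+ d = `|(a`_(d.-1))%:~R * z ^+ d|.
      by rewrite normrM normrX /c pmulrn abszE intr_norm.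
    have nd : (numer a)`_d = a`_(d.-1) by rewrite coef_numer // eqxx.
    rewrite big_ord_recr /= nd.
    set x := \sum_(i < d) _; set y := _ * _.
    by have := ler_normB (x + y) x; rewrite addrAC subrr add0r.
  rewrite e; lra.
have a0B : `|(a`_0)%:~R| <= B%:R * c.
  by have := numer_le 0; rewrite coef_numer // ltn_eqF ?(ltn_trans _ d3) // (_ : (0 < d.-1)%N) //; lia.
have h2 : c * `|z| ^+ d <= c * (2 * B%:R * `|(psi a).[z]|).
  apply: le_trans top _; have := ler_wpM2l (normr_ge0 (psi a).[z]) a0B.
  nra.
rewrite ler_pM2l // in h2; apply: le_trans h2 _.
rewrite ler_wpM2r // /T !natrM mulrAC ler_peMr ?mulr_ge0 // ler1n.
exact: ltn_trans d3.
Qed.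

(** Below [T] the left side is at most 1. From [T] on, w -> |w| / T is at least raised to the power
    d at each step, since T^d >= T^2, so the orbit stays in the region of expansion. *)
Lemma archimedean_growth z n :
  (Num.max 1 `|z| / T) ^+ (d ^ n) <= Num.max 1 `|iter n (horner (psi a)) z|.
Proof.
have T0 : 0 < T := lt_le_trans ltr01 T_ge1.
have [hz|hz] := leP T `|z|; last first.
  apply: (@le_trans _ _ 1); last by rewrite le_max lexx.
  rewrite exprn_ile1 //; first by rewrite divr_ge0 ?(ltW T0) // le_max ler01.
  by rewrite ler_pdivrMr // mul1r ge_max T_ge1 ltW.
rewrite max_r ?(le_trans T_ge1) //.
suff [h1 h2] : T <= `|iter n (horner (psi a)) z| /\
    (`|z| / T) ^+ (d ^ n) <= `|iter n (horner (psi a)) z| / T.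
  apply: le_trans h2 _; rewrite le_max orbC ler_pdivrMr // ler_peMr //.
elim: n => [|n [IH1 IH2]]; first by rewrite expn0 expr1.
set w := iter n _ z in IH1 IH2 *; rewrite iterS -/w.
have w1 : 1 <= `|w| / T by rewrite ler_pdivlMr // mul1r.
have h : (`|w| / T) ^+ d <= `|(psi a).[w]| / T.
  rewrite expr_div_n ler_pdivrMr ?exprn_gt0 //.
  apply: le_trans (psi_expansion IH1) _.
  have -> : T ^+ d = T * (T * T ^+ (d - 2)) by rewrite -!exprS; congr (_ ^+ _); lia.
  rewrite [_ / T * _]mulrA divfK ?gt_eqF // mulrA [T * _]mulrC ler_peMr ?exprn_ege1 //.
  by rewrite mulr_ge0 // ltW.
split; last first.
  apply: le_trans h; rewrite expnS mulnC exprM lerXn2r ?nnegrE //.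
    by rewrite exprn_ge0 // divr_ge0 // ltW.
  by rewrite (le_trans ler01).
rewrite -[X in X <= _]mul1r -ler_pdivlMr //; apply: le_trans h.
exact: exprn_ege1.
Qed.

End Archimedean.

Lemma ln_nat_ge0 (R : realType) n : 0 <= ln (n%:R : R).
Proof.
case: n => [|n]; first by rewrite ln0.
by apply: ln_ge0; rewrite ler1n.
Qed.

(** * Convergence and basic properties of the canonical height *)

Section CanonicalHeight.
Variables (R : realType) (d : nat) (a : d.-tuple int).
Hypotheses (d3 : (2 < d)%N) (a0 : a`_0 != 0) (ad : a`_(d.-1) != 0).

Local Notation h := (weil_height R).
Local Notation hhat := (canonical_height R d (psi a)).
Let f := horner (psi a).

Lemma weil_heightE x : h x = ln (ratH x)%:R.
Proof. by []. Qed.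

Lemma weil_height_ge0 x : 0 <= h x.
Proof. exact: ln_nat_ge0. Qed.

Let dR_gt1 : 1 < d%:R :> R. Proof. by rewrite ltr1n (ltn_trans _ d3). Qed.
Let dR_gt0 : 0 < d%:R :> R. Proof. by rewrite ltr0n (ltn_trans _ d3). Qed.
Let d1R_gt0 : 0 < d%:R - 1 :> R. Proof. by rewrite subr_gt0. Qed.

Let c : R := ln (d.+1 * coefH a)%:R.

Let coefH_gt0 : (0 < coefH a)%N.
Proof.
by apply: leq_trans (leq_coefH a d3 d); rewrite coef_numer // eqxx absz_gt0.
Qed.

Lemma weil_height_psi x : h (f x) <= c + d%:R * h x.
Proof.
have H0 y : 0 < (ratH y)%:R :> R by rewrite ltr0n ratH_gt0.
have C0 : 0 < (d.+1 * coefH a)%:R :> R by rewrite ltr0n muln_gt0.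
rewrite !weil_heightE /c mulr_natl -lnXn // -lnM ?posrE ?exprn_gt0 //.
rewrite ler_ln ?posrE ?mulr_gt0 ?exprn_gt0 //.
by rewrite -natrX -natrM ler_nat ratH_psi.
Qed.

Let u x (n : nat) : R := h (iter n f x) / d%:R ^+ n.

(** Tate's telescoping series in monotone form: adding the tail of the geometric series of errors
    makes the sequence nonincreasing. Convergence follows from boundedness below, and the value at n
    = 0 is the upper bound for the limit. *)
Let w x (n : nat) : R := u x n + c / (d%:R - 1) / d%:R ^+ n.

Let w_noninc x : nonincreasing_seq (w x).
Proof.
apply/nonincreasing_seqP => n; rewrite /w /u iterS.
have dn : 0 < d%:R ^+ n.+1 :> R by rewrite exprn_gt0.
rewrite -!mulrDl ler_pdivrMr // exprS.
have -> : (h (iter n f x) + c / (d%:R - 1)) / d%:R ^+ n * (d%:R * d%:R ^+ n) =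
   c + d%:R * h (iter n f x) + c / (d%:R - 1) :> R.
  by field; rewrite expf_neq0 ?gt_eqF.
by rewrite lerD2r weil_height_psi.
Qed.

Let inv_cvg0 : (fun n : nat => (d%:R ^+ n)^-1 : R) @ \oo --> (0 : R).
Proof.
rewrite (_ : (fun n : nat => _) = (fun n => d%:R^-1 ^+ n)); last by apply/funext => n; rewrite exprVn.
by apply: cvg_expr; rewrite ger0_norm ?invr_ge0 ?invf_lt1 // ltW.
Qed.

Let cvg_invM (e : R) : (fun n : nat => e / d%:R ^+ n : R) @ \oo --> (0 : R).
Proof. by rewrite -(mulr0 e); apply: cvgMr. Qed.

Let u_cvg x : cvgn (u x).
Proof.
have cw : cvgn (w x).
  apply: nonincreasing_is_cvgn; first exact: w_noninc.
  exists 0 => _ [n _ <-]; rewrite /w /u addr_ge0 ?divr_ge0 ?weil_height_ge0 ?exprn_ge0 //.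
  - exact: ln_nat_ge0.
  - exact: ltW.
rewrite (_ : u x = (fun n => w x n - c / (d%:R - 1) / d%:R ^+ n)).
  by apply: is_cvgB => //; apply/cvg_ex; exists 0; exact: cvg_invM.
by apply/funext => n; rewrite /w addrK.
Qed.

Lemma canonical_height_cvg x : u x @ \oo --> hhat x.
Proof. exact: u_cvg. Qed.

Lemma canonical_height_ge0 x : 0 <= hhat x.
Proof.
apply: limr_ge; first exact: u_cvg.
by apply: nearW => n; rewrite divr_ge0 ?weil_height_ge0 ?exprn_ge0.
Qed.

Lemma canonical_height_le x : hhat x <= c / (d%:R - 1) + h x.
Proof.
apply: limr_le; first exact: u_cvg.
have <- : w x 0 = c / (d%:R - 1) + h x by rewrite /w /u expr0 !divr1 addrC.
apply: nearW => n; apply: le_trans (w_noninc x (leq0n n)).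
rewrite /w lerDl divr_ge0 ?divr_ge0 ?exprn_ge0 ?ln_nat_ge0 //.
exact: ltW.
Qed.

Lemma canonical_height_psi x : hhat (f x) = d%:R * hhat x.
Proof.
apply: cvg_lim => //.
have : (fun n => d%:R * u x n.+1) @ \oo --> d%:R * hhat x.
  by apply: cvgMr; rewrite (cvg_shiftS (u x)); apply: canonical_height_cvg.
apply: cvg_trans; apply: near_eq_cvg; apply: nearW => n.
rewrite /u iterSr exprS; field.
by rewrite expf_neq0 ?gt_eqF.
Qed.

Lemma canonical_height_ge x (e E : R) :
  (forall n, e * d%:R ^+ n <= h (iter n f x) + E) -> e <= hhat x.
Proof.
move=> he; have uE : (fun n => u x n + E / d%:R ^+ n) @ \oo --> hhat x.
  by rewrite -[hhat x]addr0; apply: cvgD; [exact: canonical_height_cvg | exact: cvg_invM].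
rewrite -(cvg_lim _ uE) //; apply: limr_ge; first by apply/cvg_ex; exists (hhat x).
by apply: nearW => n; rewrite /u -mulrDl ler_pdivlMr ?exprn_gt0.
Qed.

End CanonicalHeight.

Lemma ratH_max (x : rat) : (ratH x)%:R = `|denq x|%N%:R * Num.max 1 `|x|.
Proof.
have q0 : 0 < `|denq x|%N%:R :> rat by rewrite ltr0n absz_gt0 denq_neq0.
have e : `|numq x|%N%:R = `|denq x|%N%:R * `|x|.
  by rewrite !pmulrn !abszE !intr_norm numqE normrM mulrC.
rewrite maxr_pMr ?ltW // mulr1 -e /ratH maxnC /maxn /Order.max ltr_nat.
by case: ifP.
Qed.

Section LowerBound.
Variables (R : realType) (d : nat) (a : d.-tuple int).
Hypotheses (d3 : (2 < d)%N) (a0 : a`_0 != 0) (ad : a`_(d.-1) != 0).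

Local Notation h := (weil_height R).
Local Notation hhat := (canonical_height R d (psi a)).
Let f := horner (psi a).
Let A0 := `|(a`_0)%R|%N.
Let AD := `|(a`_(d.-1))%R|%N.
Let lnn (n : nat) : R := ln n%:R.
Let lnM (m n : nat) : (0 < m)%N -> (0 < n)%N -> lnn (m * n) = lnn m + lnn n.
Proof. by move=> m0 n0; rewrite /lnn natrM lnM // posrE ltr0n. Qed.
Let lnX (m k : nat) : (0 < m)%N -> lnn (m ^ k) = k%:R * lnn m.
Proof. by move=> m0; rewrite /lnn natrX lnXn ?ltr0n // mulr_natl. Qed.
Let mx (x : rat) : R := ratr (Num.max 1 `|x|).

Let mx_ge1 x : 1 <= mx x.
Proof.
have h1 : ratr 1 <= mx x by rewrite ler_rat le_max lexx.
by rewrite rmorph1 in h1.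
Qed.

Let hE x : h x = lnn `|denq x| + ln (mx x).
Proof.
have q0 : 0 < `|denq x|%N%:R :> R by rewrite ltr0n absz_gt0 denq_neq0.
rewrite weil_heightE -(ratr_nat R) ratH_max rmorphM /= ratr_nat.
by rewrite exp.lnM ?posrE // (lt_le_trans ltr01 (mx_ge1 x)).
Qed.

(** Denominators contribute the terms in [A0] and half of log |q|; the archimedean growth
    contributes log max(1,|z|), of which half is kept to complete h(z)/2. The division of coefH by
    [AD] enters only through [B]. *)
Lemma canonical_height_lower (z : rat) (B s : nat) :
  (coefH a <= B * AD)%N -> (0 < s)%N ->
  (forall l, prime l -> (logn l AD <= 2 * logn l s + 1)%N) ->
  (lnn A0 - lnn (psi_gcd a z) - lnn (gcdn A0 AD)) / (d%:R - 1) + 2^-1 * h z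
    - lnn s - lnn (2 * d * B) <= hhat z.
Proof.
move=> hB s0 hs.
have A0_gt0 : (0 < A0)%N by rewrite absz_gt0.
have AD_gt0 : (0 < AD)%N by rewrite absz_gt0.
have B0 : (0 < B)%N.
  have := leq_coefH a d3 d; rewrite coef_numer // eqxx => /leq_trans/(_ hB).
  by rewrite lt0n; apply: contraTneq => ->; rewrite mul0n -ltnNge.
have T0 : (0 < 2 * d * B)%N by rewrite !muln_gt0 B0 (ltn_trans _ d3).
have g0 := psi_gcd_gt0 a0 z.
have gg0 : (0 < gcdn A0 AD)%N by rewrite gcdn_gt0 A0_gt0.
have q0 x : (0 < `|denq x|)%N by rewrite absz_gt0 denq_neq0.
have d1 : 0 < d%:R - 1 :> R by rewrite subr_gt0 ltr1n (ltn_trans _ d3).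
apply: (@canonical_height_ge R d a d3 a0 ad z _ (lnn A0 / (d%:R - 1))) => n.
have I1 : d%:R ^+ n * (2 * lnn A0 + (d%:R - 1) * lnn `|denq z|) <=
  2 * (d%:R - 1) * lnn `|denq (iter n f z)| + 2 * lnn A0 +
  2 * d%:R ^+ n * (lnn (psi_gcd a z) + lnn (gcdn A0 AD) + (d%:R - 1) * lnn s).
  have := denq_iter_growth d3 a0 ad z s0 hs n; rewrite -/A0 -/AD -/f => le_nat.
  have {le_nat} : lnn ((A0 ^ 2 * `|denq z| ^ d.-1) ^ (d ^ n)) <=
     lnn (`|denq (iter n f z)| ^ (d.-1 * 2) * A0 ^ 2 *
        (psi_gcd a z * gcdn A0 AD * s ^ d.-1) ^ (2 * d ^ n)).
    rewrite /lnn ler_ln ?posrE ?ltr0n ?ler_nat //.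
      by rewrite !(muln_gt0, expn_gt0) A0_gt0 q0.
    by rewrite !(muln_gt0, expn_gt0) A0_gt0 q0 g0 gg0 s0.
  rewrite !(lnX, lnM) ?(muln_gt0, expn_gt0, A0_gt0, q0, g0, gg0, s0) //.
  have -> : d.-1%:R = d%:R - 1 :> R by rewrite -subn1 natrB // (ltn_trans _ d3).
  rewrite !natrM natrX.
  have -> : d.-1%:R = d%:R - 1 :> R by rewrite -subn1 natrB // (ltn_trans _ d3).
  by rewrite [_ * 2]mulrC.
have I2 : d%:R ^+ n * (ln (mx z) - lnn (2 * d * B)) <= ln (mx (iter n f z)).
  have := archimedean_growth d3 a0 ad hB z n; rewrite -(ler_rat R).
  rewrite -/f -/(mx (iter n f z)) rmorphXn rmorphM /= fmorphV /= ratr_nat -/(mx z).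
  have T0R : 0 < (2 * d * B)%:R :> R by rewrite ltr0n.
  have m0 x : 0 < mx x := lt_le_trans ltr01 (mx_ge1 x).
  move: (mx z) (mx (iter n f z)) (m0 z) (m0 (iter n f z)) => x y x0 y0 le_xy.
  have : ln ((x / (2 * d * B)%:R) ^+ (d ^ n)) <= ln y.
    by rewrite ler_ln // posrE exprn_gt0 // divr_gt0.
  rewrite lnXn; last by rewrite divr_gt0.
  by rewrite ln_div ?posrE // -[_ *+ (d ^ n)]mulr_natl natrX.
rewrite !hE -/f; have m1 : 0 <= ln (mx z) by rewrite ln_ge0.
move: I1 I2 m1; set D := d%:R ^+ n.
have D0 : 0 < D by rewrite exprn_gt0 // ltr0n (ltn_trans _ d3).
move: (lnn A0) (lnn (psi_gcd a z)) (lnn (gcdn _ _)) (lnn s) (lnn (2 * d * B))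
  (lnn `|denq z|) (lnn `|denq (iter n f z)|) (ln (mx z)) (ln (mx (iter n f z))).
move: (d%:R - 1) d1 => k k0 x y g t T q qn m mn I1 I2 m0.
have I3 : D * (x - y - g) / k + D * (q / 2 - t) <= qn + x / k.
  rewrite -(ler_pM2r (_ : 0 < 2 * k)) ?mulr_gt0 //.
  have -> : (D * (x - y - g) / k + D * (q / 2 - t)) * (2 * k) =
     D * (2 * x + k * q) - 2 * D * (y + g + k * t) by field; rewrite gt_eqF.
  have -> : (qn + x / k) * (2 * k) = 2 * k * qn + 2 * x by field; rewrite gt_eqF.
  lra.
have I4 : D * (m / 2) <= D * m by rewrite ler_pM2l //; lra.
have -> : ((x - y - g) / k + 2^-1 * (q + m) - t - T) * D =
   D * (x - y - g) / k + D * (q / 2 - t) + D * (m / 2) - D * T by field; rewrite gt_eqF.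
lra.
Qed.

End LowerBound.

(** * Dynamical independence and existence of the successive minima *)

Lemma meval_mwiden (K : comNzRingType) n (v : 'I_n.+1 -> K) (P : mpoly.mpoly n K) :
  mpoly.meval v (mpoly.mwiden P) =
  mpoly.meval (fun i => v (widen_ord (leqnSn n) i)) P.
Proof.
rewrite /mpoly.mwiden /mpoly.mmap raddf_sum /= [RHS]mpoly.mevalE.
apply: eq_bigr => m _; rewrite mpoly.mevalM mpoly.mevalC; congr (_ * _).
rewrite /mpoly.mmap1 rmorph_prod /=; apply: eq_bigr => i _.
by rewrite rmorphXn /= mpoly.mevalXU.
Qed.

Lemma dyn_independent_belast (p : {poly rat}) N (z : N.+1.-tuple rat) :
  dyn_independent p z ->
  dyn_independent p [tuple tnth z (widen_ord (leqnSn N) i) | i < N].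
Proof.
move=> ind [P [P0 Pz Pinv]]; apply: ind; exists (mpoly.mwiden P); split.
- by apply: contra P0 => /eqP; rewrite -(mpoly.mwiden0 N algC) => /mpoly.inj_mwiden ->.
- rewrite meval_mwiden -[RHS]Pz; apply: mpoly.meval_eq => i.
  by rewrite tnth_mktuple.
- by move=> xi; rewrite !meval_mwiden => /Pinv.
Qed.

(** The diagonal is invariant under psi acting on both coordinates and contains (0,0). *)
Lemma dyn_independent_pair_neq0 (p : {poly rat}) (z : 2.-tuple rat) :
  dyn_independent p z -> exists i, tnth z i != 0.
Proof.
move=> ind; apply: contrapT => /forallNP z0; apply: ind.
have {}z0 i : tnth z i = 0 by apply/eqP; have /negP := z0 i; rewrite negbK.
exists (mpoly.mpolyX algC (mpoly.mnm1 ord0) - mpoly.mpolyX algC (mpoly.mnm1 ord_max)); split.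
- apply/eqP => /(congr1 (mpoly.meval (fun i : 'I_2 => (i : nat)%:R))) /eqP.
  by rewrite mpoly.mevalB !mpoly.mevalXU mpoly.meval0 /= sub0r oppr_eq0 oner_eq0.
- by rewrite mpoly.mevalB !mpoly.mevalXU !z0 subrr.
- move=> xi; rewrite !mpoly.mevalB !mpoly.mevalXU => /eqP; rewrite subr_eq0 => /eqP->.
  by rewrite subrr.
Qed.

Lemma dyn_independent_infinite_orbit (p : {poly rat}) (x : rat) :
  injective (fun n => iter n (horner p) x) -> dyn_independent p [tuple x].
Proof.
move=> inj; apply: dyn_independent_of_dense => P P0; apply: muni_eq0.
pose v (i : 'I_0) : rat := 0.
pose Q := map_poly (mpoly.meval v) (mpoly.muni P).
have Q0 n : root Q (iter n (horner p) x).
  apply/eqP; rewrite -[RHS](P0 n) meval_muni; congr (_.[_]).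
    by apply: eq_map_poly => c; apply: mpoly.meval_eq; case.
suff QE : Q = 0.
  apply/polyP => i; rewrite coef0; apply: (@meval_mpoly0_inj _ v).
  by rewrite -(coef0 rat i) -QE coef_map_id0 ?mpoly.meval0.
apply/eqP/negPn/negP => Qn0.
have := max_poly_roots Qn0 (_ : all (root Q) [seq iter n (horner p) x | n <- iota 0 (size Q)]).
rewrite size_map size_iota ltnn map_inj_uniq ?iota_uniq // => H.
by have : false by apply: H => //; apply/allP => _ /mapP[n _ ->].
Qed.

Lemma seq_min (R : realType) (s : seq R) (P : R -> Prop) :
  (exists2 x, x \in s & P x) ->
  exists x, P x /\ forall y, y \in s -> P y -> x <= y.
Proof.
elim: s => [[x]|x s IHs [y ys Py]]; first by rewrite in_nil.
have [[y' y's Py']|no] := pselect (exists2 y, y \in s & P y).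
  have [m [Pm mmin]] := IHs (ex_intro2 _ _ y' y's Py').
  have [[Px xm]|nx] := pselect (P x /\ x <= m).
    exists x; split=> // t; rewrite inE => /predU1P[-> //|ts Pt].
    exact: le_trans xm (mmin t ts Pt).
  exists m; split=> // t; rewrite inE => /predU1P[-> Px|]; last exact: mmin.
  by rewrite leNgt; apply/negP => /ltW xm; apply: nx.
move: ys; rewrite inE => /predU1P[yx|ys]; last by case: no; exists y.
subst y; exists x; split=> // t; rewrite inE => /predU1P[-> //|ts Pt].
by case: no; exists t.
Qed.

Lemma ratH_finite (K : nat) : exists s : seq rat, forall x, (ratH x <= K)%N -> x \in s.
Proof.
exists [seq (u%:Z - K%:Z)%:~R / v%:R | u <- iota 0 (2 * K).+1, v <- iota 0 K.+1] => x.
rewrite geq_max => /andP[hn hd]; apply/allpairsP.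
exists (`|(numq x + K%:Z)%R|%N, `|denq x|%N); split.
- by rewrite mem_iota /fst; lia.
- by rewrite mem_iota /snd; lia.
- rewrite /fst /snd gez0_abs; last by lia.
  rewrite addrK pmulrn gez0_abs ?denq_ge0 //.
  by rewrite divq_num_den.
Qed.

Section SuccessiveMinima.
Variables (R : realType) (d : nat) (a : d.-tuple int).
Hypotheses (d3 : (2 < d)%N) (a0 : a`_0 != 0) (ad : a`_(d.-1) != 0).

Local Notation hhat := (canonical_height R d (psi a)).
Let height N (z : N.-tuple rat) : R := \big[Num.max/0]_(i < N) hhat (tnth z i).

(** The lower bound is used with the crude choice [B = coefH a]: since [psi_gcd] divides [a_0], it
    bounds h(x) by 2(m + C) with [C] depending on [a] only. *)
Lemma northcott (m : R) : exists s : seq rat, forall x, hhat x <= m -> x \in s.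
Proof.
have A0_gt0 : (0 < `|(a`_0)%R|)%N by rewrite absz_gt0.
have AD_gt0 : (0 < `|(a`_(d.-1))%R|)%N by rewrite absz_gt0.
have [t [t0 _ ht]] := max_square_divisor AD_gt0.
pose C : R := ln (gcdn `|(a`_0)%R| `|(a`_(d.-1))%R|)%:R / (d%:R - 1) + ln t%:R
   + ln (2 * d * coefH a)%:R.
have [s hs] := ratH_finite (Num.truncn (expR (2 * (m + C)))).
exists s => x hx; apply: hs.
have := canonical_height_lower R d3 a0 ad x (leq_pmulr (coefH a) AD_gt0) t0 ht.
have d1 : 0 < d%:R - 1 :> R by rewrite subr_gt0 ltr1n (ltn_trans _ d3).
set A := ln _; set G := ln (psi_gcd a x)%:R.
have GA : 0 <= (A - G) / (d%:R - 1).
  apply: divr_ge0; last exact: ltW.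
  rewrite subr_ge0 ler_ln ?posrE ?ltr0n ?psi_gcd_gt0 // ler_nat.
  by rewrite dvdn_leq // dvdn_gcdr.
move=> low; have le_h : weil_height R x <= 2 * (m + C).
  move: low GA; rewrite /C mulrBl; lra.
rewrite truncn_ge_nat ?expR_ge0 // -[leLHS]lnK ?posrE ?ltr0n ?ratH_gt0 //.
by rewrite ler_expR.
Qed.

Lemma height_le N (z : N.-tuple rat) (m : R) : 0 <= m ->
  (forall i, hhat (tnth z i) <= m) -> height z <= m.
Proof. by move=> m0 hz; apply/bigmax_leP; split=> // i _; apply: hz. Qed.

Lemma le_height N (z : N.-tuple rat) i : hhat (tnth z i) <= height z.
Proof. exact: (le_bigmax _ (fun i => hhat (tnth z i))). Qed.

Lemma height_ge0 N (z : N.-tuple rat) : 0 <= height z.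
Proof. exact: bigmax_ge_id. Qed.

(** Tuples of height at most that of [z] have all their entries in one finite list, so the minimum
    is taken over finitely many values. *)
Lemma succ_min_exists N (z : N.-tuple rat) : dyn_independent (psi a) z ->
  exists2 l, succ_min d (psi a) N l & l <= height z.
Proof.
move=> indz; have [s hs] := northcott (height z).
pose P (x : R) := exists2 y : N.-tuple rat, dyn_independent (psi a) y & x = height y.
pose L := [seq height [tuple nth 0 s (tnth t i) | i < N] | t : N.-tuple 'I_(size s)].
have inL (y : N.-tuple rat) : height y <= height z -> height y \in L.
  move=> yz; have ys i : tnth y i \in s by apply/hs/(le_trans (le_height y i)).
  apply/mapP; have lt_i i : (index (tnth y i) s < size s)%N by rewrite index_mem.
  exists [tuple Ordinal (lt_i i) | i < N]; first by rewrite mem_enum.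
  congr height; apply: eq_from_tnth => i; rewrite !tnth_mktuple /=.
  by rewrite nth_index.
have [l [[y indy lE] lmin]] : exists x, P x /\ forall y, y \in L -> P y -> x <= y.
  by apply: seq_min; exists (height z); [apply: inL | exists z].
have lz : l <= height z by apply: lmin; [apply: inL | exists z].
exists l => //; split; first by exists y.
move=> _ [y' indy' <-]; have [le_y'|lt_y'] := leP (height y') (height z).
  by apply: lmin; [apply: inL | exists y'].
exact: le_trans lz (ltW lt_y').
Qed.

Lemma dyn_independent_sub_pair N (z : N.-tuple rat) : (2 <= N)%N ->
  dyn_independent (psi a) z ->
  exists2 y : 2.-tuple rat, dyn_independent (psi a) y & height y <= height z.
Proof.
elim: N z => [//|N IHN] z; rewrite leq_eqVlt => /predU1P[N2 indz|N2 indz].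
  by case: N2 => N1; subst N; exists z.
have [y indy yz] := IHN _ N2 (dyn_independent_belast indz).
exists y => //; apply: le_trans yz _; apply: height_le => [|i]; first exact: height_ge0.
by rewrite tnth_mktuple le_height.
Qed.

Lemma canonical_height_iter x n :
  hhat (iter n (horner (psi a)) x) = d%:R ^+ n * hhat x.
Proof.
elim: n => [|n IHn]; first by rewrite expr0 mul1r.
by rewrite iterS (canonical_height_psi R d3 a0 ad) IHn exprS mulrA.
Qed.

(** The heights d^n hhat(x) of the iterates are pairwise distinct, so the orbit is infinite. *)
Lemma dyn_independent_single x : 0 < hhat x -> dyn_independent (psi a) [tuple x].
Proof.
move=> hx; apply: dyn_independent_infinite_orbit => m n /(congr1 (fun y => hhat y)).
rewrite !canonical_height_iter => /(mulIf (lt0r_neq0 hx)) /eqP.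
by rewrite -!natrX eqr_nat eqn_exp2l ?(ltn_trans _ d3) // => /eqP.
Qed.

(** [u0] and [v0] enclose the height of 0, [u] bounds the heights of all other points from below and
    [v] those of the given tuple from above. The point 0 alone is admissible for the first minimum,
    but no pair independent under psi consists of zeros. *)
Lemma succ_min_bounds N (z : N.-tuple rat) (u0 v0 u v : R) : (2 <= N)%N ->
  0 < u0 -> u0 <= u -> u0 <= hhat 0 -> hhat 0 <= v0 ->
  (forall x, x != 0 -> u <= hhat x) ->
  dyn_independent (psi a) z -> (forall i, hhat (tnth z i) <= v) ->
  exists l1 l2 lN, [/\ succ_min d (psi a) 1 l1, succ_min d (psi a) 2 l2,
    succ_min d (psi a) N lN, u0 <= l1 <= v0 & [/\ u <= l2, l2 <= lN & lN <= v]].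
Proof.
move=> N2 u0_gt0 u0u h0u h0v hu indz hz.
have ind0 : dyn_independent (psi a) [tuple 0] by apply/dyn_independent_single/(lt_le_trans u0_gt0).
have [l1 min1 le1] := succ_min_exists ind0.
have [lN minN leN] := succ_min_exists indz.
have [[zN indN lNE] lbN] := minN.
have [y2 ind2 le2N] := dyn_independent_sub_pair N2 indN.
have [l2 min2 le2] := succ_min_exists ind2.
exists l1, l2, lN; split=> //.
- apply/andP; split.
    have [[z1 ind1 <-] _] := min1; apply: le_trans (le_height z1 ord0).
    by have [->|/hu] := eqVneq (tnth z1 ord0) 0; last exact: le_trans.
  apply: le_trans le1 _; apply: height_le => [|i].
    exact: le_trans (ltW u0_gt0) (le_trans h0u h0v).
  by rewrite ord1.
- have v0' : 0 <= v.
    have [i0 _] := dyn_independent_pair_neq0 ind2.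
    by apply: le_trans (hz (Ordinal (ltnW N2))); apply: canonical_height_ge0.
  split.
  + have [[z2 indz2 <-] _] := min2.
    have [i zi] := dyn_independent_pair_neq0 indz2.
    exact: le_trans (hu _ zi) (le_height z2 i).
  + by rewrite -lNE; apply: le_trans le2 le2N.
  + exact: le_trans leN (height_le v0' hz).
Qed.

End SuccessiveMinima.

(** * Counting exceptional polynomials *)

Lemma card_sum_nat (T : finType) (P : pred T) : #|P| = (\sum_i P i)%N.
Proof. by rewrite -sum1_card big_mkcond; apply: eq_bigr => i _; rewrite unfold_in; case: ifP. Qed.

Lemma count_congr (w m : nat) (Q : pred 'I_w) : (0 < m)%N ->
  (forall i j : 'I_w, Q i -> Q j -> i = j %[mod m]) -> (#|Q| <= (w %/ m).+1)%N.
Proof.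
move=> m0 hQ; have lt_i (i : 'I_w) : (i %/ m < (w %/ m).+1)%N.
  by rewrite ltnS leq_div2r // ltnW.
rewrite -(card_ord (w %/ m).+1) -(card_in_image (f := fun i => Ordinal (lt_i i))).
  exact: max_card.
move=> i j Qi Qj [e]; apply: val_inj => /=.
by rewrite (divn_eq i m) (divn_eq j m) e (hQ i j).
Qed.

Lemma count_congr_mul (w m : nat) (Q : pred 'I_w) : (0 < m <= w)%N ->
  (forall i j : 'I_w, Q i -> Q j -> i = j %[mod m]) -> (m * #|Q| <= 2 * w)%N.
Proof.
case/andP=> m0 mw hQ; apply: leq_trans (_ : m * (w %/ m).+1 <= _)%N.
  by rewrite leq_mul2l count_congr ?orbT.
by rewrite mulnS mulnC [(2 * w)%N]mul2n -addnn leq_add // leq_trunc_div.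
Qed.

(** Coefficients in [-n, n] are indexed by a finite type, shifted by [n], so that counts become
    cardinals. *)
Definition dec (n : nat) (i : 'I_(2 * n).+1) : int := (i : nat)%:Z - n%:Z.

Lemma dec_injective n : injective (@dec n).
Proof. by move=> i j /addIr [] /ord_inj. Qed.

Lemma abs_dec n (i : 'I_(2 * n).+1) : (`|dec i| <= n)%N.
Proof. by have := ltn_ord i; rewrite /dec; lia. Qed.

Lemma dec_surj n (x : int) : (`|x| <= n)%N -> exists i, @dec n i = x.
Proof.
move=> xn; have lt_i : (`|(x + n%:Z)%R|%N < (2 * n).+1)%N by lia.
by exists (Ordinal lt_i); rewrite /dec /=; lia.
Qed.

Lemma dvdz_dec_congr n (m : nat) (i j : 'I_(2 * n).+1) :
  (m%:Z %| dec i - dec j)%Z -> i = j %[mod m].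
Proof.
have -> : dec i - dec j = (i : nat)%:Z - (j : nat)%:Z by rewrite /dec; ring.
by rewrite -eqz_mod_dvd => /eqP; rewrite !modz_nat => -[].
Qed.

(** The gcd is at most the sum of all divisors [t] of [y] that divide [f i], and each [t]
    contributes at most [K] in total. On average a gcd is thus at most of the order of the number of
    divisors of [y]. *)
Lemma leq_sum_gcd (I : finType) (P : pred I) (f : I -> nat) (y K : nat) : (0 < y)%N ->
  (forall t, t \in divisors y -> (t * #|[pred i | P i && (t %| f i)]| <= K)%N) ->
  (\sum_(i | P i) gcdn (f i) y <= size (divisors y) * K)%N.
Proof.
move=> y0 hK.
apply: leq_trans (_ : \sum_(i | P i) \sum_(t <- divisors y) t * (t %| f i) <= _)%N.
  apply: leq_sum => i _; rewrite (bigD1_seq (gcdn (f i) y)) ?divisors_uniq //=.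
    by rewrite dvdn_gcdl muln1 leq_addr.
  by rewrite -dvdn_divisors // dvdn_gcdr.
have -> : (size (divisors y) * K = \sum_(t <- divisors y) K)%N.
  by rewrite big_const_seq count_predT iter_addn_0 mulnC.
rewrite exchange_big /= big_seq [leqRHS]big_seq.
apply: leq_sum => t /hK; apply: leq_trans.
rewrite -big_distrr /= card_sum_nat big_mkcond leq_mul2l leq_sum ?orbT // => i _ /=.
by case: (P i).
Qed.

(** Excluding 0 is what allows [t] larger than the interval: no multiple of [t] is then left. *)
Lemma count_dvd_dec_neq0 n (t : nat) : (0 < t)%N ->
  (t * #|[pred i : 'I_(2 * n).+1 | (dec i != 0) && (t %| `|dec i|)]| <= 2 * (2 * n).+1)%N.
Proof.
move=> t0; have [tw|tw] := leqP t (2 * n).+1.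
  apply: count_congr_mul; rewrite ?t0 // => i j; rewrite !inE => /andP[_ ti] /andP[_ tj].
  by apply: dvdz_dec_congr; rewrite rpredB // dvdzE.
rewrite card_sum_nat big1 ?muln0 // => i _ /=; case: eqP => //= /eqP i0.
by rewrite gtnNdvd ?absz_gt0 //; have := abs_dec i; lia.
Qed.

Lemma markov_card (I : finType) (P : pred I) (f : I -> nat) (G K : nat) :
  (\sum_(i | P i) f i <= K)%N -> (G * #|[pred i | P i && (G < f i)]| <= K)%N.
Proof.
apply: leq_trans; rewrite card_sum_nat big_distrr [leqRHS]big_mkcond leq_sum // => i _ /=.
by case: (P i); case: ltnP => h; rewrite ?muln0 ?muln1 // ltnW.
Qed.

Lemma count_dvd_dec n (t : nat) : (0 < t <= (2 * n).+1)%N ->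
  (t * #|[pred i : 'I_(2 * n).+1 | t %| `|dec i|]| <= 2 * (2 * n).+1)%N.
Proof.
move=> ht; apply: count_congr_mul => // i j; rewrite !inE => ti tj.
by apply: dvdz_dec_congr; rewrite rpredB // dvdzE.
Qed.

(** With u = gcd(be, t), reduction modulo [u] fixes y modulo [u], as [al] is prime to [be]; for
    given y, x is then fixed modulo [t / u]. The two savings multiply to [t]. *)
Lemma count_dvd_pair n (t : nat) (al be c : int) : coprimez al be ->
  (0 < t <= (2 * n).+1)%N ->
  (t * #|[pred x : 'I_(2 * n).+1 * 'I_(2 * n).+1 |
      t %| `|(be * dec x.1 + al * dec x.2 + c)%R| ]| <= 4 * (2 * n).+1 ^ 2)%N.
Proof.
move=> cop /andP[t0 tw]; set w := (2 * n).+1 in tw *.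
pose u := gcdn `|be| t; have u0 : (0 < u)%N by rewrite gcdn_gt0 t0 orbT.
have ut : (u %| t)%N by apply: dvdn_gcdr.
have tE : t = (u * (t %/ u))%N by rewrite mulnC divnK.
have tu0 : (0 < t %/ u)%N by rewrite divn_gt0 // dvdn_leq.
pose P x y := (t%:Z %| be * @dec n x + al * @dec n y + c)%Z.
pose Yv := [pred y : 'I_w | [exists x, P x y]].
have cY : (u * #|Yv| <= 2 * w)%N.
  apply: count_congr_mul; first by rewrite u0 (leq_trans (dvdn_leq t0 ut)).
  move=> y y' /existsP[x Px] /existsP[x' Px']; apply: dvdz_dec_congr.
  have du z : (t%:Z %| z)%Z -> (u%:Z %| z)%Z by apply: dvdz_trans; rewrite dvdzE.
  have := rpredB (du _ Px) (du _ Px').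
  have -> : be * dec x + al * dec y + c - (be * dec x' + al * dec y' + c) =
    be * (dec x - dec x') + al * (dec y - dec y') by ring.
  have dbe : (u%:Z %| be)%Z by rewrite dvdzE /= dvdn_gcdl.
  move=> /rpredB /(_ (dvdz_mulr (dec x - dec x') dbe)).
  rewrite addrAC subrr add0r Gauss_dvdzr //.
  rewrite coprimezE /=; apply: coprime_dvdl (dvdn_gcdl _ _) _.
  by rewrite coprime_sym -coprimezE.
have cX y : (t %/ u * #|[pred x | P x y]| <= 2 * w)%N.
  apply: count_congr_mul; first by rewrite tu0 (leq_trans (leq_div t u)).
  move=> x x'; rewrite !inE => Px Px'; apply: dvdz_dec_congr.
  have := rpredB Px Px'.
  have -> : be * dec x + al * dec y + c - (be * dec x' + al * dec y + c) =
    be * (dec x - dec x') by ring.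
  rewrite !dvdzE abszM /= {1}tE {1}(_ : `|be|%N = (u * (`|be| %/ u))%N); last first.
    by rewrite mulnC divnK // dvdn_gcdl.
  rewrite -mulnA dvdn_pmul2l // Gauss_dvdr //.
  rewrite coprime_sym /coprime -(eqn_pmul2l u0) muln_gcdr -tE muln1.
  by rewrite [(u * _)%N]mulnC divnK ?dvdn_gcdl.
rewrite card_sum_nat.
rewrite (eq_bigr (fun x => (P x.1 x.2 : nat))); last by move=> [x y] _; rewrite /P dvdzE.
rewrite -(pair_bigA _ (fun x y => (P x y : nat))) exchange_big /=.
have -> : (\sum_j \sum_i P i j = \sum_(j in Yv) #|[pred x | P x j]|)%N.
  rewrite [RHS]big_mkcond; apply: eq_bigr => y _; rewrite card_sum_nat.
  rewrite inE; case: ifP => [//|/existsP ny].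
  by rewrite big1 // => x _; case: (boolP (P x y)) => // Pxy; case: ny; exists x.
rewrite {1}tE -mulnA big_distrr /= (_ : 4 * w ^ 2 = 2 * w * (2 * w))%N; last by lia.
apply: leq_trans (_ : u * (#|Yv| * (2 * w)) <= _)%N; last by rewrite mulnA leq_mul2r cY orbT.
by rewrite leq_mul2l -sum_nat_const leq_sum ?orbT // => y _; apply: cX.
Qed.

(** * Sieving a_1 for noncritical fixed points modulo primes *)

Lemma card_roots (F : finFieldType) (q : {poly F}) : q != 0 ->
  (#|[pred r | root q r]| < size q)%N.
Proof.
move=> q0; rewrite cardE; apply: max_poly_roots => //; last exact: enum_uniq.
by apply/allP => r; rewrite mem_enum.
Qed.

(* Modulo [l], [r] is a noncritical fixed point of [(P + c X) / P(0)]. *)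
Definition fixes_residue (l : nat) (P : {poly int}) (c : int) (r : nat) : bool :=
  (l%:Z %| P.[r%:Z] + c * r%:Z - P`_0 * r%:Z)%Z && ~~ (l%:Z %| P^`().[r%:Z] + c)%Z.

Definition no_fixed_residue (l : nat) (P : {poly int}) (c : int) : bool :=
  [forall r : 'I_l, ~~ fixes_residue l P c r].

(* Over F_l every residue r <> 0 is a fixed point for exactly one c, critical
   for at most d values of r, and each c serves at most d residues r. *)
Lemma card_no_fixed_residue (l d n : nat) (P : {poly int}) : (0 < d)%N ->
  prime l -> (2 * d + 2 <= l)%N -> (size P <= d.+1)%N -> ~~ (l%:Z %| P`_0)%Z ->
  (2 * d * #|[pred x : 'I_l | no_fixed_residue l P ((x : nat)%:Z - n%:Z)]| <=
   (2 * d).-1 * l)%N.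
Proof.
move=> d0 pr_l dl sP lP0; set B := [pred x | _].
pose F := 'F_l; have chF : l \in [pchar F] := pchar_Fp pr_l.
have zF (z : int) : (l%:Z %| z)%Z = (z%:~R == 0 :> F) by rewrite (dvdz_pcharf chF).
pose p : {poly F} := map_poly intr P.
have sp : (size p <= d.+1)%N by apply: leq_trans (size_poly _ _) sP.
have p0 : p`_0 = (P`_0)%:~R by rewrite coef_map.
have p0n : p`_0 != 0 by rewrite p0 -zF.
have cardF : #|{: F}| = l by rewrite card_Fp.
have q_neq0 (q : {poly F}) : q`_0 != 0 -> q != 0.
  by apply: contraNneq => ->; rewrite coef0.
have sX (c : F) : (size (c *: 'X : {poly F}) <= d.+1)%N.
  by apply: leq_trans (size_scale_leq _ _) _; rewrite size_polyX.
have sD (q1 q2 : {poly F}) : (size q1 <= d.+1)%N -> (size q2 <= d.+1)%N ->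
    (size (q1 + q2)%R <= d.+1)%N.
  by move=> h1 h2; apply: leq_trans (size_polyD _ _) _; rewrite geq_max h1.
(* Eliminating c between the fixed point equation p(r) + (c - p_0) r = 0 and the critical point
   equation p'(r) + c = 0 leaves K(r) = 0. *)
pose K : {poly F} := 'X * p^`() + p`_0 *: 'X - p.
have K0 : K`_0 = - p`_0 by rewrite !coefB !coefD coefXM coefZ coefX /= mulr0 addr0 sub0r.
have sK : (size K <= d.+1)%N.
  apply: (sD); last by rewrite size_polyN.
  apply: (sD) => //; apply: leq_trans (size_polyMleq _ _) _.
  rewrite size_polyX /=; apply: leq_trans (size_poly _ _) _.
  by move: sp; case: (size p).
have Kn : K != 0 by apply: q_neq0; rewrite K0 oppr_eq0.
pose c (x : 'I_l) : F := (x : nat)%:R - n%:R.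
pose q x : {poly F} := p + (c x - p`_0) *: 'X.
have q0 x : q x != 0 by apply: q_neq0; rewrite coefD coefZ coefX mulr0 addr0.
have sq x : (size (q x) <= d.+1)%N by apply: sD.
pose g x r := [&& r != 0, root (q x) r & ~~ root K r].
have good x r : g x r -> x \notin B.
  case/and3P=> rn0 /eqP qr Kr; rewrite inE negb_forall.
  have lt_r : (r < l)%N by rewrite -[X in (_ < X)%N](Fp_cast pr_l).
  apply/existsP; exists (Ordinal lt_r); rewrite negbK /fixes_residue /= !zF.
  have rE : (r : nat)%:R = r :> F by rewrite natr_Zp.
  set cz : int := (x : nat)%:Z - n%:Z.
  have cE : cz%:~R = c x by rewrite rmorphB.
  clearbody cz.
  have pE (Q : {poly int}) : (Q.[r%:Z])%:~R = (map_poly intr Q).[r] :> F.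
    by rewrite -{2}rE -[(r : nat)%:R]/((r%:Z)%:~R) horner_map.
  have qE : p.[r] + (c x - p`_0) * r = 0 by rewrite -[RHS]qr !hornerE.
  rewrite !(rmorphB, rmorphD, rmorphM) /= cE !pE -deriv_map -/p -p0.
  rewrite -[(r%:Z)%:~R]/((r : nat)%:R) rE; apply/andP; split.
    by rewrite -[X in _ == X]qE; apply/eqP; ring.
  apply: contra Kr => /eqP dE; rewrite /root /K !hornerE.
  have -> : p^`().[r] = - c x by apply/eqP; rewrite -addr_eq0 dE.
  by rewrite -oppr_eq0 -[X in _ == X]qE; apply/eqP; ring.
have upper : (\sum_x \sum_r g x r <= d * (l - #|B|))%N.
  apply: leq_trans (_ : \sum_(x | x \notin B) d <= _)%N; last first.
    have e : (#|B| + #|[predC B]| = l)%N by rewrite cardC card_ord.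
    rewrite sum_nat_const mulnC leq_mul2l -[X in (X - _)%N]e addKn.
    by apply/orP; right; apply: eq_leq; apply: eq_card.
  rewrite [leqRHS]big_mkcond; apply: leq_sum => x _; case: ifP => xB.
    apply: leq_trans (_ : #|[pred r | root (q x) r]| <= _)%N.
      rewrite card_sum_nat; apply: leq_sum => r _; rewrite /g /=.
      by case: (root (q x) r); rewrite ?andbF // leq_b1.
    by rewrite -ltnS; apply: leq_trans (card_roots (q0 x)) (sq x).
  rewrite big1 // => r _; case: (boolP (g x r)) => // /good.
  by rewrite xB.
have pt r : (1 <= \sum_x g x r + (r == 0%R) + root K r)%N.
  have [->|rn0] := eqVneq r 0; first by rewrite addn1.
  case: (boolP (root K r)) => [_|nK]; first by rewrite addn1.
  rewrite addn0 addn0 lt0n; apply/negP; rewrite sum_nat_eq0 => /forallP h.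
  (* The value of c for which [r] is fixed, with [n] added to undo the shift in [c x]. *)
  pose y : F := p`_0 - p.[r] / r + n%:R.
  have lt_y : (y < l)%N by rewrite -[X in (_ < X)%N](Fp_cast pr_l).
  have := h (Ordinal lt_y); rewrite /g rn0 nK andbT /=.
  suff -> : root (q (Ordinal lt_y)) r by [].
  have yE : (y : nat)%:R = y by rewrite natr_Zp.
  rewrite /root /q !hornerE /c /= yE; apply/eqP; rewrite /y; field.
  exact: rn0.
have lower : (l <= \sum_x \sum_r g x r + 1 + d)%N.
  have := @leq_sum _ (index_enum F) predT _ _ (fun r _ => pt r).
  rewrite sum1_card cardF !big_split /= exchange_big /= => /leq_trans; apply.
  apply: leq_add; last by rewrite -card_sum_nat -ltnS; apply: leq_trans (card_roots Kn) sK.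
  by rewrite leq_add2l -(card_sum_nat (pred1 (0 : F))) card1.
have cB : (#|B| <= l)%N by rewrite -[leqRHS]card_ord max_card.
(* At least l - d - 1 >= l/2 residues are noncritically fixed by some c, each c serving at most d of
   them; so at least l/(2d) values of c lie outside [B]. *)
move: upper lower; rewrite mulnBr; nia.
Qed.

Definition periodic (m : nat) (b : pred nat) : Prop := forall x, b (x + m)%N = b x.

Lemma periodic_mod m b x : periodic m b -> b (x %% m)%N = b x.
Proof.
move=> pb; rewrite [in RHS](divn_eq x m) addnC.
by elim: (x %/ m)%N => [|k IHk]; rewrite ?mul0n ?addn0 // mulSn addnA addnAC pb.
Qed.

Lemma periodic_all (ls : seq nat) (b : nat -> pred nat) :
  (forall l, l \in ls -> periodic l (b l)) ->
  periodic (\prod_(l <- ls) l) (fun x => all (fun l => b l x) ls).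
Proof.
move=> pb x; apply: eq_in_all => y yls; rewrite (big_rem y) //= mulnC.
by elim: (\prod_(_ <- _) _)%N => [|k IHk]; rewrite ?mul0n ?addn0 // mulSn addnA addnAC pb.
Qed.

(** By the Chinese remainder theorem the pair of residues determines [x], and each periodic
    condition depends on one residue only. *)
Lemma card_sieve_mul (m1 m2 : nat) (b1 b2 : pred nat) :
  (0 < m1)%N -> (0 < m2)%N -> coprime m1 m2 -> periodic m1 b1 -> periodic m2 b2 ->
  (#|[pred x : 'I_(m1 * m2) | b1 x && b2 x]| <=
   #|[pred x : 'I_m1 | b1 x]| * #|[pred x : 'I_m2 | b2 x]|)%N.
Proof.
move=> m1_gt0 m2_gt0 cop pb1 pb2.
pose f (x : 'I_(m1 * m2)) := (Ordinal (ltn_pmod x m1_gt0), Ordinal (ltn_pmod x m2_gt0)).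
have inj_f : injective f.
  move=> x y [e1 e2]; apply: val_inj => /=.
  have : (x == y %[mod m1 * m2])%N by rewrite chinese_remainder // e1 e2 !eqxx.
  by rewrite !modn_small // => /eqP.
rewrite -cardX -(card_imset _ inj_f); apply: subset_leq_card.
apply/fintype.subsetP => _ /imsetP[x + ->]; rewrite !inE /= => /andP[h1 h2].
by rewrite !periodic_mod ?h1.
Qed.

Lemma card_sieve (ls : seq nat) (b : nat -> pred nat) (K0 K1 : nat) :
  all prime ls -> uniq ls -> (forall l, l \in ls -> periodic l (b l)) ->
  (forall l, l \in ls -> (K1 * #|[pred x : 'I_l | b l x]| <= K0 * l)%N) ->
  (K1 ^ size ls * #|[pred x : 'I_(\prod_(l <- ls) l) | all (fun l => b l x) ls]| <=
   K0 ^ size ls * \prod_(l <- ls) l)%N.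
Proof.
elim: ls => [_ _ _ _|l ls IHls] /=.
  by rewrite !big_nil !expn0 !mul1n; apply: leq_trans (max_card _) _; rewrite card_ord.
case/andP=> pr_l pr_ls /andP[nl uls] pb hb; rewrite big_cons.
have pr l' : l' \in ls -> prime l' by move/(allP pr_ls).
have P0 : (0 < \prod_(l <- ls) l)%N.
  by rewrite big_seq; elim/big_ind: _ => // [x y x0 y0|l' /pr/prime_gt0 //]; rewrite muln_gt0 x0.
have cop : coprime l (\prod_(l <- ls) l).
  rewrite big_seq; elim/big_ind: _ => [|x y cx cy|l' l'ls].
  - exact: coprimen1.
  - by rewrite coprimeMr cx.
  - rewrite prime_coprime // dvdn_prime2 ?(pr _ l'ls) //.
    by apply: contra nl => /eqP->.
have pbs : periodic (\prod_(l <- ls) l) (fun x => all (fun l => b l x) ls).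
  by apply: periodic_all => y yls; apply: pb; rewrite inE yls orbT.
have := card_sieve_mul (prime_gt0 pr_l) P0 cop (pb l (mem_head l ls)) pbs.
set A := #|_|; set B := #|_|; set C := #|_| => hABC.
have hB : (K1 * B <= K0 * l)%N by apply/hb/mem_head.
have hC : (K1 ^ size ls * C <= K0 ^ size ls * \prod_(l <- ls) l)%N.
  by apply: IHls => // y yls; [apply: pb | apply: hb]; rewrite inE yls orbT.
rewrite !expnS; apply: leq_trans (_ : K1 * K1 ^ size ls * (B * C) <= _)%N.
  by rewrite leq_mul2l hABC orbT.
by rewrite mulnACA [leqRHS]mulnACA leq_mul.
Qed.

(** An interval of length w >= m is covered by at most 2w/m periods. *)
Lemma card_periodic (w m : nat) (b : pred nat) : (0 < m <= w)%N -> periodic m b ->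
  (m * #|[pred x : 'I_w | b x]| <= 2 * w * #|[pred x : 'I_m | b x]|)%N.
Proof.
case/andP=> m0 mw pb.
have lt_q (x : 'I_w) : (x %/ m < (w %/ m).+1)%N by rewrite ltnS leq_div2r // ltnW.
pose f (x : 'I_w) := (Ordinal (lt_q x), Ordinal (ltn_pmod x m0)).
have inj_f : injective f.
  move=> x y [e1 e2]; apply: val_inj => /=.
  by rewrite (divn_eq x m) (divn_eq y m) e1 e2.
have : (#|[pred x : 'I_w | b x]| <= (w %/ m).+1 * #|[pred x : 'I_m | b x]|)%N.
  rewrite -[X in (X * _)%N]card_ord -cardX -(card_imset _ inj_f); apply: subset_leq_card.
  apply/fintype.subsetP => _ /imsetP[x + ->]; rewrite !inE /= => h1.
  by rewrite periodic_mod.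
move=> h; apply: leq_trans (_ : m * ((w %/ m).+1 * #|[pred x : 'I_m | b x]|) <= _)%N.
  by rewrite leq_mul2l h orbT.
rewrite mulnA leq_mul2r; apply/orP; right.
by rewrite mulnS mulnC mul2n -addnn leq_add // leq_trunc_div.
Qed.

Lemma no_fixed_residue_periodic l (P : {poly int}) (n : nat) :
  periodic l (fun x => no_fixed_residue l P (x%:Z - n%:Z)).
Proof.
move=> x; apply: eq_forallb => r; congr (~~ _); rewrite /fixes_residue.
have e (u v : int) : (l%:Z %| u - v)%Z -> (l%:Z %| u)%Z = (l%:Z %| v)%Z.
  move=> h; apply/idP/idP => h'; last by rewrite -(subrK v u) rpredD.
  by have := rpredB h' h; rewrite opprB addrC subrK.
congr (_ && ~~ _); apply: e; rewrite PoszD.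
  have -> (A B C D E : int) : A + (B + l%:Z - C) * D - E - (A + (B - C) * D - E) = l%:Z * D by ring.
  by rewrite dvdz_mulr.
have -> (A B C : int) : A + (B + l%:Z - C) - (A + (B - C)) = l%:Z by ring.
by [].
Qed.

Lemma card_sieve_no_fixed_residue (ls : seq nat) (d n : nat) (P : {poly int}) :
  (0 < d)%N -> all prime ls -> uniq ls -> (size P <= d.+1)%N ->
  (forall l, l \in ls -> (2 * d + 2 <= l)%N /\ ~~ (l%:Z %| P`_0)%Z) ->
  (\prod_(l <- ls) l <= (2 * n).+1)%N ->
  ((2 * d) ^ size ls * #|[pred i : 'I_(2 * n).+1 |
      all (fun l => no_fixed_residue l P (dec i)) ls]| <=
   2 * (2 * n).+1 * (2 * d).-1 ^ size ls)%N.
Proof.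
move=> d0 pr_ls uls sP hls lsn.
pose b l x := no_fixed_residue l P ((x : nat)%:Z - n%:Z).
have pb l : periodic l (b l) by apply: no_fixed_residue_periodic.
have P0 : (0 < \prod_(l <- ls) l)%N.
  rewrite big_seq; elim/big_ind: _ => // [x y x0 y0|l /(allP pr_ls)/prime_gt0 //].
  by rewrite muln_gt0 x0.
have h1 := @card_sieve ls b (2 * d).-1 (2 * d) pr_ls uls (fun l _ => pb l)
  (fun l lls => card_no_fixed_residue n d0 (allP pr_ls l lls) (hls l lls).1 sP (hls l lls).2).
have h2 := card_periodic (_ : 0 < \prod_(l <- ls) l <= (2 * n).+1)%N
  (periodic_all (fun l _ => pb l)).
rewrite P0 lsn in h2; move: (h2 isT) h1 => {h2}.
set A := #|_|; set B := #|_| => h2 h1.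
rewrite -(leq_pmul2l P0).
apply: leq_trans (_ : (2 * d) ^ size ls * (2 * (2 * n).+1 * B) <= _)%N.
  by rewrite mulnCA leq_mul2l h2 orbT.
rewrite mulnCA; apply: leq_trans (_ : 2 * (2 * n).+1 * ((2 * d).-1 ^ size ls * \prod_(l <- ls) l) <= _)%N.
  by rewrite leq_mul2l h1 orbT.
by rewrite [leqRHS]mulnC -!mulnA.
Qed.

(** Counting in the box one block of coordinates at a time: [phi] reassembles the coordinates, [a]
    is frozen and [b] varies. *)
Lemma card_fiber (A B T : finType) (phi : A * B -> T) (Q : pred T) (e K : nat) :
  (forall t, exists x, phi x = t) ->
  (forall a, (e * #|[pred b | Q (phi (a, b))]| <= K)%N) -> (e * #|Q| <= #|A| * K)%N.
Proof.
move=> surj hK; apply: leq_trans (_ : e * #|[pred x | Q (phi x)]| <= _)%N.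
  rewrite leq_mul2l; apply/orP; right.
  apply: leq_trans (leq_image_card phi [pred x | Q (phi x)]).
  apply: subset_leq_card; apply/fintype.subsetP => t Qt; have [x xt] := surj t.
  by apply/fintype.imageP; exists x; rewrite ?inE ?xt.
rewrite card_sum_nat (eq_bigr (fun x => (Q (phi (x.1, x.2)) : nat))); last by case.
rewrite -(pair_bigA _ (fun a b => (Q (phi (a, b)) : nat))) /= big_distrr /=.
rewrite -sum_nat_const; apply: leq_sum => a _.
by apply: leq_trans (hK a); rewrite card_sum_nat.
Qed.

(** * The box of coefficient vectors *)

Section Box.
Variables (n k : nat).
Local Notation w := (2 * n).+1.
Local Notation d := k.+3.
(* [(s, ((a_0, a_1), a_d))], with [s] listing [a_2, ..., a_(d-2)] and every
   entry shifted by [n]: the counting varies [a_0], [a_1] and [a_d] separately. *)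
Definition box : finType := (k.-tuple 'I_w * ('I_w * 'I_w * 'I_w))%type.

Definition code (t : box) : d.-tuple int :=
  [tuple of dec t.2.1.1 :: dec t.2.1.2 :: rcons [seq dec i | i <- t.1] (dec t.2.2)].

Implicit Type t : box.

Lemma code0 t : (code t)`_0 = dec t.2.1.1. Proof. by []. Qed.

Lemma code1 t : (code t)`_1 = dec t.2.1.2. Proof. by []. Qed.

Lemma code_last t : (code t)`_k.+2 = dec t.2.2.
Proof. by rewrite /= nth_rcons size_map size_tuple ltnn eqxx. Qed.

Lemma code_mid t i : (i < k)%N -> (code t)`_i.+2 = [seq dec j | j <- t.1]`_i.
Proof. by move=> ik; rewrite /= nth_rcons size_map size_tuple ik. Qed.

Lemma code_inj : injective code.
Proof.
move=> [s [[x0 x1] xd]] [s' [[x0' x1'] xd']] e.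
have := congr1 (@tval _ _) e => -[/dec_injective e0 /dec_injective e1 /rcons_inj[es /dec_injective ed]].
rewrite e0 e1 ed; congr (_, _); apply: val_inj => /=.
exact: (inj_map (@dec_injective n)) es.
Qed.

Lemma code_surj (a : d.-tuple int) : (coefH a <= n)%N -> exists t, code t = a.
Proof.
move=> an; have hdec j : (`|(a`_j)%R|%N <= n)%N.
  apply: leq_trans an; have [lt_j|le_j] := ltnP j d; last by rewrite nth_default ?size_tuple.
  by rewrite /coefH (big_nth 0) size_tuple big_mkord (leq_bigmax (Ordinal lt_j)).
have [f fP] := choice (fun j => dec_surj (hdec j)).
have [u uE] : exists u : k.-tuple 'I_w, forall i, (i < k)%N -> nth ord0 u i = f i.+2.
  exists [tuple f (i : nat).+2 | i < k] => i ik.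
  exact: (nth_mktuple (fun j : 'I_k => f (j : nat).+2) ord0 (Ordinal ik)).
exists (u, ((f 0%N, f 1%N), f k.+2)).
apply: (@eq_from_tnth _ _) => i; rewrite !(tnth_nth 0).
case: i => -[|[|i]] /= lt_i; rewrite ?fP //.
rewrite nth_rcons size_map size_tuple; case: ssrnat.ltngtP => ik.
- by rewrite (nth_map ord0) ?size_tuple // uE ?fP.
- by move: lt_i; rewrite !ltnS leqNgt ik.
- by rewrite ik.
Qed.

Lemma coefH_code t : (coefH (code t) <= n)%N.
Proof.
apply/bigmax_leqP_seq => x xt _; move: xt.
rewrite !inE mem_rcons inE => /or4P[/eqP->|/eqP->|/eqP->|/mapP[i _ ->]]; exact: abs_dec.
Qed.

(** The numerator with a_1 = 0, since [inord n] decodes to 0; the sieve then restores a_1 as the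
    free parameter c. *)
Definition base_poly (s : k.-tuple 'I_w) (x0 xd : 'I_w) : {poly int} :=
  numer (code (s, ((x0, inord n), xd))).

Lemma dec_inord : dec (inord n : 'I_w) = 0.
Proof. by rewrite /dec inordK ?subrr // ltnS leq_pmull. Qed.

Lemma numer_code s x0 x1 xd :
  numer (code (s, ((x0, x1), xd))) = base_poly s x0 xd + dec x1 *: 'X.
Proof.
apply/polyP => i; rewrite coefD coefZ coefX /base_poly !coef_numer // !code_last /=.
case: i => [|[|i]] /=; rewrite ?mulr0 ?addr0 //.
by rewrite dec_inord add0r mulr1.
Qed.

Lemma base_poly0 s x0 xd : (base_poly s x0 xd)`_0 = dec x0.
Proof. by rewrite /base_poly coef_numer. Qed.

Lemma size_base_poly s x0 xd : (size (base_poly s x0 xd) <= d.+1)%N.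
Proof.
apply/leq_sizeP => j dj; rewrite /base_poly coef_numer // gtn_eqF //.
by rewrite (_ : (j < d.-1)%N = false) //; lia.
Qed.

Lemma good_prime_code s x0 x1 xd l r : prime l ->
  ~~ (l%:Z %| dec x0)%Z -> ~~ (l%:Z %| dec xd)%Z ->
  fixes_residue l (base_poly s x0 xd) (dec x1) r ->
  good_prime (code (s, ((x0, x1), xd))) l r%:Z.
Proof.
move=> pr_l l0 ld /andP[h1 h2]; split=> //; first by rewrite code_last.
  by move: h1; rewrite base_poly0 numer_code hornerD hornerZ hornerX.
by rewrite numer_code derivD derivZ derivX hornerD hornerZ hornerC mulr1.
Qed.

End Box.

Lemma dvdn_gcd_mul (m n a : nat) : (gcdn (m * n) a %| gcdn m a * gcdn n a)%N.
Proof.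
rewrite muln_gcdr dvdn_gcd; apply/andP; split; last by rewrite dvdn_mull ?dvdn_gcdr.
by rewrite [X in (_ %| X)%N]mulnC muln_gcdr dvdn_gcd mulnC dvdn_gcdl dvdn_mull ?dvdn_gcdr.
Qed.

(** * Exceptional sets of coefficient vectors and their sizes *)

Section BadSets.
Variables (n k b : nat).
Local Notation w := (2 * n).+1.
Local Notation d := k.+3.
Local Notation I := 'I_w.
Local Notation box := (box n k).
Implicit Type t : box.
Hypothesis b_gt0 : (0 < b)%N.

Definition bad_small t : bool :=
  (b * `|dec t.2.2| < n)%N || (b * `|dec t.2.1.1| < n)%N.

Definition bad_tau t : bool :=
  (dec t.2.1.1 != 0) && (b < size (divisors `|dec t.2.1.1|))%N.

(** Later exceptional sets include this condition, because averages of gcds with a_0 are controlled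
    by the number of divisors of a_0. *)
Definition few_divisors (x0 : I) : bool :=
  (dec x0 != 0) && (size (divisors `|dec x0|) <= b)%N.

Definition bad_gcd t : bool :=
  few_divisors t.2.1.1 && (b ^ 2 < gcdn `|dec t.2.2| `|dec t.2.1.1|)%N.

Definition bad_square t : bool :=
  (dec t.2.2 != 0) && [exists m : 'I_n.+1, (b < m)%N && (m ^ 2 %| `|dec t.2.2|)%N].

(** The threshold allows Y^2 for the number of points p/q, a factor b for the average of each of two
    gcds with a_0, and one more b for Markov's inequality. *)
Definition bad_psi (Y : nat) t : bool :=
  few_divisors t.2.1.1 &&
  [exists p : 'I_(2 * Y).+1, exists q : 'I_Y.+1,
    [&& (0 < q)%N, dec p != 0, coprime `|dec p| q &
      (Y ^ 2 * b ^ 3 < gcdn `|homog (code t) (dec p) q%:Z| `|dec t.2.1.1|)%N]].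

Definition bad_div (l : nat) t : bool :=
  (l %| `|dec t.2.1.1|)%N || (l %| `|dec t.2.2|)%N.

(** Vectors with a_0 divisible by some prime of the list are counted by [bad_div], so they are left
    out here; P(0) is then a unit at each prime, as the residue count requires. *)
Definition bad_sieve (ls : seq nat) t : bool :=
  all (fun l => ~~ (l%:Z %| dec t.2.1.1)%Z &&
    no_fixed_residue l (base_poly t.1 t.2.1.1 t.2.2) (dec t.2.1.2)) ls.

Lemma card_box_last (Q : pred box) (e K : nat) :
  (forall s x0 x1, (e * #|[pred xd : I | Q (s, ((x0, x1), xd))]| <= K)%N) ->
  (e * #|Q| <= w ^ k.+2 * K)%N.
Proof.
move=> hK; have -> : (w ^ k.+2 = #|{: k.-tuple I * I * I}|)%N.
  by rewrite !card_prod card_tuple !card_ord -!expnSr.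
apply: (@card_fiber _ _ _ (fun y => (y.1.1.1, ((y.1.1.2, y.1.2), y.2)))) => [[s [[x0 x1] xd]]|].
  by exists (s, x0, x1, xd).
by case=> -[s x0] x1; apply: hK.
Qed.

Lemma card_box_first (Q : pred box) (e K : nat) :
  (forall s x1 xd, (e * #|[pred x0 : I | Q (s, ((x0, x1), xd))]| <= K)%N) ->
  (e * #|Q| <= w ^ k.+2 * K)%N.
Proof.
move=> hK; have -> : (w ^ k.+2 = #|{: k.-tuple I * I * I}|)%N.
  by rewrite !card_prod card_tuple !card_ord -!expnSr.
apply: (@card_fiber _ _ _ (fun y => (y.1.1.1, ((y.2, y.1.1.2), y.1.2)))) => [[s [[x0 x1] xd]]|].
  by exists (s, x1, xd, x0).
by case=> -[s x0] x1; apply: hK.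
Qed.

Lemma card_box_second (Q : pred box) (e K : nat) :
  (forall s x0 xd, (e * #|[pred x1 : I | Q (s, ((x0, x1), xd))]| <= K)%N) ->
  (e * #|Q| <= w ^ k.+2 * K)%N.
Proof.
move=> hK; have -> : (w ^ k.+2 = #|{: k.-tuple I * I * I}|)%N.
  by rewrite !card_prod card_tuple !card_ord -!expnSr.
apply: (@card_fiber _ _ _ (fun y => (y.1.1.1, ((y.1.1.2, y.2), y.1.2)))) => [[s [[x0 x1] xd]]|].
  by exists (s, x0, xd, x1).
by case=> -[s x0] x1; apply: hK.
Qed.

Lemma card_box_pair (Q : pred box) (e K : nat) :
  (forall s x0, (e * #|[pred y : I * I | Q (s, ((x0, y.1), y.2))]| <= K)%N) ->
  (e * #|Q| <= w ^ k.+1 * K)%N.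
Proof.
move=> hK; have -> : (w ^ k.+1 = #|{: k.-tuple I * I}|)%N.
  by rewrite !card_prod card_tuple !card_ord -!expnSr.
apply: (@card_fiber _ _ _ (fun y : k.-tuple I * I * (I * I) =>
  (y.1.1, ((y.1.2, y.2.1), y.2.2)))) => [[s [[x0 x1] xd]]|].
  by exists (s, x0, (x1, xd)).
by case=> s x0; apply: hK.
Qed.

Lemma card_small_dec : (b <= w)%N ->
  (b * #|[pred x : I | (b * `|dec x| < n)%N]| <= 2 * w)%N.
Proof.
move=> bw; pose m := (n %/ b)%N.
have small (x : I) : (b * `|dec x| < n)%N -> (`|dec x| <= m)%N.
  by move=> h; rewrite leq_divRL // mulnC ltnW.
have : (#|[pred x : I | (b * `|dec x| < n)%N]| <= (2 * m).+1)%N.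
  rewrite -[leqRHS]card_ord.
  pose f (x : I) : 'I_(2 * m).+1 := inord `|(dec x + m%:Z)%R|.
  rewrite -(card_in_image (f := f)); first exact: max_card.
  move=> x y; rewrite !inE => /small hx /small hy /(congr1 val).
  rewrite /f /= !inordK; try by rewrite ltnS; lia.
  by move=> e; apply: dec_injective; lia.
move=> h; apply: leq_trans (_ : b * (2 * m).+1 <= _)%N; first by rewrite leq_mul2l h orbT.
have := leq_trunc_div n b; rewrite -/m; lia.
Qed.

Lemma card_bad_small : (b <= w)%N -> (b * #|bad_small| <= w ^ k.+2 * (4 * w))%N.
Proof.
move=> bw; apply: leq_trans (_ : b * (#|[pred t : box | (b * `|dec t.2.2| < n)%N]| +
    #|[pred t : box | (b * `|dec t.2.1.1| < n)%N]|) <= _)%N.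
  rewrite leq_mul2l; apply/orP; right.
  rewrite -cardUI; apply: leq_trans (leq_addr _ _).
  by apply: subset_leq_card; apply/fintype.subsetP => t; rewrite !inE.
rewrite mulnDr (_ : 4 * w = 2 * w + 2 * w)%N; last by lia.
rewrite mulnDr; apply: leq_add.
  by apply: card_box_last => s x0 x1; apply: card_small_dec.
by apply: card_box_first => s x1 xd; apply: card_small_dec.
Qed.

Lemma card_bad_gcd : (b * #|bad_gcd| <= w ^ k.+2 * (2 * w))%N.
Proof.
apply: card_box_last => s x0 x1; rewrite /bad_gcd /=.
have [/andP[x0n tau]|_] := boolP (few_divisors x0); last first.
  by rewrite (eq_card (B := pred0)) ?card0 ?muln0 // => x; rewrite !inE.
have h := @leq_sum_gcd I predT (fun xd => `|dec xd|%N) `|dec x0| (2 * w).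
rewrite -(leq_pmul2l b_gt0) mulnA mulnn.
apply: markov_card; apply: leq_trans (_ : size (divisors `|dec x0|) * (2 * w) <= _)%N.
  apply: h => [|t]; first by rewrite absz_gt0.
  rewrite -dvdn_divisors ?absz_gt0 // => tx; apply: count_dvd_dec.
  rewrite (dvdn_gt0 _ tx) ?absz_gt0 //; apply: leq_trans (dvdn_leq _ tx) _; rewrite ?absz_gt0 //.
  by have := abs_dec x0; lia.
by rewrite leq_mul2r tau orbT.
Qed.

Lemma card_bad_div (l : nat) : (0 < l <= w)%N ->
  (l * #|bad_div l| <= w ^ k.+2 * (4 * w))%N.
Proof.
move=> lw; apply: leq_trans (_ : l * (#|[pred t : box | (l %| `|dec t.2.1.1|)%N]| +
    #|[pred t : box | (l %| `|dec t.2.2|)%N]|) <= _)%N.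
  rewrite leq_mul2l; apply/orP; right.
  rewrite -cardUI; apply: leq_trans (leq_addr _ _).
  by apply: subset_leq_card; apply/fintype.subsetP => t; rewrite !inE.
rewrite mulnDr (_ : 4 * w = 2 * w + 2 * w)%N; last by lia.
rewrite mulnDr; apply: leq_add.
  by apply: card_box_first => s x1 xd; apply: count_dvd_dec.
by apply: card_box_last => s x0 x1; apply: count_dvd_dec.
Qed.

Lemma card_bad_sieve (ls : seq nat) :
  all prime ls -> uniq ls -> (forall l, l \in ls -> 2 * d + 2 <= l)%N ->
  (\prod_(l <- ls) l <= w)%N ->
  ((2 * d) ^ size ls * #|bad_sieve ls| <= w ^ k.+2 * (2 * w * (2 * d).-1 ^ size ls))%N.
Proof.
move=> pr uls hl hw; apply: card_box_second => s x0 xd; rewrite /bad_sieve /=.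
have [h|h] := boolP (all (fun l : nat => ~~ (l%:Z %| dec x0)%Z) ls); last first.
  rewrite (eq_card (B := pred0)) ?card0 ?muln0 // => x; rewrite !inE.
  by apply: contraNF h => /allP h; apply/allP => l /h /andP[].
rewrite (eq_card (B := [pred x1 : I | all (fun l =>
    no_fixed_residue l (base_poly s x0 xd) (dec x1)) ls])); last first.
  by move=> x; rewrite !inE; apply: eq_in_all => l lls; rewrite (allP h).
apply: card_sieve_no_fixed_residue => //; first exact: size_base_poly.
by move=> l lls; rewrite hl // base_poly0 (allP h).
Qed.

(** The mean number of divisors, computed by exchanging the sums over a_0 and over the divisor, is a
    harmonic sum. *)
Lemma card_bad_tau :
  (b * #|bad_tau| <= w ^ k.+2 * \sum_(1 <= t < n.+1) (2 * w) %/ t)%N.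
Proof.
apply: card_box_first => s x1 xd.
apply: (@markov_card I (fun x0 => dec x0 != 0) (fun x0 => size (divisors `|dec x0|))).
apply: leq_trans (_ : \sum_(x0 : I | dec x0 != 0) \sum_(1 <= t < n.+1) (t %| `|dec x0|) <= _)%N.
  apply: leq_sum => x0 x0n.
  have x0_gt0 : (0 < `|dec x0|)%N by rewrite absz_gt0.
  have -> : (\sum_(1 <= t < n.+1) (t %| `|dec x0|) =
      size [seq t <- index_iota 1 n.+1 | t %| `|dec x0|])%N.
    rewrite size_filter -sum1_count [RHS]big_mkcond; apply: eq_bigr => t _.
    by case: (t %| _)%N.
  apply: uniq_leq_size; first exact: divisors_uniq.
  move=> t; rewrite -dvdn_divisors // mem_filter mem_index_iota => tx.
  rewrite tx (dvdn_gt0 x0_gt0 tx) ltnS; apply: leq_trans (dvdn_leq _ tx) _ => //.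
  exact: abs_dec.
rewrite exchange_big /= !big_nat; apply: leq_sum => t /andP[t0 _].
rewrite leq_divRL // mulnC; apply: leq_trans (count_dvd_dec_neq0 n t0).
rewrite leq_mul2l card_sum_nat [X in (X <= _)%N]big_mkcond leq_sum ?orbT // => x _ /=.
by case: (dec x != 0).
Qed.

(** The tail is compared with a telescoping sum: 1/m^2 <= 1/(m-1) - 1/m. *)
Lemma sum_square_tail (C : nat -> nat) (K : nat) :
  (forall m, (0 < m)%N -> (m ^ 2 * C m <= K)%N) ->
  forall N, (b * \sum_(b.+1 <= m < N.+1) C m <= K)%N.
Proof.
move=> hC N.
have b0 : 0 < b%:R :> rat by rewrite ltr0n.
have [bN|Nb] := leqP b N; last by rewrite big_geq ?muln0 // ltnW.
suff h : (\sum_(b.+1 <= m < N.+1) C m)%N%:R <= K%:R * (b%:R^-1 - N%:R^-1) :> rat.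
  rewrite -(ler_nat rat) natrM mulrC -ler_pdivlMr //; apply: le_trans h _.
  by rewrite ler_wpM2l // lerBlDr lerDl invr_ge0.
elim: N bN => [|N IHN]; first by rewrite leqNgt b_gt0.
rewrite leq_eqVlt => /predU1P[<-|bN]; first by rewrite big_geq // subrr mulr0.
rewrite big_nat_recr //= natrD.
have N0 : 0 < N%:R :> rat by rewrite ltr0n (leq_trans b_gt0).
have step : (C N.+1)%:R <= K%:R * (N%:R^-1 - N.+1%:R^-1) :> rat.
  have h : (C N.+1)%:R * N.+1%:R ^+ 2 <= K%:R :> rat.
    by rewrite -natrX -natrM ler_nat mulnC hC.
  have N1 : 0 < N.+1%:R :> rat by rewrite ltr0n.
  rewrite -(ler_pM2r (_ : 0 < N.+1%:R ^+ 2)) ?exprn_gt0 //; apply: le_trans h _.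
  rewrite -mulrA ler_peMr // -[N.+1]addn1 natrD.
  have -> : (N%:R^-1 - (N%:R + 1)^-1) * (N%:R + 1) ^+ 2 = 1 + N%:R^-1 :> rat.
    by field; rewrite !gt_eqF // addr_gt0.
  by rewrite lerDl invr_ge0 ltW.
by have := lerD (IHN bN) step; rewrite -mulrDr addrA subrK.
Qed.

Lemma card_bad_square : (b * #|bad_square| <= w ^ k.+2 * (2 * w))%N.
Proof.
apply: card_box_last => s x0 x1; rewrite /bad_square /=.
pose C m := #|[pred xd : I | (dec xd != 0) && (m ^ 2 %| `|dec xd|)%N]|.
have hC m : (0 < m)%N -> (m ^ 2 * C m <= 2 * w)%N.
  by move=> m0; apply: count_dvd_dec_neq0; rewrite expn_gt0 m0.
apply: leq_trans (sum_square_tail hC n); rewrite leq_mul2l; apply/orP; right.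
rewrite card_sum_nat; under [leqRHS]eq_bigr => m _ do rewrite /C card_sum_nat.
rewrite exchange_big /=; apply: leq_sum => xd _.
case: (dec xd != 0) => //=; case: existsP => // -[m /andP[bm mx]].
have mi : (m : nat) \in index_iota b.+1 n.+1 by rewrite mem_index_iota bm ltn_ord.
by rewrite (bigD1_seq _ mi (iota_uniq _ _)) /= mx.
Qed.

(** The terms of a_2, ..., a_(d-2) divided by p; the index i = k is the absent coefficient of degree
    d - 1, hence the 0. *)
Definition homog_tail (s : k.-tuple I) (p q : int) : int :=
  \sum_(i < k.+1) (if (i < k)%N then [seq dec j | j <- s]`_i else 0) *
    p ^+ i.+1 * q ^+ (k.+1 - i).

(** Modulo a_0 the form is p times an affine form in (a_1, a_d), with coefficients q^(d-1) and
    p^(d-1) that are coprime when p and q are. *)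
Lemma homog_code s (x0 x1 xd : I) p q :
  homog (code (s, ((x0, x1), xd))) p q =
  p * (q ^+ k.+2 * dec x1 + p ^+ k.+2 * dec xd + homog_tail s p q) + dec x0 * q ^+ d.
Proof.
set c := code _; have ci i := @coef_numer d c i isT.
have c0 : (numer c)`_0 = dec x0 by rewrite ci.
have c1 : (numer c)`_1 = dec x1 by rewrite ci.
have cd : (numer c)`_d = dec xd by rewrite ci eqxx /c code_last.
have cm i : (i < k.+1)%N ->
    (numer c)`_i.+2 = if (i < k)%N then [seq dec j | j <- s]`_i else 0.
  move=> ik; rewrite ci (_ : (i.+2 == d) = false) ?ltn_eqF // (_ : (i.+2 < d.-1)%N = (i < k)%N) //.
  by case: ifP => // ik'; rewrite /c code_mid.
clearbody c; move: (dec x0) (dec x1) (dec xd) c0 c1 cd => y0 y1 yd c0 c1 cd.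
rewrite /homog big_ord_recl c0 big_ord_recl big_ord_recr.
rewrite /bump /= ?add1n c1 cd subnn subn0 !expr0 expr1 !mulr1.
under eq_bigr => i _ do rewrite ?add1n cm //.
rewrite subSS subn0 /homog_tail !mulrDr mulr_sumr.
have -> : \sum_(i < k.+1) (if (i < k)%N then [seq dec j | j <- s]`_i else 0) *
    p ^+ i.+2 * q ^+ (d - i.+2) =
  \sum_(i < k.+1) p * ((if (i < k)%N then [seq dec j | j <- s]`_i else 0) *
    p ^+ i.+1 * q ^+ (k.+1 - i)).
  by apply: eq_bigr => i _; rewrite !subSS exprS; ring.
rewrite -[bump 0 (bump 0 k.+1)]/d [p ^+ d]exprS; ring.
Qed.

(** By [homog_code] the gcd is at most gcd(p, a_0) times the gcd of a_0 with an affine form in (a_1,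
    a_d). The second factor averages to O(b) over (a_1, a_d), the first sums to O(bY) over p, and q
    takes Y values; Markov's inequality at Y^2 b^3 leaves O(1/b). *)
Lemma card_bad_psi (Y : nat) : (0 < Y)%N ->
  (b * #|bad_psi Y| <= w ^ k.+1 * (24 * w ^ 2))%N.
Proof.
move=> Y0; apply: card_box_pair => s x0; rewrite /bad_psi /=.
have [/andP[x0n tau]|_] := boolP (few_divisors x0); last first.
  by rewrite (eq_card (B := pred0)) ?card0 ?muln0 // => x; rewrite !inE.
have a0 : (0 < `|dec x0|)%N by rewrite absz_gt0.
have x0w : (`|dec x0| <= w)%N by have := abs_dec x0; lia.
pose S (p : 'I_(2 * Y).+1) (q : 'I_Y.+1) := [pred p | dec p != 0] p.
pose L (p q : int) (y : I * I) :=
  `|(q ^+ k.+2 * dec y.1 + p ^+ k.+2 * dec y.2 + homog_tail s p q)%R|%N.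
have hL (p : 'I_(2 * Y).+1) (q : 'I_Y.+1) : coprime `|dec p| q ->
    (\sum_y gcdn (L (dec p) (q : nat)%:Z y) `|dec x0| <= b * (4 * w ^ 2))%N.
  move=> cop; apply: leq_trans (_ : size (divisors `|dec x0|) * (4 * w ^ 2) <= _)%N.
    apply: (@leq_sum_gcd _ predT) => // t; rewrite -dvdn_divisors // => tx.
    apply: count_dvd_pair.
      by rewrite coprimezE !abszX coprimeXl // coprimeXr.
    by rewrite (dvdn_gt0 a0 tx) (leq_trans (dvdn_leq a0 tx)).
  by rewrite leq_mul2r tau orbT.
have hp : (\sum_(p : 'I_(2 * Y).+1 | dec p != 0) gcdn `|dec p| `|dec x0| <= b * (6 * Y))%N.
  apply: leq_trans (_ : size (divisors `|dec x0|) * (6 * Y) <= _)%N; last first.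
    by rewrite leq_mul2r tau orbT.
  apply: leq_sum_gcd => // t; rewrite -dvdn_divisors // => tx.
  apply: leq_trans (count_dvd_dec_neq0 Y (dvdn_gt0 a0 tx)) _; lia.
set G := (Y ^ 2 * b ^ 3)%N.
have G0 : (0 < Y ^ 2 * b ^ 2)%N by rewrite muln_gt0 !expn_gt0 Y0 b_gt0.
rewrite -(leq_pmul2l G0) mulnA.
have -> : (Y ^ 2 * b ^ 2 * b = G)%N by rewrite -mulnA -expnSr.
apply: leq_trans (_ : \sum_(q : 'I_Y.+1 | (0 < q)%N) \sum_(p : 'I_(2 * Y).+1 | dec p != 0)
   (gcdn `|dec p| `|dec x0| * (b * (4 * w ^ 2))) <= _)%N; last first.
  under eq_bigr => q _ do rewrite -big_distrl /=.
  rewrite sum_nat_const; have -> : #|[pred q : 'I_Y.+1 | (0 < q)%N]| = Y.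
    have := cardC1 (ord0 : 'I_Y.+1); rewrite card_ord /= => Ycard; rewrite -[RHS]Ycard.
    by apply: eq_card => q; rewrite !inE lt0n.
  apply: leq_trans (_ : Y * (b * (6 * Y) * (b * (4 * w ^ 2))) <= _)%N.
    by rewrite leq_mul2l leq_mul2r hp !orbT.
  by apply: eq_leq; ring.
apply: leq_trans (_ : \sum_(q : 'I_Y.+1 | (0 < q)%N) \sum_(p : 'I_(2 * Y).+1 | dec p != 0)
   (if coprime `|dec p| q then G * #|[pred y : I * I | (G < gcdn
      `|homog (code (s, ((x0, y.1), y.2))) (dec p) (q : nat)%:Z| `|dec x0|)%N]| else 0) <= _)%N.
  rewrite card_sum_nat big_distrr /=.
  under [leqRHS]eq_bigr => q _.
    under eq_bigr => p _.
      rewrite card_sum_nat big_distrr /= (_ : (if _ then _ else _) =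
        \sum_(y : I * I) (if coprime `|dec p| q then G * (G < gcdn
        `|homog (code (s, ((x0, y.1), y.2))) (dec p) (q : nat)%:Z| `|dec x0|)%N else 0))%N; last first.
        by case: ifP => // _; rewrite big1.
      over.
    rewrite exchange_big /=; over.
  rewrite exchange_big /=; apply: leq_sum => y _.
  case: existsP => [[p /existsP[q /and4P[q0 p0 cop hG]]]|_]; last by rewrite muln0.
  rewrite (bigD1 q) //= (bigD1 p) //= cop hG muln1.
  by rewrite -addnA leq_addr.
apply: leq_sum => q q0; apply: leq_sum => p p0; case: ifP => // cop.
apply: leq_trans (_ : \sum_(y : I * I) gcdn `|homog (code (s, ((x0, y.1), y.2))) (dec p)
    (q : nat)%:Z| `|dec x0| <= _)%N; first exact: (@markov_card _ predT).
apply: leq_trans (_ : \sum_y gcdn `|dec p| `|dec x0| * gcdn (L (dec p) (q : nat)%:Z y) `|dec x0| <= _)%N.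
  apply: leq_sum => y _; apply: dvdn_leq; first by rewrite muln_gt0 !gcdn_gt0 a0 !orbT.
  apply: dvdn_trans (dvdn_gcd_mul _ _ _).
  rewrite dvdn_gcd dvdn_gcdr andbT -abszM.
  set g := gcdn _ _.
  have g1 : (g%:Z %| homog (code (s, ((x0, y.1), y.2))) (dec p) (q : nat)%:Z)%Z.
    by rewrite dvdzE /= dvdn_gcdl.
  have g2 : (g%:Z %| dec x0)%Z by rewrite dvdzE /= dvdn_gcdr.
  by have := rpredB g1 (dvdz_mulr ((q : nat)%:Z ^+ d) g2); rewrite homog_code addrK dvdzE.
by rewrite -big_distrr leq_mul2l hL ?orbT.
Qed.

End BadSets.

(** * Bounds for the minima away from the exceptional sets *)

Section GoodBounds.
Variables (R : realType) (n k b Y N W : nat) (t : box n k).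
Local Notation d := k.+3.
Let a := code t.
Hypotheses (n_gt0 : (0 < n)%N) (b_gt0 : (0 < b)%N) (Y_gt0 : (0 < Y)%N).
Hypotheses (Y_le : (Y ^ (d + 3) <= n ^ 2)%N) (Y_gt : (n ^ 2 < Y.+1 ^ (d + 3))%N).
Hypotheses (x0 : dec t.2.1.1 != 0) (xd : dec t.2.2 != 0).
Hypotheses (n_small : ~~ bad_small b t) (n_tau : ~~ bad_tau b t).
Hypotheses (n_gcd : ~~ bad_gcd b t) (n_square : ~~ bad_square b t).
Hypotheses (n_psi1 : ~~ bad_psi b 1 t) (n_psiY : ~~ bad_psi b Y t).
Variables (l : 'I_N -> nat) (r : 'I_N -> int).
Hypotheses (inj_l : injective l) (good_l : forall j, good_prime a (l j) (r j)).
Hypothesis (le_W : (\prod_j l j <= W)%N).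
Hypothesis N_ge2 : (2 <= N)%N.

Local Notation hhat := (canonical_height R d (psi a)).
Local Notation lnn m := (ln (m%:R : R)).
Let L : R := lnn n.
(** A common error term. The factor 5 is 6/2 + 2: losses of at most 6 log b are divided by d - 1 >=
    2, and 2 log b come from the square part of a_d and from the ratio of the coefficients to
    a_d. *)
Let D : R := 5 * lnn b + lnn (2 * d) + lnn (d.+1) + lnn W.

Let d3 : (2 < d)%N. Proof. by []. Qed.
Let a0 : a`_0 != 0. Proof. by []. Qed.
Let ad : a`_(d.-1) != 0. Proof. by rewrite code_last. Qed.
Let A0 := `|(a`_0)%R|%N.
Let AD := `|(a`_(d.-1))%R|%N.
Let A0_gt0 : (0 < A0)%N. Proof. by rewrite absz_gt0. Qed.
Let AD_gt0 : (0 < AD)%N. Proof. by rewrite absz_gt0. Qed.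
Let ADE : AD = `|dec t.2.2|%N. Proof. by rewrite /AD code_last. Qed.

Let lnM (m p : nat) : (0 < m)%N -> (0 < p)%N -> lnn (m * p) = lnn m + lnn p.
Proof. by move=> m0 p0; rewrite natrM lnM // posrE ltr0n. Qed.
Let lnX (m p : nat) : (0 < m)%N -> lnn (m ^ p) = p%:R * lnn m.
Proof. by move=> m0; rewrite natrX lnXn ?ltr0n // mulr_natl. Qed.
Let ln_le (m p : nat) : (0 < m)%N -> (m <= p)%N -> lnn m <= lnn p.
Proof.
by move=> m0 mp; rewrite ler_ln ?posrE ?ltr0n ?ler_nat // (leq_trans m0).
Qed.

Let few : few_divisors b t.2.1.1.
Proof. by move: n_tau; rewrite /bad_tau /few_divisors x0 /= -leqNgt. Qed.

Let psi_gcd_le y z : (0 < y)%N -> ~~ bad_psi b y t -> z != 0 -> (ratH z <= y)%N ->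
  (psi_gcd a z <= y ^ 2 * b ^ 3)%N.
Proof.
move=> y0 + z0; rewrite geq_max => nb /andP[hn hd].
have [p pE] := dec_surj hn.
have lt_q : (`|denq z| < y.+1)%N by [].
rewrite leqNgt; apply: contra nb => h; rewrite /bad_psi few /=.
apply/existsP; exists p; apply/existsP; exists (Ordinal lt_q) => /=.
rewrite pE numq_eq0 z0 absz_gt0 denq_neq0 coprime_num_den /=.
by rewrite gez0_abs ?denq_ge0.
Qed.

Let square : exists s, [/\ (0 < s)%N, (s <= b)%N &
    forall p, prime p -> (logn p AD <= 2 * logn p s + 1)%N].
Proof.
have [s [s0 sA sP]] := max_square_divisor AD_gt0; exists s; split=> //.
rewrite leqNgt; apply: contra n_square => bs; rewrite /bad_square xd /=.
have sn : (s < n.+1)%N.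
  rewrite ltnS; apply: leq_trans (abs_dec t.2.2); rewrite -ADE.
  apply: leq_trans (dvdn_leq AD_gt0 sA); by rewrite -mulnn leq_pmulr.
by apply/existsP; exists (Ordinal sn); rewrite bs /= -ADE.
Qed.

Let n_le_AD : (n <= b * AD)%N.
Proof. by move: n_small; rewrite /bad_small negb_or -!leqNgt ADE => /andP[]. Qed.

Let n_le_A0 : (n <= b * A0)%N.
Proof. by move: n_small; rewrite /bad_small negb_or -!leqNgt => /andP[]. Qed.

Let gcd_le : (gcdn A0 AD <= b ^ 2)%N.
Proof.
move: n_gcd; rewrite /bad_gcd few /= -leqNgt gcdnC => h.
by rewrite ADE.
Qed.

Let d1 : 2 <= d%:R - 1 :> R.
Proof. by rewrite lerBrDr -(natrD R 2 1) ler_nat. Qed.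

Let lower_aux z (G : R) : lnn (psi_gcd a z) <= G ->
  (L - G - 3 * lnn b) / (d%:R - 1) + 2^-1 * weil_height R z - 2 * lnn b - lnn (2 * d)
  <= hhat z.
Proof.
move=> hG; have [s [s0 sb sP]] := square.
have cB : (coefH a <= b * AD)%N := leq_trans (coefH_code t) n_le_AD.
have low := canonical_height_lower R d3 a0 ad z cB s0 sP.
apply: le_trans low.
rewrite [lnn (2 * d * b)]lnM // -/A0 -/AD.
have h1 : L <= lnn b + lnn A0 by rewrite -lnM //; apply: ln_le.
have h2 : lnn (gcdn A0 AD) <= 2 * lnn b.
  by rewrite -lnX //; apply: ln_le; rewrite ?gcdn_gt0 ?A0_gt0.
have h3 : lnn s <= lnn b by apply: ln_le.
have h4 : (L - G - 3 * lnn b) / (d%:R - 1) <=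
   (lnn A0 - lnn (psi_gcd a z) - lnn (gcdn A0 AD)) / (d%:R - 1).
  by rewrite ler_wpM2r ?invr_ge0 ?(le_trans _ d1) //; lra.
lra.
Qed.

Let b_ge0 : 0 <= lnn b. Proof. exact: ln_nat_ge0. Qed.
Let L_ge0 : 0 <= L. Proof. exact: ln_nat_ge0. Qed.

Let div_d1 (x : R) : 0 <= x -> x / (d%:R - 1) <= x / 2.
Proof.
move=> x0'; rewrite ler_wpM2l // lef_pV2 ?posrE ?(lt_le_trans _ d1) //.
Qed.

(** The point 1 has height 0, so the exceptional set with Y = 1 already bounds its gcd, by b^3. *)
Let lower1 : L / (d%:R - 1) - D <= hhat 1.
Proof.
have g1 : lnn (psi_gcd a 1) <= 3 * lnn b.
  rewrite -lnX //; apply: ln_le; first exact: psi_gcd_gt0.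
  by have := psi_gcd_le (ltn0Sn 0) n_psi1 (oner_neq0 _) (leqnn _); rewrite exp1n mul1n.
have := lower_aux g1; have := div_d1 (mulr_ge0 (ler0n R 6) b_ge0).
have := weil_height_ge0 R 1; have := ln_nat_ge0 R d.+1; have := ln_nat_ge0 R W.
rewrite /D; have -> : (L - 3 * lnn b - 3 * lnn b) / (d%:R - 1) =
   L / (d%:R - 1) - 6 * lnn b / (d%:R - 1) by rewrite -mulrBl; congr (_ / _); ring.
move: (L / (d%:R - 1)) (6 * lnn b / (d%:R - 1)) (lnn b) (lnn W) (lnn d.+1) (lnn (2 * d)) (weil_height R 1) (hhat 1) => *; lra.
Qed.

(** Up to height log Y the gcd bound applies and log Y <= 2L/(d+3) gives (L - 2 log Y)/(d-1) >=
    L/(d+3). Beyond it the gcd is only bounded by |a_0|, and h(z)/2 >= L/(d+3) by the maximality of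
    [Y]. *)
Let lower_neq0 z : z != 0 -> L / (d%:R + 3) - D <= hhat z.
Proof.
move=> z0; have d30 : 0 < d%:R + 3 :> R by rewrite ltr_pwDr.
have d10 : 0 < d%:R - 1 :> R := lt_le_trans (ltr0Sn R 1) d1.
have [hz|hz] := leqP (ratH z) Y.
  have gY : lnn (psi_gcd a z) <= 2 * lnn Y + 3 * lnn b.
    rewrite -!lnX // -lnM ?expn_gt0 ?Y_gt0 ?b_gt0 //.
    apply: ln_le; first exact: psi_gcd_gt0.
    exact: psi_gcd_le.
  have lY : (d%:R + 3) * lnn Y <= 2 * L.
    by rewrite -(natrD R d 3) -!lnX //; apply: ln_le; rewrite ?expn_gt0 ?Y_gt0.
  have := lower_aux gY; have := div_d1 (mulr_ge0 (ler0n R 6) b_ge0).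
  have := weil_height_ge0 R z; have := ln_nat_ge0 R d.+1; have := ln_nat_ge0 R W.
  have -> : (L - (2 * lnn Y + 3 * lnn b) - 3 * lnn b) / (d%:R - 1) =
   (L - 2 * lnn Y) / (d%:R - 1) - 6 * lnn b / (d%:R - 1) by rewrite -mulrBl; congr (_ / _); ring.
  have : L / (d%:R + 3) <= (L - 2 * lnn Y) / (d%:R - 1).
    rewrite ler_pdivlMr // mulrAC ler_pdivrMr //.
    move: (d%:R) lY d30 d10 => e lY d30 d10; nra.
  rewrite /D.
  move: (L / (d%:R + 3)) ((L - 2 * lnn Y) / (d%:R - 1)) (6 * lnn b / (d%:R - 1)) (lnn b) (lnn W) (lnn d.+1) (lnn (2 * d)) (weil_height R z) (hhat z) => *; lra.
have hY : L / (d%:R + 3) <= 2^-1 * weil_height R z.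
  rewrite ler_pdivrMr // weil_heightE.
  have h1 : 2 * L <= (d%:R + 3) * lnn Y.+1.
    by rewrite -(natrD R d 3) -!lnX //; apply: ln_le; rewrite ?expn_gt0 ?n_gt0 // ltnW.
  have h2 : lnn Y.+1 <= lnn (ratH z) by apply: ln_le.
  move: (d%:R) d30 h1 => e d30 h1; nra.
have g_le : lnn (psi_gcd a z) <= lnn A0.
  by apply: ln_le; [exact: psi_gcd_gt0 | rewrite dvdn_leq ?dvdn_gcdr].
have L_A0 : L <= lnn b + lnn A0 by rewrite -lnM //; apply: ln_le.
have A0L : lnn A0 <= L.
  by apply: ln_le => //; apply: abs_dec.
have := lower_aux (le_trans g_le A0L); have := div_d1 (mulr_ge0 (ler0n R 3) b_ge0).
have := ln_nat_ge0 R d.+1; have := ln_nat_ge0 R W.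
rewrite subrr sub0r mulNr /D;
move: (L / (d%:R + 3)) (lnn b) (lnn W) (lnn d.+1) (lnn (2 * d)) (weil_height R z) (hhat z) hY b_ge0 => *; lra.
Qed.

Let upper z : hhat z <= L / (d%:R - 1) + lnn d.+1 + weil_height R z.
Proof.
have d10 : 0 < d%:R - 1 :> R := lt_le_trans (ltr0Sn R 1) d1.
apply: le_trans (canonical_height_le R d3 a0 ad z) _; rewrite lerD2r.
have cH : (0 < coefH a)%N.
  by apply: leq_trans (leq_coefH a d3 d); rewrite coef_numer // eqxx absz_gt0.
rewrite lnM //; have h1 : lnn (coefH a) <= L by apply: ln_le; rewrite ?coefH_code.
rewrite mulrDl addrC lerD ?ler_wpM2r ?invr_ge0 ?(ltW d10) //.
rewrite ler_pdivrMr // ler_peMr ?ln_nat_ge0 //; move: d1; lra.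
Qed.

Lemma good_bounds : 0 < L / (d%:R * (d%:R - 1)) - D ->
  exists l1 l2 lN, [/\ succ_min d (psi a) 1 l1, succ_min d (psi a) 2 l2,
    succ_min d (psi a) N lN,
    L / (d%:R * (d%:R - 1)) - D <= l1 <= L / (d%:R * (d%:R - 1)) + D &
    [/\ L / (d%:R + 3) - D <= l2, l2 <= lN & lN <= L / (d%:R - 1) + D]].
Proof.
move=> pos.
have d10 : 0 < d%:R - 1 :> R := lt_le_trans (ltr0Sn R 1) d1.
have d0 : 1 <= d%:R :> R by rewrite ler1n.
have d30 : 0 < d%:R + 3 :> R by rewrite ltr_pwDr.
have D0 : 0 <= D by rewrite /D !addr_ge0 ?mulr_ge0 ?ln_nat_ge0.
have psi0 : (psi a).[0] = 1.
  rewrite -[0 in LHS]/(0%:~R) horner_psi_int // horner_coef0 coef_numer //=.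
  by rewrite divff // intr_eq0.
have h01 : d%:R * hhat 0 = hhat 1.
  by rewrite -(canonical_height_psi R d3 a0 ad) psi0.
have [z [indz hz]] := independent_points d3 a0 ad inj_l good_l.
have l_W j : (l j <= W)%N.
  apply: leq_trans le_W; rewrite (bigD1 j) //= leq_pmulr // prodn_gt0 // => i.
  by have [/prime_gt0] := good_l i.
have E : L / (d%:R * (d%:R - 1)) = L / (d%:R - 1) / d%:R.
  by rewrite invfM [_^-1 * _]mulrC mulrA.
have h0 : hhat 0 = hhat 1 / d%:R by rewrite -h01 mulrC mulKf // gt_eqF // ltr0n.
apply: (@succ_min_bounds R d a d3 a0 ad N z) => //.
- rewrite lerD2r ler_wpM2l // lef_pV2 ?posrE ?mulr_gt0 ?ltr0n //.
  have d3R : 3 <= d%:R :> R by rewrite ler_nat.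
  (* This product is d(d-1) - (d+3): the level of the point 0 does not exceed the one of the nonzero
     points. *)
  have : 0 <= (d%:R - 3) * (d%:R + 1) :> R by rewrite mulr_ge0 ?subr_ge0 // addr_ge0 ?ler0n.
  by move: (d%:R : R) => e he; rewrite -subr_ge0; apply: le_trans he _; lra.
- rewrite h0 E ler_pdivlMr ?ltr0n // mulrBl mulfVK; last by rewrite pnatr_eq0.
  by apply: le_trans lower1; rewrite lerB // ler_peMr.
- rewrite h0 E ler_pdivrMr ?ltr0n // mulrDl mulfVK; last by rewrite pnatr_eq0.
  apply: le_trans (upper 1) _; rewrite -addrA lerD2l.
  rewrite weil_heightE ln1 addr0; apply: le_trans (_ : D <= _); last by rewrite ler_peMr.
  rewrite /D; have := ln_nat_ge0 R W; have := ln_nat_ge0 R (2 * d); move: b_ge0.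
  move: (lnn b) (lnn W) (lnn d.+1) (lnn (2 * d)) => *; lra.
- move=> i; apply: le_trans (upper _) _; rewrite -addrA lerD2l.
  have [m /andP[m0 mP] ->] := hz i; rewrite weil_heightE.
  have hW : lnn (ratH (m%:R / (l i)%:R)) <= lnn W.
    apply: ln_le; first exact: ratH_gt0.
    rewrite !pmulrn; apply: leq_trans (ratH_frac _ _) _.
      by have [/prime_gt0] := good_l i; rewrite lt0n.
    by rewrite geq_max /= l_W (leq_trans (ltnW mP)).
  rewrite /D; have := ln_nat_ge0 R (2 * d); move: b_ge0 hW.
  move: (lnn (ratH _)) (lnn b) (lnn W) (lnn d.+1) (lnn (2 * d)) => *; lra.
Qed.

End GoodBounds.

(** * Densities and asymptotics *)

Lemma card_fset_set_le (T : finType) (U : choiceType) (f : T -> U) (P : pred T)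
    (A : set U) : finite_set A -> (forall u, A u -> exists2 t, P t & u = f t) ->
  (#|` fset_set A| <= #|P|)%N.
Proof.
move=> finA AP; rewrite cardE -(size_map f); apply: uniq_leq_size; first exact: fset_uniq.
move=> u; rewrite in_fset_set // in_setE => /AP[t Pt ->].
by apply: map_f; rewrite mem_enum.
Qed.

Lemma card_fset_set_ge (T : finType) (U : choiceType) (f : T -> U) (P : pred T)
    (A : set U) : finite_set A -> {in P &, injective f} ->
  (forall t, P t -> A (f t)) -> (#|P| <= #|` fset_set A|)%N.
Proof.
move=> finA inj PA; rewrite cardE -(size_map f); apply: uniq_leq_size.
  rewrite map_inj_in_uniq ?enum_uniq // => x y; rewrite !mem_enum; exact: inj.
move=> _ /mapP[t + ->]; rewrite mem_enum => Pt.
by rewrite in_fset_set // in_setE; apply: PA.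
Qed.

(** A union bound over the common divisors m >= 2: m = 2 accounts for 1/4, and the tail from m = 3
    for at most 1/2. *)
Lemma card_not_coprime (n : nat) :
  (4 * #|[pred y : 'I_n * 'I_n | ~~ coprime y.1.+1 y.2.+1]| <= 3 * n ^ 2)%N.
Proof.
pose C m := #|[pred y : 'I_n * 'I_n | (m %| y.1.+1) && (m %| y.2.+1)]|%N.
have hC m : (0 < m)%N -> (m ^ 2 * C m <= n ^ 2)%N.
  move=> m0; pose c := #|[pred x : 'I_n | m %| x.+1]|%N.
  have -> : C m = (c * c)%N.
    by rewrite /C /c -cardX; apply eq_card => -[x y]; rewrite !inE.
  suff mc : (m * c <= n)%N by rewrite -mulnn mulnACA -mulnn leq_mul.
  rewrite mulnC -leq_divRL //.
  have lt_q (x : 'I_n) : (x.+1 %/ m < (n %/ m).+1)%N by rewrite ltnS leq_div2r.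
  have -> : (n %/ m = #|[pred j : 'I_(n %/ m).+1 | (0 < j)%N]|)%N.
    transitivity #|predC1 (ord0 : 'I_(n %/ m).+1)|; first by rewrite cardC1 card_ord.
    by apply eq_card => q; rewrite !inE lt0n.
  rewrite /c -(card_in_image (f := fun x => Ordinal (lt_q x))).
    apply: subset_leq_card; apply/fintype.subsetP => _ /fintype.imageP[x + ->].
    by rewrite !inE => mx /=; rewrite divn_gt0 // dvdn_leq.
  move=> x y; rewrite !inE => mx my [e]; apply: val_inj => /=.
  by apply: succn_inj; rewrite -(divnK mx) -(divnK my) e.
have h2 := @sum_square_tail 2 isT C (n ^ 2) hC n.
have h1 := hC 2 isT.
apply: leq_trans (_ : 4 * (C 2 + \sum_(3 <= m < n.+1) C m) <= _)%N; last first.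
  by move: (C 2) (\sum_(_ <= m < _) C m)%N (n ^ 2)%N h1 h2 => u v y; lia.
rewrite leq_mul2l /=; case: (leqP n 1) => n1.
  rewrite (eq_card0 (A := [pred y : 'I_n * 'I_n | _])) // => -[x y]; rewrite !inE /=.
  have -> : (x : nat) = 0%N by have := ltn_ord x; lia.
  by rewrite coprime1n.
rewrite -big_ltn // card_sum_nat.
under [leqRHS]eq_bigr => m _ do rewrite /C card_sum_nat.
rewrite exchange_big /=; apply: leq_sum => -[x y] _ /=.
case: (boolP (coprime _ _)) => //= ncop.
have g0 : (0 < gcdn x.+1 y.+1)%N by rewrite gcdn_gt0.
have gi : gcdn x.+1 y.+1 \in index_iota 2 n.+1.
  rewrite mem_index_iota ltn_neqAle eq_sym ncop g0 /= ltnS.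
  by apply: leq_trans (dvdn_leq _ (dvdn_gcdl _ _)) _.
by rewrite (bigD1_seq _ gi (iota_uniq _ _)) /= dvdn_gcdl dvdn_gcdr.
Qed.

(** * A lower bound for the number of polynomials *)

Section CountPolynomials.
Variables (n k : nat).
Local Notation w := (2 * n).+1.
Local Notation d := k.+3.

(** A subfamily with a_0, a_1, a_d positive. Once gcd(a_0, a_1) = 1 is imposed, its vectors are
    primitive and of positive proportion in the box. *)
Definition positive_box (y : k.-tuple 'I_w * ('I_n * 'I_n * 'I_n)) : box n k :=
  (y.1, ((inord (n + y.2.1.1.+1), inord (n + y.2.1.2.+1)), inord (n + y.2.2.+1))).

Lemma dec_positive (x : 'I_n) : dec (inord (n + x.+1) : 'I_w) = x.+1%:Z.
Proof. by rewrite /dec inordK; have := ltn_ord x; lia. Qed.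

Definition coprime_box (y : k.-tuple 'I_w * ('I_n * 'I_n * 'I_n)) : bool :=
  coprime y.2.1.1.+1 y.2.1.2.+1.

Lemma positive_box_inj : injective positive_box.
Proof.
move=> [s [[x y] z]] [s' [[x' y'] z']] [-> e1 e2 e3].
have dj (u v : 'I_n) : inord (n + u.+1) = inord (n + v.+1) :> 'I_w -> u = v.
  by move/(congr1 (@dec n)); rewrite !dec_positive => -[/ord_inj].
by rewrite (dj _ _ e1) (dj _ _ e2) (dj _ _ e3).
Qed.

Lemma card_coprime_box : (n ^ 3 * w ^ k <= 4 * #|coprime_box|)%N.
Proof.
have h := card_not_coprime n.
have -> : #|coprime_box| = (w ^ k * (#|[pred y : 'I_n * 'I_n | coprime y.1.+1 y.2.+1]| * n))%N.
  rewrite -[X in (w ^ k * (_ * X))%N]card_ord -cardX.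
  have -> : (w ^ k = #|{: k.-tuple 'I_w}|)%N by rewrite card_tuple card_ord.
  rewrite -cardX; apply eq_card => -[s [[x y] z]]; rewrite !inE /coprime_box /=.
  by rewrite andbT.
have := cardC [pred y : 'I_n * 'I_n | coprime y.1.+1 y.2.+1].
rewrite card_prod !card_ord => e.
have {}h : (n ^ 2 <= 4 * #|[pred y : 'I_n * 'I_n | coprime y.1.+1 y.2.+1]|)%N.
  move: h e; rewrite mulnn (_ : #|[predC _]| = #|[pred y : 'I_n * 'I_n | ~~ coprime y.1.+1 y.2.+1]|).
    by move: #|_| #|_| (n ^ 2)%N => u v x; lia.
  by apply eq_card => y; rewrite !inE.
have -> : (n ^ 3 = n ^ 2 * n)%N by rewrite expnSr.
move: h; move: #|_| => c h; apply: leq_trans (_ : 4 * c * n * w ^ k <= _)%N.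
  by rewrite !leq_mul2r h !orbT.
by apply: eq_leq; ring.
Qed.

Lemma param_coprime_box y : coprime_box y -> param (code (positive_box y)).
Proof.
case: y => [s [[x y] z]] cop; split; last 2 first.
- by rewrite [_.-1]/= code_last /= dec_positive.
- by rewrite code0 /= dec_positive.
have dv i : (\big[gcdn/0%N]_(c <- code (positive_box (s, (x, y, z)))) `|c| %|
    `|((code (positive_box (s, (x, y, z))))`_i)%R|)%N.
  have [lt_i|le_i] := ltnP i d; last by rewrite nth_default ?size_tuple ?dvdn0.
  rewrite (big_nth 0) size_tuple big_mkord.
  by rewrite (bigD1 (Ordinal lt_i)) //= dvdn_gcdl.
have cop1 : gcdn x.+1 y.+1 = 1%N := eqP cop.
have := dv 0%N; have := dv 1%N; rewrite code0 code1 /= !dec_positive /= => d1 d0.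
apply/eqP; rewrite -dvdn1; apply: dvdn_trans (_ : _ %| gcdn x.+1 y.+1)%N _.
  by rewrite dvdn_gcd d0.
by rewrite cop1.
Qed.

(** The fraction a_1/a_0 is in lowest terms, so psi determines a_0 and then all coefficients. *)
Lemma psi_code_inj : {in coprime_box &, injective (fun y => psi (code (positive_box y)))}.
Proof.
move=> y y' cy cy' /= e; apply: positive_box_inj; apply: (@code_inj n k).
have [_ ad a0] := param_coprime_box cy; have [_ ad' a0'] := param_coprime_box cy'.
move: cy cy'; rewrite !unfold_in /coprime_box => cy cy'.
set a := code (positive_box y) in e a0 ad *; set a' := code (positive_box y') in e a0' ad' *.
have a0n : a`_0 != 0 by rewrite gt_eqF.
have a0n' : a'`_0 != 0 by rewrite gt_eqF.
have ce i : (numer a)`_i * a'`_0 = (numer a')`_i * a`_0.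
  have := congr1 (fun p : {poly rat} => p`_i) e; rewrite !coef_psi // => /eqP.
  rewrite eqr_div ?intr_eq0 // -!rmorphM eqr_int => /eqP ->.
  by [].
have a00 : a`_0 = a'`_0.
  have A0 : a`_0 = y.2.1.1.+1%:Z by rewrite /a code0 /= dec_positive.
  have A1 : a`_1 = y.2.1.2.+1%:Z by rewrite /a code1 /= dec_positive.
  have A0' : a'`_0 = y'.2.1.1.+1%:Z by rewrite /a' code0 /= dec_positive.
  have A1' : a'`_1 = y'.2.1.2.+1%:Z by rewrite /a' code1 /= dec_positive.
  have n1 : (numer a)`_1 = a`_1 by rewrite coef_numer.
  have n1' : (numer a')`_1 = a'`_1 by rewrite coef_numer.
  have := ce 1%N; rewrite n1 n1' A0 A1 A0' A1'.
  move/eqP; rewrite -!PoszM eqz_nat => /eqP e1; congr Posz; apply/eqP; rewrite eqn_dvd.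
  rewrite -(@Gauss_dvdr _ y.2.1.2.+1 y'.2.1.1.+1) // e1 dvdn_mull //=.
  by rewrite -(@Gauss_dvdr _ y'.2.1.2.+1 y.2.1.1.+1) // -e1 dvdn_mull.
have ne i : (numer a)`_i = (numer a')`_i.
  by apply: (mulIf a0n'); rewrite ce a00.
apply: eq_from_tnth => i; rewrite !(tnth_nth 0).
have [id|id] := ltnP i d.-1.
  by have := ne i; rewrite !coef_numer // ltn_eqF ?id // (leq_trans id) // leq_pred.
have -> : (i : nat) = d.-1 by have := ltn_ord i; lia.
by have := ne d; rewrite !coef_numer // eqxx.
Qed.

End CountPolynomials.

Section Proportion.
Variables (R : realType) (k : nat) (X : R).
Local Notation d := k.+3.
Let n := Num.truncn X.
Local Notation w := (2 * n).+1.
Hypothesis X_ge1 : 1 <= X.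

Let X_ge0 : 0 <= X. Proof. exact: le_trans X_ge1. Qed.

Lemma polysH_code (t : box n k) : param (code t) -> polysH d X (psi (code t)).
Proof.
move=> pt; exists (code t) => //; split=> //.
apply: le_trans (_ : n%:R <= X); first by rewrite ler_nat coefH_code.
by rewrite truncn_le.
Qed.

Lemma polysH_decode u : polysH d X u ->
  exists2 t : box n k, param (code t) & u = psi (code t).
Proof.
case=> a [pa aX] <-; have [|t tE] := @code_surj n k a; first by rewrite truncn_ge_nat.
by exists t; rewrite tE.
Qed.

Lemma finite_polysH : finite_set (polysH d X).
Proof.
apply: (@sub_finite_set _ _ [set psi (code t) | t in [set: box n k]]).
  by move=> u /polysH_decode[t _ ->]; exists t.
exact/finite_image/finite_finset.
Qed.

(** Here 108 = 27 * 4: w <= 3n for three coordinates, and the proportion 1/4 of coprime pairs. *)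
Lemma card_polysH : (w ^ d <= 108 * #|` fset_set (polysH d X)|)%N.
Proof.
have n0 : (0 < n)%N by rewrite truncn_gt0.
have h1 : (#|@coprime_box n k| <= #|` fset_set (polysH d X)|)%N.
  apply: (card_fset_set_ge finite_polysH (@psi_code_inj n k)) => y cy.
  by apply/polysH_code/param_coprime_box.
have h2 := card_coprime_box n k.
have h3 : (w ^ 3 <= 27 * n ^ 3)%N.
  by rewrite (_ : 27 = 3 ^ 3)%N // -expnMn leq_exp2r //; lia.
apply: leq_trans (_ : 27 * n ^ 3 * w ^ k <= _)%N.
  by rewrite -addn3 expnD mulnC leq_mul2r h3 orbT.
apply: leq_trans (_ : 27 * (4 * #|` fset_set (polysH d X)|) <= _)%N; last by lia.
rewrite -mulnA leq_mul2l; apply: leq_trans h2 _; by rewrite leq_mul2l h1.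
Qed.

(** The polynomials outside [G] are images of vectors in [B], so there are at most as many; the
    denominator is bounded below by [card_polysH]. *)
Lemma proportion_bounds (G : set {poly rat}) (B : pred (box n k)) :
  (forall t, param (code t) -> ~~ B t -> G (psi (code t))) ->
  1 - 108 * #|B|%:R / w%:R ^+ d <=
  proportion R [set p | polysH d X p /\ G p] (polysH d X) <= 1.
Proof.
move=> hB; set P := polysH d X; set A := [set p | _].
have finP : finite_set P := finite_polysH.
have AP : A `<=` P by move=> p [].
have finA : finite_set A := sub_finite_set AP finP.
have finD : finite_set (P `\` A) by apply: sub_finite_set finP => p [].
have cD : (#|` fset_set (P `\` A)| <= #|B|)%N.
  apply: (card_fset_set_le (f := fun t => psi (code t)) finD) => u [Pu nAu].
  have [t pt uE] := polysH_decode Pu; exists t => //.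
  apply/negPn/negP => nB; apply: nAu; split=> //; rewrite uE; exact: hB.
have cA : (#|` fset_set A| <= #|` fset_set P|)%N by apply: fsubset_leq_card; rewrite -fset_set_sub.
have cPA : (#|` fset_set P| - #|` fset_set A| <= #|B|)%N.
  by rewrite -cardfsDS -?fset_setD // -fset_set_sub.
have w0 : 0 < w%:R ^+ d :> R by rewrite exprn_gt0.
have P0 : 0 < #|` fset_set P|%:R :> R.
  have := card_polysH; rewrite ltr0n -/P lt0n; apply: contraTneq => ->.
  by rewrite muln0 -ltnNge expn_gt0.
rewrite /proportion; apply/andP; split; last by rewrite ler_pdivrMr // mul1r ler_nat.
have h1 : w%:R ^+ d <= 108 * #|` fset_set P|%:R :> R.
  by rewrite -natrX -natrM ler_nat card_polysH.
have h2 : #|` fset_set P|%:R <= #|B|%:R + #|` fset_set A|%:R :> R.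
  by rewrite -natrD ler_nat; lia.
rewrite ler_pdivlMr // mulrBl mul1r lerBlDr; apply: le_trans h2 _.
rewrite addrC lerD2l.
have -> : 108 * #|B|%:R / w%:R ^+ d * #|` fset_set P|%:R =
   #|B|%:R / w%:R ^+ d * (108 * #|` fset_set P|%:R) :> R by ring.
apply: le_trans (_ : #|B|%:R / w%:R ^+ d * w%:R ^+ d <= _); first by rewrite divfK ?gt_eqF.
by rewrite ler_wpM2l // divr_ge0 // ltW.
Qed.

End Proportion.

(** The increment is bounded by 1/(n+1) <= -log(1 - 1/(n+1)). *)
Lemma harmonic_le_ln (R : realType) (n : nat) : (0 < n)%N ->
  \sum_(1 <= t < n.+1) t%:R^-1 <= 1 + ln n%:R :> R.
Proof.
elim: n => [//|[|n] IHn] _; first by rewrite big_nat1 invr1 ln1 addr0.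
rewrite big_nat_recr //=; apply: le_trans (lerD (IHn isT) (lexx _)) _.
rewrite -addrA lerD2l -lerBrDl -ln_div ?posrE //.
rewrite -lerN2 -lnV ?posrE ?divr_gt0 // invf_div.
have -> : n.+1%:R / n.+2%:R = 1 + - n.+2%:R^-1 :> R.
  by rewrite -[in n.+2%:R^-1](addn1 n.+1) natrD; field; rewrite gt_eqF // ltr_pwDr.
by apply: le_ln1Dx; rewrite ltrN2 invf_lt1 // ltr1n.
Qed.

(** * Total density of the exceptional sets *)

Section TotalBad.
Variables (R : realType) (n k b Y N M K : nat) (Lj : 'I_N -> seq nat).
Local Notation w := (2 * n).+1.
Local Notation d := k.+3.
Hypotheses (n_gt0 : (0 < n)%N) (b_gt0 : (0 < b)%N) (b_w : (b <= w)%N).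
Hypotheses (Y_gt0 : (0 < Y)%N) (K_gt0 : (0 < K)%N).
Hypothesis L_size : forall j, size (Lj j) = M.
Hypothesis L_prime : forall j, all prime (Lj j).
Hypothesis L_uniq : forall j, uniq (Lj j).
Hypothesis L_large : forall j l, l \in Lj j -> (2 * d + 2 <= l)%N /\ (K <= l)%N.
Hypothesis L_prod : forall j, (\prod_(l <- Lj j) l <= w)%N.

Definition bad_coef (t : box n k) : bool :=
  [|| bad_small b t, bad_tau b t, bad_gcd b t, bad_square b t, bad_psi b 1 t | bad_psi b Y t].

Definition bad_prime (t : box n k) : bool :=
  [exists j, has (fun l => bad_div l t) (Lj j)] || [exists j, bad_sieve (Lj j) t].

Let dens (P : pred (box n k)) : R := #|P|%:R / w%:R ^+ d.

Let dens_le (P : pred (box n k)) (e C : nat) (c : R) : (0 < e)%N ->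
  (e * #|P| <= C)%N -> C%:R <= w%:R ^+ d * c -> dens P <= c / e%:R.
Proof.
move=> e0 h1 h2; rewrite /dens ler_pdivrMr // mulrAC ler_pdivlMr ?ltr0n //.
by rewrite -natrM mulnC [c * _]mulrC; apply: le_trans h2; rewrite ler_nat.
Qed.

Let dens_le_nat (P : pred (box n k)) (e c : nat) : (0 < e)%N ->
  (e * #|P| <= w ^ k.+2 * (c * w))%N -> dens P <= c%:R / e%:R.
Proof.
move=> e0 /dens_le; apply => //.
by rewrite -natrX -natrM ler_nat [(c * w)%N]mulnC mulnA -expnSr.
Qed.

Let dens_tau : dens (bad_tau b) <= 2 * (1 + ln n%:R) / b%:R.
Proof.
apply: dens_le b_gt0 (card_bad_tau n k b) _.
rewrite natrM natrX [w%:R ^+ d]exprSr -[leRHS]mulrA ler_pM2l ?exprn_gt0 //.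
apply: le_trans (_ : w%:R * (2 * \sum_(1 <= t < n.+1) t%:R^-1) <= _); last first.
  by rewrite ler_wpM2l // ler_wpM2l // harmonic_le_ln.
rewrite natr_sum mulrA mulr_sumr [w%:R * 2]mulrC -natrM.
apply: ler_sum_nat => t /andP[t0 _]; rewrite ler_pdivlMr ?ltr0n // -natrM ler_nat.
exact: leq_trunc_div.
Qed.

(** In the first term 58 = 4 + 2 + 2 + 2 + 24 + 24, the first 2 coming with 2 log n from the number
    of divisors. The other two terms belong to the auxiliary primes: divisibility of a_0 or a_d by
    one of them, and failure of a whole block in the sieve. *)
Lemma density_bad :
  dens [pred t | bad_coef t || bad_prime t] <=
  (58 + 2 * ln n%:R) / b%:R + (N * M)%:R * (4 / K%:R) +
  N%:R * (2 * ((2 * d).-1%:R / (2 * d)%:R) ^+ M).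
Proof.
have union : (#|[pred t | bad_coef t || bad_prime t]| <=
  #|@bad_small n k b| + (#|@bad_tau n k b| + (#|@bad_gcd n k b| + (#|@bad_square n k b| +
  (#|@bad_psi n k b 1| + #|@bad_psi n k b Y|)))) +
  (\sum_j \sum_(l <- Lj j) #|@bad_div n k l| + \sum_j #|@bad_sieve n k (Lj j)|))%N.
  have -> : (\sum_j \sum_(l <- Lj j) #|@bad_div n k l| =
      \sum_(t : box n k) \sum_j \sum_(l <- Lj j) bad_div l t)%N.
    rewrite exchange_big; apply: eq_bigr => j _; rewrite exchange_big.
    by apply: eq_bigr => l _; rewrite card_sum_nat.
  have -> : (\sum_j #|@bad_sieve n k (Lj j)| = \sum_(t : box n k) \sum_j bad_sieve (Lj j) t)%N.
    by rewrite exchange_big; apply: eq_bigr => j _; rewrite card_sum_nat.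
  rewrite !card_sum_nat -!big_split /=; apply: leq_sum => t _.
  have leq_orb (u v : bool) (x y : nat) : (u <= x -> v <= y -> u || v <= x + y)%N.
    by case: u => //= ux vy; [rewrite (leq_trans ux) ?leq_addr | rewrite (leq_trans vy) ?leq_addl].
  rewrite /bad_coef /bad_prime; do ![apply: (leq_orb) => //].
    case: existsP => // -[j /hasP[l lL bl]].
    by rewrite (bigD1 j) //= (big_rem l) //= bl.
  by case: existsP => // -[j bj]; rewrite (bigD1 j) //= bj.
have denslin : dens [pred t | bad_coef t || bad_prime t] <=
  dens (@bad_small n k b) + (dens (@bad_tau n k b) + (dens (@bad_gcd n k b) +
  (dens (@bad_square n k b) + (dens (@bad_psi n k b 1) + dens (@bad_psi n k b Y))))) +
  (\sum_j \sum_(l <- Lj j) dens (@bad_div n k l) + \sum_j dens (@bad_sieve n k (Lj j))).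
  apply: le_trans (_ : (#|@bad_small n k b| + (#|@bad_tau n k b| + (#|@bad_gcd n k b| + (#|@bad_square n k b| +
  (#|@bad_psi n k b 1| + #|@bad_psi n k b Y|)))) +
  (\sum_j \sum_(l <- Lj j) #|@bad_div n k l| + \sum_j #|@bad_sieve n k (Lj j)|))%N%:R / w%:R ^+ d <= _).
    by rewrite /dens ler_pM2r ?invr_gt0 // ler_nat.
  rewrite !natrD !natr_sum !mulrDl !mulr_suml.
  by under eq_bigr => j _ do rewrite natr_sum mulr_suml.
apply: le_trans denslin _; rewrite -[leRHS]addrA; apply: lerD.
  have -> : (58 + 2 * ln n%:R) / b%:R = 4%:R / b%:R + (2 * (1 + ln n%:R) / b%:R +
     (2%:R / b%:R + (2%:R / b%:R + (24%:R / b%:R + 24%:R / b%:R)))) :> R.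
    by rewrite -!mulrDl; congr (_ / _); ring.
  have psi_dens y : (0 < y)%N -> dens (bad_psi b y) <= 24%:R / b%:R.
    move=> y0; apply: dens_le_nat => //; apply: leq_trans (card_bad_psi n k b_gt0 y0) _.
    by apply: eq_leq; rewrite !expnS expn0; ring.
  do ![apply: lerD => //]; try exact: psi_dens.
  - by apply: dens_le_nat => //; apply: card_bad_small.
  - by apply: dens_le_nat => //; apply: card_bad_gcd.
  - by apply: dens_le_nat => //; apply: card_bad_square.
apply: lerD.
  apply: le_trans (_ : \sum_(j < N) \sum_(l <- Lj j) 4 / K%:R <= _); last first.
    rewrite (eq_bigr (fun=> M%:R * (4 / K%:R))) => [|j _].
      by rewrite sumr_const card_ord natrM -mulrA [leRHS]mulr_natl.
    by rewrite big_const_seq count_predT L_size iter_addr addr0 [RHS]mulr_natl.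
  apply: ler_sum => j _; rewrite big_seq [leRHS]big_seq; apply: ler_sum => l lL.
  have [h1 h2] := L_large lL.
  have l0 : (0 < l)%N := leq_trans K_gt0 h2.
  apply: le_trans (_ : 4%:R / l%:R <= _).
    apply: (@dens_le_nat _ l 4) => //; apply: (card_bad_div k b_gt0); rewrite l0 /=.
    apply: leq_trans (L_prod j); rewrite (big_rem l) //= leq_pmulr //.
    rewrite big_seq; elim/big_ind: _ => // [x y x0 y0|p /mem_rem pL]; first by rewrite muln_gt0 x0.
    by have [_ /(leq_trans K_gt0)] := L_large pL.
  by rewrite ler_wpM2l // lef_pV2 ?posrE ?ltr0n // ler_nat.
apply: le_trans (_ : \sum_(j < N) 2 * ((2 * d).-1%:R / (2 * d)%:R) ^+ M <= _); last first.
  by rewrite sumr_const card_ord [leRHS]mulr_natl.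
apply: ler_sum => j _; rewrite expr_div_n mulrA -!natrX -natrM.
apply: dens_le_nat; first by rewrite expn_gt0.
have := card_bad_sieve (n := n) (k := k) (L_prime j) (L_uniq j)
  (fun l lL => (L_large lL).1) (L_prod j).
by rewrite L_size => h; apply: leq_trans h _; apply: eq_leq; ring.
Qed.

End TotalBad.

(** One block of candidate primes for each point; disjointness of the blocks makes the chosen primes
    distinct. *)
Lemma prime_blocks (N M K : nat) : exists L : 'I_N -> seq nat,
  (forall j, [/\ size (L j) = M, all prime (L j), uniq (L j) &
     forall l, l \in L j -> (K <= l)%N]) /\
  (forall i j l, l \in L i -> l \in L j -> i = j).
Proof.
pose next (x : nat) : nat := s2val (prime_above x).
pose P i := iter i next (next K).
have next_prime x : prime (next x) by rewrite /next; case: prime_above.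
have next_gt x : (x < next x)%N by rewrite /next; case: prime_above.
have P_prime i : prime (P i) by case: i => [|i]; apply: next_prime.
have P_lt i : (P i < P i.+1)%N by apply: next_gt.
have P_ge i : (K <= P i)%N.
  by elim: i => [|i IHi]; [apply/ltnW/next_gt | apply: leq_trans IHi (ltnW (P_lt i))].
have P_inj : injective P.
  have h : {homo P : i j / (i < j)%N} by apply: homo_ltn P_lt; apply: ltn_trans.
  by move=> i j e; case: (ssrnat.ltngtP i j) => // /h; rewrite e ltnn.
exists (fun j => [seq P (j * M + i)%N | i <- iota 0 M]); split.
  move=> j; split.
  - by rewrite size_map size_iota.
  - by apply/allP => _ /mapP[i _ ->].
  - by rewrite map_inj_uniq ?iota_uniq // => i i' /P_inj /addnI.
  - by move=> _ /mapP[i _ ->].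
move=> i j _ /mapP[u + ->] /mapP[v + /P_inj e]; rewrite !mem_iota !add0n /= => uM vM.
apply: ord_inj; have M0 : (0 < M)%N := leq_ltn_trans (leq0n u) uM.
have := congr1 (fun x => x %/ M)%N e.
by rewrite /= !divnMDl // !divn_small // !addn0.
Qed.

Lemma nat_root (m e : nat) : (0 < e)%N -> exists r, (r ^ e <= m < r.+1 ^ e)%N.
Proof.
move=> e0; pose P r := (r ^ e <= m)%N.
have P0 : P 0%N by rewrite /P exp0n.
have Pm r : P r -> (r <= m)%N.
  by apply: leq_trans; case: r => // r; rewrite -[leqLHS]expn1 leq_pexp2l.
case: (ex_maxnP (ex_intro P 0%N P0) Pm) => r Pr rmax; exists r; rewrite [X in X && _]Pr /=.
by rewrite ltnNge; apply/negP => /rmax; rewrite ltnn.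
Qed.

(** * Choice of the parameters *)

Section AlmostAll.
Variable R : realType.

(** For b about n^(1/J), log n is at most J log(b+1), and log(b+1) <= 4 sqrt(b). The square of [c]
    ensures that sqrt(b) exceeds (58 + 8J)/eta. *)
Lemma log_negligible (J : nat) (eta : R) : 0 < eta -> exists b0 : nat,
  forall b (x : R), (0 < b)%N -> (b0 <= b)%N -> x <= J%:R * ln b.+1%:R ->
  (58 + 2 * x) / b%:R <= eta.
Proof.
move=> eta0; pose c : R := (58 + 8 * J%:R) / eta.
have c0 : 0 <= c by rewrite divr_ge0 ?addr_ge0 ?mulr_ge0 // ltW.
exists (Num.truncn (c ^+ 2)).+1 => b x b0 hb hx.
have bR : 0 < b%:R :> R by rewrite ltr0n.
have b1 : 1 <= b%:R :> R by rewrite ler1n.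
pose s : R := Num.sqrt b%:R.
have s1 : 1 <= s by rewrite -[leLHS]sqrtr1 ler_wsqrtr.
have ss : s ^+ 2 = b%:R by rewrite sqr_sqrtr ?ltW.
have cs : c <= s.
  rewrite -(@ler_pXn2r _ 2) ?nnegrE ?sqrtr_ge0 // ss.
  apply: le_trans (ltW (truncnS_gt _)) _.
  by rewrite ler_nat.
have lnb : ln b.+1%:R <= 4 * s.
  have h : b.+1%:R <= (2 * s) ^+ 2 by rewrite exprMn ss -addn1 natrD -natrX; lra.
  have s20 : 0 < 2 * s by rewrite mulr_gt0 // (lt_le_trans ltr01).
  apply: le_trans (_ : ln ((2 * s) ^+ 2) <= _); first by rewrite ler_ln ?posrE ?exprn_gt0.
  by rewrite lnXn // mulr2n; have := ltW (ln_sublinear s20); lra.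
rewrite ler_pdivrMr // -ss.
have hx' : x <= J%:R * (4 * s) by apply: le_trans hx _; rewrite ler_wpM2l.
have cE : 58 + 8 * J%:R = c * eta by rewrite divfK // gt_eqF.
have h1 : 58 + 2 * x <= (58 + 8 * J%:R) * s.
  rewrite mulrDl; have : 58 <= 58 * s :> R by rewrite ler_peMr.
  lra.
apply: le_trans h1 _; rewrite cE expr2 mulrAC [c * s * eta]mulrC ler_wpM2l ?(ltW eta0) //.
by rewrite ler_wpM2r // ltW // (lt_le_trans ltr01).
Qed.

Lemma geometric_small (q eta : R) : 0 <= q -> q < 1 -> 0 < eta -> exists M, q ^+ M <= eta.
Proof.
move=> q0 q1 eta0.
have : (fun M => q ^+ M) @ \oo --> (0 : R) by apply: cvg_expr; rewrite ger0_norm.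
move/cvgrPdist_le => /(_ eta eta0) [M _ hM]; exists M.
by have := hM M (leqnn M); rewrite sub0r normrN ger0_norm // exprn_ge0.
Qed.

(** The order of the choices matters: [M], [K] and the prime blocks depend on [eta], [J] on [dl],
    and all of them are fixed before [X]; only [b] and [Y] vary with [X]. *)
Lemma almost_all (k N : nat) (dl eta : R) : (2 <= N)%N -> 0 < dl -> 0 < eta ->
  dl < (k.+3%:R * (k.+3%:R - 1))^-1 ->
  exists X0 : R, forall X, X0 <= X ->
  let n := Num.truncn X in let L := ln n%:R in
  [/\ 1 <= X, 0 < L & exists B : pred (box n k),
    108 * #|B|%:R / (2 * n).+1%:R ^+ k.+3 <= eta /\
    forall t, param (code t) -> ~~ B t ->
    exists l1 l2 lN, [/\ succ_min k.+3 (psi (code t)) 1 l1,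
      succ_min k.+3 (psi (code t)) 2 l2, succ_min k.+3 (psi (code t)) N lN,
      L / (k.+3%:R * (k.+3%:R - 1)) - dl * L <= l1
        <= L / (k.+3%:R * (k.+3%:R - 1)) + dl * L &
      [/\ L / (k.+3%:R + 3) - dl * L <= l2, l2 <= lN &
          lN <= L / (k.+3%:R - 1) + dl * L]]].
Proof.
move=> N2 dl0 eta0 dl_small; set d := k.+3.
(* 324 = 3 * 108: the three terms of the density bound, times the constant of [card_polysH]. *)
pose et := eta / 324%:R; have et0 : 0 < et by apply: divr_gt0 => //; rewrite ltr0n.
pose q : R := (2 * d).-1%:R / (2 * d)%:R.
have q0 : 0 <= q by rewrite divr_ge0.
have q1 : q < 1 by rewrite ltr_pdivrMr ?mul1r ?ltr_nat.
have N0 : 0 < N%:R :> R by rewrite ltr0n ltnW.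
have etN : 0 < et / (N%:R * 2) by rewrite divr_gt0 ?mulr_gt0.
have [M hM] := geometric_small q0 q1 etN.
(* The first summand serves the residue count; the second makes divisibility by one of the N M
   primes rare. *)
pose K := ((2 * d + 2) + (Num.truncn ((N * M)%:R * 4 / et)).+1)%N.
have K0 : (0 < K)%N by rewrite /K addnS ltn0Sn.
have hK : (N * M)%:R * (4 / K%:R) <= et.
  rewrite mulrA ler_pdivrMr ?ltr0n // [leRHS]mulrC -ler_pdivrMr //.
  apply: le_trans (ltW (truncnS_gt _)) _.
  by rewrite ler_nat leq_addl.
have [Lj [Lj1 Lj2]] := prime_blocks N M K.
have Ljp j : (0 < \prod_(l <- Lj j) l)%N.
  have [_ /allP pr _ _] := Lj1 j.
  rewrite big_seq; elim/big_ind: _ => // [x y x0 y0|l /pr/prime_gt0 //].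
  by rewrite muln_gt0 x0.
pose W := (\prod_j \prod_(l <- Lj j) l)%N.
(* Half of the margin [dl * L] is for 5 log b <= 5L/J, the other half for the constant [c0]. *)
pose J := (Num.truncn (10 / dl)).+1.
have hJ : 5 / J%:R <= dl / 2.
  rewrite ler_pdivrMr ?ltr0n //.
  have : 10 / dl <= J%:R by apply: ltW (truncnS_gt _).
  rewrite ler_pdivrMr // => h; lra.
pose c0 : R := ln (2 * d)%:R + ln d.+1%:R + ln W%:R.
have c0_ge0 : 0 <= c0 by rewrite !addr_ge0 ?ln_nat_ge0.
have [b0 hb0] := log_negligible J et0.
(* The summands ensure in turn b >= b0, W <= n, c0 <= (dl/2) L and L > 0. *)
pose n0 := ((b0 ^ J) + W + (Num.truncn (expR (2 * c0 / dl))).+1 + 2)%N.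
exists n0%:R => X hX n L.
have X1 : 1 <= X by apply: le_trans hX; rewrite ler1n /n0 addnS.
have n0n : (n0 <= n)%N by rewrite truncn_ge_nat // (le_trans _ X1).
have n2 : (2 <= n)%N by apply: leq_trans n0n; rewrite leq_addl.
have n_gt0 : (0 < n)%N := ltnW n2.
have L0 : 0 < L by rewrite ln_gt0 // ltr1n.
split=> //.
have Wn : (W <= n)%N.
  by apply: leq_trans n0n; rewrite /n0 -!addnA addnCA leq_addr.
have Lc : c0 <= dl / 2 * L.
  have h : 2 * c0 / dl <= L.
    rewrite -[leLHS]expRK ler_ln ?posrE ?expR_gt0 ?ltr0n //.
    apply: le_trans (ltW (truncnS_gt _)) _; rewrite ler_nat.
    by apply: leq_trans n0n; rewrite /n0 -addnA addnCA leq_addr.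
  by move: h; rewrite ler_pdivrMr // => h; lra.
have [b /andP[b_le b_gt]] := nat_root n (ltn0Sn _ : 0 < J)%N.
have b_gt0 : (0 < b)%N.
  by rewrite lt0n; apply: contraTneq b_gt => ->; rewrite exp1n -leqNgt.
have b0b : (b0 <= b)%N.
  rewrite leqNgt; apply/negP => hb; move: b_gt; rewrite ltnNge => /negP; apply.
  apply: leq_trans (_ : b0 ^ J <= _)%N; first by rewrite leq_exp2r.
  by apply: leq_trans n0n; rewrite /n0 -!addnA leq_addr.
have bn : (b <= n)%N.
  by apply: leq_trans b_le; rewrite -[leqLHS]expn1 leq_pexp2l.
have lnXn' (m e : nat) : (0 < m)%N -> ln (m ^ e)%:R = e%:R * ln m%:R :> R.
  by move=> m0; rewrite natrX lnXn ?ltr0n // mulr_natl.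
have lnle (m p : nat) : (0 < m)%N -> (m <= p)%N -> ln m%:R <= ln p%:R :> R.
  by move=> m0 mp; rewrite ler_ln ?posrE ?ltr0n ?ler_nat // (leq_trans m0).
have Lb : L <= J%:R * ln b.+1%:R by rewrite -lnXn' //; apply: lnle => //; apply: ltnW.
have bL : J%:R * ln b%:R <= L by rewrite -lnXn' //; apply: lnle; rewrite ?expn_gt0 ?b_gt0.
(* The balancing height n^(2/(d+3)), rounded down. *)
have [Y /andP[Y_le Y_gt]] := nat_root (n ^ 2) (ltn0Sn _ : 0 < d + 3)%N.
have Y_gt0 : (0 < Y)%N.
  by rewrite lt0n; apply: contraTneq Y_gt => ->; rewrite exp1n -leqNgt expn_gt0 n_gt0.
have hs j : size (Lj j) = M by have [] := Lj1 j.
have hp j : all prime (Lj j) by have [] := Lj1 j.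
have hu j : uniq (Lj j) by have [] := Lj1 j.
have hl j l : l \in Lj j -> (2 * d + 2 <= l)%N /\ (K <= l)%N.
  have [_ _ _ h] := Lj1 j => /h Kl; split=> //.
  by apply: leq_trans Kl; apply: leq_addr.
have WE j : (\prod_(l <- Lj j) l <= W)%N.
  by rewrite /W (bigD1 j) //= leq_pmulr // prodn_gt0.
have nw : (n <= (2 * n).+1)%N by rewrite leqW // mul2n -addnn leq_addr.
have hprod j : (\prod_(l <- Lj j) l <= (2 * n).+1)%N.
  by apply: leq_trans (WE j) (leq_trans Wn nw).
have bw : (b <= (2 * n).+1)%N := leq_trans bn nw.
have E1 := hb0 b L b_gt0 b0b Lb.
have E3 : N%:R * (2 * q ^+ M) <= et.
  by rewrite mulrA -ler_pdivlMl ?mulr_gt0 // mulrC.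
have hD : 5 * ln b%:R + ln (2 * d)%:R + ln d.+1%:R + ln W%:R <= dl * L.
  have h5 : 5 * ln b%:R <= dl / 2 * L.
    have JR : 0 < J%:R :> R by rewrite ltr0n.
    apply: le_trans (_ : 5 / J%:R * L <= _); last by rewrite ler_wpM2r // ltW.
    by rewrite mulrAC ler_pdivlMr // -mulrA ler_wpM2l // mulrC.
  move: h5 Lc; rewrite /c0.
  move: (ln b%:R) (ln (2 * d)%:R) (ln d.+1%:R) (ln W%:R) (dl) => *; lra.
have hpos : 0 < L / (d%:R * (d%:R - 1)) - dl * L.
  by rewrite mulrC -mulrBl mulr_gt0 // subr_gt0.
clear hX n0n hb0 Lc hJ c0_ge0 hM X1.
have WD : W = (\prod_j \prod_(l <- Lj j) l)%N by [].
have LE : L = ln n%:R by [].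
have etE : 108 * (et + et + et) = eta by rewrite /et; field.
clearbody n L W K J et.
exists [pred t | bad_coef b Y t || bad_prime Lj t]; split.
  have h := density_bad R n_gt0 b_gt0 bw Y_gt0 K0 hs hp hu hl hprod.
  rewrite -mulrA; apply: le_trans (_ : 108 * (et + et + et) <= _).
    rewrite ler_wpM2l //; apply: le_trans h _.
    by rewrite !lerD -?LE.
  by rewrite etE.
move=> [s [[x0 x1] xd]] [_ pd p0]; rewrite /= negb_or => /andP[nc np].
rewrite [_.-1]/= code_last in pd; rewrite code0 /= in p0.
have x0n : dec x0 != 0 by rewrite gt_eqF.
move: np; rewrite /bad_prime negb_or => /andP[/existsPn nd /existsPn ns].
have /choice[lr lrP] : forall j, exists lr : nat * int,
    lr.1 \in Lj j /\ good_prime (code (s, ((x0, x1), xd))) lr.1 lr.2.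
  move=> j; have /allPn[l lL] := ns j; rewrite negb_and negbK /=.
  have := nd j; rewrite -all_predC => /allP/(_ l lL) /=.
  rewrite /bad_div negb_or /= => /andP[l0 ld].
  have l0' : ~~ (l%:Z %| dec x0)%Z by rewrite dvdzE.
  have ld' : ~~ (l%:Z %| dec xd)%Z by rewrite dvdzE.
  rewrite (negbTE l0') /= => /forallPn[r]; rewrite negbK => fr.
  exists (l, (r : nat)%:Z); split=> //.
  by apply: good_prime_code => //; apply: (allP (hp j)).
have inj_l : injective (fun j => (lr j).1).
  by move=> i j e; apply: (Lj2 i j (lr i).1); [have [] := lrP i | rewrite e; have [] := lrP j].
have le_W : (\prod_j (lr j).1 <= W)%N.
  rewrite WD; apply: leq_prod => j _; have [lL _] := lrP j.
  rewrite (big_rem _ lL) /= leq_pmulr // big_seq.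
  elim/big_ind: _ => // [x y x_gt0 y_gt0|p /mem_rem pL]; first by rewrite muln_gt0 x_gt0.
  by apply/prime_gt0/(allP (hp j)).
move: nc; rewrite /bad_coef => /norP[n1 /norP[n2' /norP[n3 /norP[n4 /norP[n5 n6]]]]].
have pos : 0 < L / (d%:R * (d%:R - 1)) -
    (5 * ln b%:R + ln (2 * d)%:R + ln d.+1%:R + ln W%:R).
  by apply: lt_le_trans hpos _; rewrite lerB.
rewrite LE in pos.
have [l1 [l2 [lN [m1 m2 mN /andP[h1 h1'] [h2 h2N hN]]]]] := @good_bounds R n k b Y N W (s, ((x0, x1), xd)) n_gt0 b_gt0 Y_gt0 Y_le Y_gt x0n pd
   n1 n2' n3 n4 n5 n6 _ _ inj_l (fun j => (lrP j).2) le_W N2 pos.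
rewrite -LE in h1 h1' h2 hN.
exists l1, l2, lN; split=> //.
- by rewrite (le_trans _ h1) ?(le_trans h1') ?lerB ?lerD.
- by split=> //; [rewrite (le_trans _ h2) ?lerB | rewrite (le_trans hN) ?lerD].
Qed.

End AlmostAll.

(** With a = L/(D(D-1)) and e = dl L, the choice of [dl] means (1 + D + eps) e = eps a. This is
    exactly what Da + e <= (D + eps)(a - e) requires, and it implies the other estimates; the last
    one uses 4/(D-1) <= 2 and D >= 3. *)
Lemma minima_ratios (R : realFieldType) (D eps L l1 l2 lN : R) :
  3 <= D -> 0 < eps -> 0 < L ->
  let dl := eps / (D * (D - 1) * (1 + D + eps)) in
  L / (D * (D - 1)) - dl * L <= l1 <= L / (D * (D - 1)) + dl * L ->
  L / (D + 3) - dl * L <= l2 -> l2 <= lN -> lN <= L / (D - 1) + dl * L ->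
  [/\ D * (1 - 4 / (D + 3)) - eps < l2 / l1, l2 / l1 <= D + eps,
      1 <= lN / l2 & lN / l2 <= 1 + 4 / (D - 1) + eps].
Proof.
move=> D3 eps0 L0 dl /andP[l1_ge l1_le] l2_ge l2N lN_le.
have D1 : 0 < D - 1 by lra.
have Dp : 0 < D by lra.
have D3p : 0 < D + 3 by lra.
have S0 : 0 < 1 + D + eps by lra.
pose a := L / (D * (D - 1)); pose c := L / (D + 3).
have a0 : 0 < a by rewrite divr_gt0 ?mulr_gt0.
have e0 : 0 < dl * L by rewrite mulr_gt0 // divr_gt0 ?mulr_gt0.
have eE : (1 + D + eps) * (dl * L) = eps * a.
  by rewrite /dl /a; field; rewrite !gt_eqF.
have DaE : L / (D - 1) = D * a by rewrite /a; field; rewrite !gt_eqF.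
have ac : a <= c.
  rewrite /a /c ler_pM2l // lef_pV2 ?posrE ?mulr_gt0 //; nra.
have epac : eps * a <= eps * c by rewrite ler_pM2l.
have DcE : L / (D - 1) = (1 + 4 / (D - 1)) * c.
  by rewrite /c; field; rewrite !gt_eqF.
have acE : D * (1 - 4 / (D + 3)) * a = c.
  by rewrite /a /c; field; rewrite !gt_eqF.
rewrite -/a -/c in l1_ge l1_le l2_ge.
move: (dl * L) e0 eE l1_ge l1_le l2_ge lN_le => e e0 eE l1_ge l1_le l2_ge lN_le.
have l1_gt0 : 0 < l1 by nra.
have l2_gt0 : 0 < l2 by nra.
split.
- rewrite ltr_pdivlMr //.
  set t := D * _ in acE *.
  have tD : t <= D.
    by rewrite /t ler_piMr ?(ltW Dp) // lerBlDr lerDl divr_ge0 // ltW.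
  (* A nonpositive lower bound is immediate from l2 > 0; only a positive one may be multiplied by
     the upper bound for l1. *)
  have [t_le|t_gt] := leP (t - eps) 0; first nra.
  have : (t - eps) * l1 <= (t - eps) * (a + e) by rewrite ler_wpM2l // ltW.
  nra.
- rewrite ler_pdivrMr //; apply: le_trans l2N (le_trans lN_le _).
  rewrite DaE; nra.
- by rewrite ler_pdivlMr // mul1r.
- rewrite ler_pdivrMr //; apply: le_trans lN_le _; rewrite DcE.
  have r2 : 4 / (D - 1) <= 2 by rewrite ler_pdivrMr //; lra.
  have r0 : 0 <= 4 / (D - 1) by rewrite divr_ge0 // ltW.
  move: (4 / (D - 1)) r0 r2 => r r0 r2; nra.
Qed.

Lemma proportion_cvg1 (R : realType) (k : nat) (G : set {poly rat}) :
  (forall eta : R, 0 < eta -> exists X0 : R, forall X, X0 <= X -> 1 <= X /\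
    exists B : pred (box (Num.truncn X) k),
      108 * #|B|%:R / (2 * Num.truncn X).+1%:R ^+ k.+3 <= eta /\
      forall t, param (code t) -> ~~ B t -> G (psi (code t))) ->
  (fun X : R => proportion R [set p | polysH k.+3 X p /\ G p] (polysH k.+3 X))
    @ +oo%R --> (1 : R).
Proof.
move=> h; apply/cvgrPdist_le => eta /h[X0 hX0].
near=> X; have X0X : X0 <= X by near: X; apply: nbhs_pinfty_ge; rewrite num_real.
have [X1 [B [hB good]]] := hX0 _ X0X.
have /andP[ge le1] := proportion_bounds X1 good.
by rewrite ger0_norm ?subr_ge0 // lerBlDr -lerBlDl (le_trans _ ge) // lerB.
Unshelve. all: by end_near. Qed.

Theorem theorem1p4 (R : realType) (d N : nat) (eps : R)
    (hd : (3 <= d)%N) (heps : 0 < eps) (hN : (3 <= N)%N) :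
  ((fun X : R =>
      proportion R
        [set p | polysH d X p /\
          exists l1 l2 : R,
            [/\ succ_min d p 1 l1, succ_min d p 2 l2,
                d%:R * (1 - 4 / (d%:R + 3)) - eps < l2 / l1 &
                l2 / l1 <= d%:R + eps]]
        (polysH d X)) @ +oo%R --> (1 : R)) /\
  ((fun X : R =>
      proportion R
        [set p | polysH d X p /\
          exists l2 lN : R,
            [/\ succ_min d p 2 l2, succ_min d p N lN,
                1 <= lN / l2 &
                lN / l2 <= 1 + 4 / (d%:R - 1) + eps]]
        (polysH d X)) @ +oo%R --> (1 : R)).
Proof.
have [k dE] : exists k, d = k.+3 by exists (d - 3)%N; lia.
subst d.
have D3 : 3 <= k.+3%:R :> R by rewrite ler_nat.
pose dl : R := eps / (k.+3%:R * (k.+3%:R - 1) * (1 + k.+3%:R + eps)).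
have Q0 : 0 < k.+3%:R * (k.+3%:R - 1) :> R by rewrite mulr_gt0 //; lra.
have S0 : 0 < 1 + k.+3%:R + eps by lra.
have dl0 : 0 < dl by rewrite divr_gt0 ?mulr_gt0.
have dl_small : dl < (k.+3%:R * (k.+3%:R - 1))^-1.
  by rewrite /dl ltr_pdivrMr ?mulr_gt0 // mulKf ?gt_eqF //; lra.
split; apply: proportion_cvg1 => eta eta0;
  have [X0 hX0] := almost_all (ltnW hN) dl0 eta0 dl_small;
  exists X0 => X /hX0[X1 L0 [B [hB good]]]; split=> //; exists B; split=> // t pt nB;
  have [l1 [l2 [lN [m1 m2 mN b1 [b2 b2N bN]]]]] := good t pt nB;
  have [r1 r2 r3 r4] := minima_ratios D3 heps L0 b1 b2 b2N bN.
- by exists l1, l2.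
- by exists l2, lN.
Qed.
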